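(* Let $M$ and $M'$ be smooth (abstract) CR-manifolds with $\dim M=\dim M'$. Suppose that there exist a number $r$ and a smooth map $\Phi\colon G^r(M,M')\to J^{r+1}(M,M')$ such that every smooth CR-diffeomorphism $f$ between open pieces of $M$ and $M'$ satisfies $j_x^{r+1}f\equiv\Phi(x,j_x^rf)$ for all $x$ in the domain of definition of $f$. Then for any $p\in M$ and $p'\in M'$ there exist an open neighborhood $\Omega$ of $\{p\}\times G^r_{p,p'}(M,M')$ in $M\times G^r(M,M')$ and a smooth map $\Psi\colon\Omega\to M'$ such that every smooth CR-map $f$ from a neighborhood of a point $q\in M$ into $M'$ with $(q,j_q^rf)\in\Omega$ satisfies the identity $$f(x)\equiv\Psi(x,q,j_q^rf)$$ for all $x\in M$ sufficiently close to $q$.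
   Context: ''Smooth'' means $\mathcal C^\infty$. An (abstract) CR-manifold of CR-dimension $n$ and CR-codimension $d$ is a smooth real $(2n+d)$-dimensional manifold $M$ together with a subbundle $T^cM\subset TM$ of rank $2n$ and a bundle automorphism $J\colon T^cM\to T^cM$ with $J^2=-\mathrm{id}$ such that the commutator of any two $(0,1)$ vector fields (sections of the bundle of vectors $X+iJX$, $X\in T^cM$) is again a $(0,1)$ vector field. A map $f\colon M\to M'$ is CR if $df(T^cM)\subset T^cM'$ and $df\circ J=J'\circ df$ on $T^cM$; a CR-diffeomorphism is a diffeomorphism $f$ such that $f$ and $f^{-1}$ are CR. An open piece is an open subset. $J^k(M,M')$ is the bundle of all $k$-jets of smooth maps between open pieces of $M$ and $M'$; $j_x^kf$ is the $k$-jet of $f$ at $x$, and $(x,j_x^kf)$ denotes the corresponding element of $J^k(M,M')$. If $\dim M=\dim M'$, $G^k(M,M')\subset J^k(M,M')$ is the open subset of all jets of (locally) invertible maps, and $G^k_{p,p'}(M,M')$ is its fiber over $(p,p')\in M\times M'$, i.e. the jets with fixed source $p$ and target $p'$. In ''$(q,j_q^rf)\in\Omega$'' the first entry is the point $q\in M$ (first factor of $M\times G^r(M,M')$) and $j_q^rf$ is regarded as an element of $G^r(M,M')$ with source $q$; $\Psi(x,q,j_q^rf)$ denotes the value of $\Psi$ at the point of $M\times G^r(M,M')$ with first component $x$ and second component the jet $j_q^rf$ with source $q$.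
   Formalization: The number r is assumed positive, and the CR-dimension of M' is assumed at most that of M; without these the claim fails (constant CR-maps share 0-jets with nonconstant ones; for M = R^2 of CR-dimension 0 and M' = C every smooth map is CR but there are no CR-diffeomorphisms). *)

(* Defs.v *)
From HB Require Import structures.
From mathcomp Require Import all_boot all_order all_algebra.
From mathcomp Require Import all_classical all_reals all_analysis.

Set Implicit Arguments.
Unset Strict Implicit.
Unset Printing Implicit Defensive.
Import Order.TTheory GRing.Theory Num.Theory.
Import numFieldNormedType.Exports.
Local Open Scope classical_set_scope.
Local Open Scope ring_scope.

(** * Smooth functions between normed modules *)

(* Intended for finite-dimensional [V], where [Ck k U F] says that [F] is of
   class C^k on the open set [U]. *)
Fixpoint Ck (R : realType) (V W : normedModType R) (k : nat) (U : set V)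
    (F : V -> W) : Prop :=
  if k is k'.+1 then
    (forall v, U v -> differentiable F v) /\ (forall u, Ck k' U ('D_u F))
  else forall v, U v -> {for v, continuous F}.

Definition smooth_near (R : realType) (V W : normedModType R) (F : V -> W)
    (v : V) : Prop :=
  exists2 U : set V, open_nbhs v U & forall k, Ck k U F.

(** * Charts and manifolds *)

(* [cmap] is meaningful on [cdom] only. *)
Record chart (R : realType) (X : Type) (V : normedModType R) := Chart {
  cdom : set X;
  cmap : X -> V }.

Definition atlas (R : realType) (X : Type) (V : normedModType R) :=
  set (chart X V).

Definition charts_at (R : realType) (X : Type) (V : normedModType R)
    (A : atlas X V) (x : X) : set (chart X V) :=
  [set phi | A phi /\ cdom phi x].

(* The open sets of the topology determined by the charts of [A]. *)
Definition atlas_open (R : realType) (X : Type) (V : normedModType R)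
    (A : atlas X V) (O : set X) : Prop :=
  forall phi x, charts_at A x phi -> O x ->
    \forall v \near cmap phi x, forall y, cdom phi y -> cmap phi y = v -> O y.

Lemma atlas_openT (R : realType) (X : Type) (V : normedModType R)
  (A : atlas X V) : atlas_open A [set: X].
Proof. by move=> phi x _ _; apply: filterE. Qed.

Lemma atlas_openI (R : realType) (X : Type) (V : normedModType R)
  (A : atlas X V) : setI_closed (atlas_open A).
Proof.
move=> O1 O2 o1 o2 phi x phix [xO1 xO2].
apply: filterS2 (o1 _ _ phix xO1) (o2 _ _ phix xO2) => v h1 h2 y dy ey.
by split; [exact: h1|exact: h2].
Qed.

Lemma atlas_open_bigcup (R : realType) (X : Type) (V : normedModType R)
  (A : atlas X V) (I : Type) (O : I -> set X) :
  (forall i, atlas_open A (O i)) -> atlas_open A (\bigcup_i O i).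
Proof.
move=> oO phi x phix [i _ Oix].
apply: filterS (oO i _ _ phix Oix) => v h y dy ey.
by exists i => //; exact: h.
Qed.

(* The expression g o phi^-1 of [g] in the chart [phi], extended by 0 outside
   of phi(cdom phi). *)
Definition inchart (R : realType) (X : Type) (V W : normedModType R)
    (phi : chart X V) (g : X -> W) : V -> W :=
  fun v => xget 0 [set g x | x in [set x | cdom phi x /\ cmap phi x = v]].

(* Smoothness of [f] near [x], with respect to the atlases [A] and [B]. *)
Definition smooth_at (R : realType) (X Y : topologicalType)
    (V W : normedModType R) (A : atlas X V) (B : atlas Y W)
    (f : X -> Y) (x : X) : Prop :=
  {for x, continuous f} /\
  forall phi psi, charts_at A x phi -> charts_at B (f x) psi ->
    smooth_near (inchart phi (cmap psi \o f)) (cmap phi x).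

Definition smooth_on (R : realType) (X Y : topologicalType)
    (V W : normedModType R) (A : atlas X V) (B : atlas Y W)
    (U : set X) (f : X -> Y) : Prop :=
  forall x, U x -> smooth_at A B f x.

Definition prod_chart (R : realType) (X Y : Type) (V W : normedModType R)
    (phi : chart X V) (psi : chart Y W) : chart (X * Y) (V * W)%type :=
  Chart [set z | cdom phi z.1 /\ cdom psi z.2]
        (fun z => (cmap phi z.1, cmap psi z.2) : (V * W)%type).

Definition prod_atlas (R : realType) (X Y : Type) (V W : normedModType R)
    (A : atlas X V) (B : atlas Y W) : atlas (X * Y) (V * W)%type :=
  [set chi | exists phi psi, [/\ A phi, B psi & chi = prod_chart phi psi]].

Record manifold (R : realType) (m : nat) := Manifold {
  mcarrier :> topologicalType;
  matlas : atlas mcarrier 'rV[R]_m;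
  manifold_hausdorff : hausdorff_space mcarrier;
  manifold_second_countable : @second_countable mcarrier;
  matlas_cover : forall x, exists phi, charts_at matlas x phi;
  matlas_open : forall phi, matlas phi -> open (cdom phi);
  matlas_inj : forall phi, matlas phi -> set_inj (cdom phi) (cmap phi);
  matlas_continuous : forall phi, matlas phi ->
    forall x, cdom phi x -> {for x, continuous (cmap phi)};
  matlas_open_map : forall phi, matlas phi ->
    forall U, open U -> U `<=` cdom phi -> open (cmap phi @` U);
  matlas_compatible : forall phi psi x,
    charts_at matlas x phi -> charts_at matlas x psi ->
    smooth_near (inchart phi (cmap psi)) (cmap phi x) }.

Arguments matlas {R m} M _ : rename.

(** * Tangent vectors *)

Definition chart_at (R : realType) (m : nat) (M : manifold R m) (x : M) :
    chart M 'rV[R]_m :=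
  projT1 (cid (matlas_cover x)).

(* T_xM is identified with R^m by means of the coordinates in [chart_at x];
   [tcoord phi x] converts to the coordinates in another chart [phi] at x. *)
Definition tcoord (R : realType) (m : nat) (M : manifold R m)
    (phi : chart M 'rV[R]_m) (x : M) (u : 'rV[R]_m) : 'rV[R]_m :=
  'D_u (inchart (chart_at x) (cmap phi)) (cmap (chart_at x) x).

(* The differential d_xf : T_xM -> T_(f x)M'. *)
Definition mdiff (R : realType) (m m' : nat) (M : manifold R m)
    (M' : manifold R m') (f : M -> M') (x : M) (u : 'rV[R]_m) : 'rV[R]_m' :=
  'D_u (inchart (chart_at x) (cmap (chart_at (f x)) \o f))
       (cmap (chart_at x) x).

Definition vfield (R : realType) (m : nat) (M : manifold R m) :=
  M -> 'rV[R]_m.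

Definition vcoord (R : realType) (m : nat) (M : manifold R m)
    (phi : chart M 'rV[R]_m) (X : vfield M) : 'rV[R]_m -> 'rV[R]_m :=
  inchart phi (fun x => tcoord phi x (X x)).

Definition smooth_vfield (R : realType) (m : nat) (M : manifold R m)
    (U : set M) (X : vfield M) : Prop :=
  forall x phi, U x -> charts_at (matlas M) x phi ->
    smooth_near (vcoord phi X) (cmap phi x).

Definition bracket (R : realType) (m : nat) (M : manifold R m)
    (X Y : vfield M) : vfield M :=
  fun x => let phi := chart_at x in
    'D_(X x) (vcoord phi Y) (cmap phi x) - 'D_(Y x) (vcoord phi X) (cmap phi x).

(* A section of the complexified tangent bundle, as a pair consisting of its
   real and imaginary parts. *)
Definition cvfield (R : realType) (m : nat) (M : manifold R m) : Type :=
  vfield M * vfield M.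

(* Complex bilinear extension of [bracket]. *)
Definition cbracket (R : realType) (m : nat) (M : manifold R m)
    (Z W : cvfield M) : cvfield M :=
  ((fun x => bracket Z.1 W.1 x - bracket Z.2 W.2 x),
   (fun x => bracket Z.1 W.2 x + bracket Z.2 W.1 x)).

(** * CR-manifolds *)

Definition bundle_section (R : realType) (m : nat) (M : manifold R m)
    (T : M -> {vspace 'rV[R]_m}) (U : set M) (X : vfield M) : Prop :=
  smooth_vfield U X /\ (forall x, U x -> X x \in T x).

Definition is_subbundle (R : realType) (m : nat) (M : manifold R m)
    (T : M -> {vspace 'rV[R]_m}) (k : nat) : Prop :=
  forall p : M, exists (U : set M) (X : 'I_k -> vfield M),
    [/\ open_nbhs p U, forall i, smooth_vfield U (X i) &
        forall x, U x -> basis_of (T x) [tuple X i x | i < k]].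

Definition is_01_vfield (R : realType) (m : nat) (M : manifold R m)
    (T : M -> {vspace 'rV[R]_m}) (J : M -> 'End('rV[R]_m))
    (U : set M) (Z : cvfield M) : Prop :=
  bundle_section T U Z.1 /\ (forall x, U x -> Z.2 x = J x (Z.1 x)).

(* Only the restriction of [crJ x] to [crT x] is meaningful. *)
Record CRmanifold (R : realType) (n d : nat) := CRManifold {
  crM :> manifold R (n.*2 + d);
  crT : crM -> {vspace 'rV[R]_(n.*2 + d)};
  crJ : crM -> 'End('rV[R]_(n.*2 + d));
  crT_subbundle : is_subbundle crT n.*2;
  crJ_stable : forall x u, u \in crT x -> crJ x u \in crT x;
  crJ_square : forall x u, u \in crT x -> crJ x (crJ x u) = - u;
  crJ_smooth : forall U X, open U -> bundle_section crT U X ->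
    smooth_vfield U (fun x => crJ x (X x));
  cr_integrable : forall U Z W, open U ->
    is_01_vfield crT crJ U Z -> is_01_vfield crT crJ U W ->
    is_01_vfield crT crJ U (cbracket Z W) }.

(* Maps between open pieces are total functions restricted to open sets. *)

Record cr_map (R : realType) (n d n' d' : nat) (M : CRmanifold R n d)
    (M' : CRmanifold R n' d') (U : set M) (f : M -> M') : Prop := CRMap {
  cr_map_smooth : smooth_on (matlas M) (matlas M') U f;
  cr_map_T : forall x u, U x -> u \in crT x -> mdiff f x u \in crT (f x);
  cr_map_J : forall x u, U x -> u \in crT x ->
    mdiff f x (crJ x u) = crJ (f x) (mdiff f x u) }.

Definition inverse_maps (X Y : Type) (U : set X) (U' : set Y)
    (f : X -> Y) (g : Y -> X) : Prop :=
  [/\ forall x, U x -> U' (f x) /\ g (f x) = x &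
      forall y, U' y -> U (g y) /\ f (g y) = y].

Definition diffeo (R : realType) (m m' : nat) (M : manifold R m)
    (M' : manifold R m') (U : set M) (U' : set M') (f : M -> M') : Prop :=
  [/\ open U, open U', smooth_on (matlas M) (matlas M') U f &
      exists2 g, inverse_maps U U' f g & smooth_on (matlas M') (matlas M) U' g].

Definition cr_diffeo (R : realType) (n d n' d' : nat) (M : CRmanifold R n d)
    (M' : CRmanifold R n' d') (U : set M) (U' : set M') (f : M -> M') : Prop :=
  [/\ open U, open U', cr_map U f &
      exists2 g, inverse_maps U U' f g & cr_map U' g].

(** * Jets *)

Definition multi_index (m k : nat) :=
  {a : {ffun 'I_m -> 'I_k.+1} | (\sum_i a i <= k)%N}.

(* On smooth functions the order of the differentiations is irrelevant. *)
Definition partial (R : realType) (m k : nat) (W : normedModType R)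
    (a : multi_index m k) (F : 'rV[R]_m -> W) : 'rV[R]_m -> W :=
  foldr (fun i G => iter (val a i) (fun H => 'D_(delta_mx 0 i) H) G) F
        (enum 'I_m).

Definition same_jet (R : realType) (m m' : nat) (M : manifold R m)
    (M' : manifold R m') (k : nat) (x : M) (f g : M -> M') : Prop :=
  f x = g x /\
  forall phi psi (a : multi_index m k),
    charts_at (matlas M) x phi -> charts_at (matlas M') (f x) psi ->
    partial a (inchart phi (cmap psi \o f)) (cmap phi x) =
    partial a (inchart phi (cmap psi \o g)) (cmap phi x).

Definition jet_class (R : realType) (m m' : nat) (M : manifold R m)
    (M' : manifold R m') (k : nat) (x : M) (f : M -> M') : set (M -> M') :=
  [set g | smooth_at (matlas M) (matlas M') g x /\ same_jet k x f g].

(* J^k(M, M'): a source point together with an equivalence class of maps that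
   are smooth near this point. *)
Record jet (R : realType) (m m' : nat) (M : manifold R m)
    (M' : manifold R m') (k : nat) := Jet {
  jsource : M;
  jmaps : set (M -> M');
  jetP : exists2 f, smooth_at (matlas M) (matlas M') f jsource &
                    jmaps = jet_class k jsource f }.

(* j_x^k f *)
Definition jet_at (R : realType) (m m' : nat) (M : manifold R m)
    (M' : manifold R m') (k : nat) (f : M -> M') (x : M)
    (hf : smooth_at (matlas M) (matlas M') f x) : jet M M' k :=
  Jet (ex_intro2 _ _ f hf erefl).

Arguments jet_at {R m m' M M'} k {f x} hf.

Definition jrepr (R : realType) (m m' k : nat) (M : manifold R m)
    (M' : manifold R m') (j : jet M M' k) : M -> M' :=
  s2val (cid2 (jetP j)).

Definition jtarget (R : realType) (m m' k : nat) (M : manifold R m)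
    (M' : manifold R m') (j : jet M M' k) : M' :=
  jrepr j (jsource j).

(* The source in the chart [phi], and the partial derivatives of order <= k
   (the one of order 0 being the target) in the charts [phi] and [psi]. *)
Definition jet_chart (R : realType) (m m' : nat) (M : manifold R m)
    (M' : manifold R m') (k : nat) (phi : chart M 'rV[R]_m)
    (psi : chart M' 'rV[R]_m') :
    chart (jet M M' k) ('rV[R]_m * 'M[R]_(#|{: multi_index m k}|, m'))%type :=
  Chart
    [set j | cdom phi (jsource j) /\ cdom psi (jtarget j)]
    (fun j => (cmap phi (jsource j),
       \matrix_(a, l) partial (enum_val a) (inchart phi (cmap psi \o jrepr j))
                        (cmap phi (jsource j)) 0 l)
       : ('rV[R]_m * 'M[R]_(#|{: multi_index m k}|, m'))%type).

Definition jatlas (R : realType) (m m' : nat) (M : manifold R m)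
    (M' : manifold R m') (k : nat) :
    atlas (jet M M' k) ('rV[R]_m * 'M[R]_(#|{: multi_index m k}|, m'))%type :=
  [set chi | exists phi psi,
    [/\ matlas M phi, matlas M' psi & chi = jet_chart k phi psi]].

Arguments jatlas {R m m'} M M' k.

HB.instance Definition _ (R : realType) (m m' : nat) (M : manifold R m)
    (M' : manifold R m') (k : nat) := gen_eqMixin (jet M M' k).
HB.instance Definition _ (R : realType) (m m' : nat) (M : manifold R m)
    (M' : manifold R m') (k : nat) := gen_choiceMixin (jet M M' k).

HB.instance Definition _ (R : realType) (m m' : nat) (M : manifold R m)
    (M' : manifold R m') (k : nat) :=
  isOpenTopological.Build (jet M M' k) (@atlas_openT _ _ _ (jatlas M M' k))
    (@atlas_openI _ _ _ (jatlas M M' k))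
    (@atlas_open_bigcup _ _ _ (jatlas M M' k)).

(* G^k(M, M') *)
Definition invertible_jet (R : realType) (m m' : nat) (M : manifold R m)
    (M' : manifold R m') (k : nat) : set (jet M M' k) :=
  [set j | exists f U U', [/\ jmaps j f, U (jsource j) & diffeo U U' f]].

Arguments invertible_jet {R m m'} M M' k.

(* G^k_{p,p'}(M, M') *)
Definition invertible_jet_fiber (R : realType) (m m' : nat) (M : manifold R m)
    (M' : manifold R m') (k : nat) (p : M) (p' : M') : set (jet M M' k) :=
  [set j | [/\ invertible_jet M M' k j, jsource j = p & jtarget j = p']].

(* Main.v *)
Require Import Defs.
From HB Require Import structures.
From mathcomp Require Import all_boot all_order all_algebra.
From mathcomp Require Import all_classical all_reals all_analysis.
From mathcomp Require Import ring lra.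
Set Implicit Arguments.
Unset Strict Implicit.
Unset Printing Implicit Defensive.
Import Order.TTheory GRing.Theory Num.Theory.
Import numFieldNormedType.Exports.
Local Open Scope classical_set_scope.
Local Open Scope ring_scope.

(** The map Psi is found by integrating the complete system.  In charts, let
    [x] move along a segment starting at [q], with constant velocity [w].  The
    r-jet [u] of a solution [f] at [x] changes at a rate that is linear in [w]
    and in the partial derivatives of [f] of order at most r + 1, and these are
    given by Phi.  Hence (x, u, w) is an integral curve of an autonomous vector
    field, [system_field], and the value of [f] at the end of the segment is
    read off the time-one flow of this field.  The field vanishes where w = 0,
    so the flow exists up to time one and is smooth near all points with w = 0;
    this yields a neighborhood of the fiber ([param_dom]), a smooth map on it
    ([param]) and the identity to be proved ([complete_solution]).

    Two points need care.  Nothing is known about Phi at jets which are not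
    jets of solutions: Phi j may have another source or target than j and may
    leave the chart.  The field is therefore built with a cut-off ([cut]) that
    equals one at jets of solutions.  Moreover Phi controls CR-diffeomorphisms,
    while [f] is only a CR-map with an invertible jet.  By the inverse function
    theorem such an [f] is a local diffeomorphism; its differential is
    injective on complex tangent spaces and, by comparison of dimensions, maps
    them onto complex tangent spaces, so the inverse is CR ([diffeo_cr]).

    Flows are constructed with the Euler scheme with 2^i steps.  On a convex
    compact set that confines the Euler polygons the scheme is stable, and
    halving the step changes the result by O(2^-i), so it converges.  The
    scheme of a field F, differentiated, is the scheme of the tangent field
    (z, v) |-> (F z, DF(z) v) ([euler_tangent]); hence the derivative of the
    flow of F is a component of the flow of another smooth field, and
    smoothness follows by induction on the order for all fields at once
    ([flow_Ck]).  A map that intertwines two fields intertwines their flows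
    ([flow_natural]).  Applied to a curve, this identifies integral curves with
    flow lines; applied to the field dx/dt = Df(x)^-1 w, whose solutions are
    mapped by [f] to straight lines, it gives the inverse function theorem.

    Jet charts form a smooth atlas because the derivatives of a composite
    sigma o F o tau are smooth functions of the jet of F ([change_partial]), and
    because Taylor polynomials realize all values of the jet coordinates
    ([jet_exists]). *)

(** * Directional derivatives *)

Section Derivatives.
Context {R : realType}.
Implicit Types (U V W : normedModType R).

Lemma derD V W (f g : V -> W) (x v : V) :
  differentiable f x -> differentiable g x ->
  'D_v (fun y => f y + g y) x = 'D_v f x + 'D_v g x.
Proof. by move=> df dg; rewrite [LHS]deriveD//; exact: diff_derivable. Qed.

Lemma derN V W (f : V -> W) (x v : V) :
  differentiable f x -> 'D_v (fun y => - f y) x = - 'D_v f x.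
Proof. by move=> df; rewrite [LHS]deriveN//; exact: diff_derivable. Qed.

Lemma derB V W (f g : V -> W) (x v : V) :
  differentiable f x -> differentiable g x ->
  'D_v (fun y => f y - g y) x = 'D_v f x - 'D_v g x.
Proof. by move=> df dg; rewrite [LHS]deriveB//; exact: diff_derivable. Qed.

Lemma der_dirD V W (f : V -> W) (x u v : V) :
  differentiable f x -> 'D_(u + v) f x = 'D_u f x + 'D_v f x.
Proof. by move=> df; rewrite !deriveE// linearD. Qed.

Lemma der_dirZ V W (f : V -> W) (x v : V) (a : R) :
  differentiable f x -> 'D_(a *: v) f x = a *: 'D_v f x.
Proof. by move=> df; rewrite !deriveE// linearZ. Qed.

Lemma der_dir_sum V W (f : V -> W) (x : V) I (s : seq I) (P : pred I) (v : I -> V) :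
  differentiable f x ->
  'D_(\sum_(i <- s | P i) v i) f x = \sum_(i <- s | P i) 'D_(v i) f x.
Proof.
move=> df; rewrite deriveE// linear_sum.
by apply: eq_bigr => i _; rewrite deriveE.
Qed.

Lemma differentiable_compf U V W (f : U -> V) (g : V -> W) (x : U) :
  differentiable f x -> differentiable g (f x) ->
  differentiable (fun y => g (f y)) x.
Proof. exact: differentiable_comp. Qed.

Lemma der_comp U V W (f : U -> V) (g : V -> W) (x u : U) :
  differentiable f x -> differentiable g (f x) ->
  'D_u (fun y => g (f y)) x = 'D_('D_u f x) g (f x).
Proof.
move=> df dg; rewrite [LHS]deriveE; last exact: differentiable_comp.
by rewrite (diff_comp df dg) /= !deriveE.
Qed.

Lemma der_linear V W (L : {linear V -> W}) (x v : V) :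
  continuous L -> 'D_v L x = L v.
Proof. by move=> Lc; rewrite deriveE ?diff_lin//; exact: linear_differentiable. Qed.

Lemma der_pair U V W (f : U -> V) (g : U -> W) (x u : U) :
  differentiable f x -> differentiable g x ->
  'D_u (fun y => (f y, g y)) x = ('D_u f x, 'D_u g x).
Proof.
move=> df dg; rewrite deriveE; last exact: differentiable_pair.
by rewrite diff_pair// !deriveE.
Qed.

Lemma scale_is_bilinear V :
  bilinear_for (GRing.Scale.Law.clone _ _ *:%R _) (GRing.Scale.Law.clone _ _ *:%R _)
    (@GRing.scale R V : R -> V -> V).
Proof.
split=> [v|a] c x y /=; first by rewrite scalerDl scalerA.
by rewrite scalerDr !scalerA mulrC.
Qed.

Lemma scale_is_diff V (p : R * V) :
  is_diff p (fun q : R * V => q.1 *: q.2) (fun q => p.1 *: q.2 + q.1 *: p.2).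
Proof.
pose BM := bilinear_isBilinear.Build R R V V _ _ (@GRing.scale R V) (@scale_is_bilinear V).
pose B : {bilinear R -> V -> V} := HB.pack (@GRing.scale R V : R -> V -> V) BM.
have Bc : continuous (fun p => B p.1 p.2) by move=> ?; exact: scale_continuous.
apply: DiffDef; first exact: (@differentiable_bilin _ _ _ _ B).
exact: (@diff_bilin _ _ _ _ B p).
Qed.

Lemma differentiable_scale V W (a : V -> R) (f : V -> W) (x : V) :
  differentiable a x -> differentiable f x ->
  differentiable (fun y => a y *: f y) x.
Proof.
move=> da df; have dp := differentiable_pair da df.
have [h _] := scale_is_diff (a x, f x).
exact: (differentiable_comp dp h).
Qed.

Lemma der_scale V W (a : V -> R) (f : V -> W) (x v : V) :
  differentiable a x -> differentiable f x ->
  'D_v (fun y => a y *: f y) x = a x *: 'D_v f x + 'D_v a x *: f x.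
Proof.
move=> da df; have dp := differentiable_pair da df.
have [h e] := scale_is_diff (a x, f x).
rewrite (@der_comp _ _ _ (fun y => (a y, f y)) (fun q => q.1 *: q.2))//.
by rewrite der_pair// deriveE// e.
Qed.

End Derivatives.

(** * Finite-dimensional normed modules *)

(** A finite family spans, with continuous coordinates. Stated in this way the
    condition is visibly stable under products and holds for whatever norm the
    space carries; finite dimension is used through the coordinates only. *)
Class findim (R : realType) (V : normedModType R) : Prop := Findim {
  findim_basis : exists N (e : 'I_N -> V) (c : 'I_N -> {linear V -> R}),
    (forall i, continuous (c i)) /\ forall v, v = \sum_i c i v *: e i }.

Section FindimInstances.
Context {R : realType}.

Global Instance findimR : findim (R : normedModType R).
Proof.
constructor; exists 1%N, (fun=> 1), (fun=> idfun); split=> [i|v]; first by move=> ?; exact: cvg_id.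
by rewrite big_ord1 /= [_ *: _]mulr1.
Qed.

Global Instance findimX (V W : normedModType R) :
  findim V -> findim W -> findim (V * W)%type.
Proof.
move=> [[N [e [c [cc ce]]]]] [[N' [e' [c' [cc' ce']]]]].
constructor; exists (N + N')%N.
exists (fun i => match fintype.split i with inl j => (e j, 0) | inr j => (0, e' j) end).
have lf i : linear (fun z : V * W => c i z.1) by move=> a x y; rewrite linearP.
have lg i : linear (fun z : V * W => c' i z.2) by move=> a x y; rewrite linearP.
pose F i : {linear (V * W)%type -> R} := HB.pack (fun z : V * W => c i z.1)
  (GRing.isLinear.Build _ _ _ _ _ (lf i)).
pose G i : {linear (V * W)%type -> R} := HB.pack (fun z : V * W => c' i z.2)
  (GRing.isLinear.Build _ _ _ _ _ (lg i)).
exists (fun i => match fintype.split i with inl j => F j | inr j => G j end).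
split=> [i|[v w]].
  case: (fintype.split i) => j z.
    by apply: (@continuous_comp _ _ _ fst (c j)); [exact: cvg_fst|exact: cc].
  by apply: (@continuous_comp _ _ _ snd (c' j)); [exact: cvg_snd|exact: cc'].
rewrite big_split_ord /=.
under eq_bigr => i _ do rewrite (unsplitK (inl i)) /=.
under [X in _ = _ + X]eq_bigr => i _ do rewrite (unsplitK (inr i)) /=.
have fstD : {morph (fun z : V * W => z.1) : x y / x + y} by [].
have sndD : {morph (fun z : V * W => z.2) : x y / x + y} by [].
apply: injective_projections; rewrite [LHS]/=.
  rewrite fstD !(big_morph _ fstD (erefl _)) /=.
  by rewrite [X in _ + X]big1 ?addr0 -?ce// => i _; rewrite scaler0.
rewrite sndD !(big_morph _ sndD (erefl _)) /=.
by rewrite [X in X + _]big1 ?add0r -?ce'// => i _; rewrite scaler0.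
Qed.

Global Instance findimM m n : findim 'M[R]_(m, n).
Proof.
constructor; exists #|{: 'I_m * 'I_n}|.
exists (fun k => delta_mx (enum_val k).1 (enum_val k).2).
have lf (ij : 'I_m * 'I_n) : linear (fun A : 'M[R]_(m, n) => A ij.1 ij.2).
  by move=> a x y; rewrite !mxE.
pose F (k : 'I_#|{: 'I_m * 'I_n}|) : {linear 'M[R]_(m, n) -> R} := HB.pack
  (fun A : 'M[R]_(m, n) => A (enum_val k).1 (enum_val k).2)
  (GRing.isLinear.Build _ _ _ _ _ (lf (enum_val k))).
exists F.
split=> [i|A] /=; first exact: coord_continuous.
rewrite {1}(matrix_sum_delta A) pair_bigA /=.
by rewrite (reindex (fun k : 'I_#|{: 'I_m * 'I_n}| => enum_val k))//=; exact: onW_bij (enum_val_bij _).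
Qed.

End FindimInstances.

(** * Functions of class C^k *)

Section CkCalculus.
Context {R : realType}.
Implicit Types (U V W : normedModType R).

Lemma Ck_diff V W k (D : set V) (F : V -> W) x :
  Ck k.+1 D F -> D x -> differentiable F x.
Proof. by move=> [h _]; exact: h. Qed.

Lemma Ck_continuous V W k (D : set V) (F : V -> W) x :
  Ck k D F -> D x -> {for x, continuous F}.
Proof.
case: k => [|k] h Dx; first exact: (h x Dx).
exact/differentiable_continuous/(Ck_diff h).
Qed.

Lemma CkW V W k (D : set V) (F : V -> W) : Ck k.+1 D F -> Ck k D F.
Proof.
elim: k F => [|k IH] F h; first by move=> x Dx; exact: Ck_continuous h Dx.
by split=> [x|u]; [exact: h.1|exact/IH/h.2].
Qed.

Lemma Ck_sub V W k (D D' : set V) (F : V -> W) : D' `<=` D -> Ck k D F -> Ck k D' F.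
Proof.
move=> sD; elim: k F => [|k IH] F h; first by move=> x /sD Dx; exact: (h x Dx).
by split=> [x /sD|u]; [exact: h.1|exact/IH/h.2].
Qed.

(** [D] being open, the differential depends on germs only. *)
Lemma Ck_congr V W k (D : set V) (F G : V -> W) :
  open D -> (forall x, D x -> F x = G x) -> Ck k D F -> Ck k D G.
Proof.
move=> oD; have nearFG (f g : V -> W) x : (forall x, D x -> f x = g x) -> D x -> \forall y \near x, f y = g y.
  by move=> fg Dx; apply: filterS (open_nbhs_nbhs (conj oD Dx)) => y /fg.
elim: k F G => [|k IH] F G FG h.
  move=> x Dx; have : F @ x --> F x := h x Dx.
  rewrite (FG _ Dx) => Fx; apply: cvg_trans Fx.
  by apply: near_eq_cvg; apply: nearFG Dx.
have E u x : D x -> 'D_u F x = 'D_u G x.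
  by move=> Dx; apply: near_eq_derive; exact: nearFG.
split=> [x Dx|u]; last exact: (IH _ _ (E u) (h.2 u)).
have dF := h.1 _ Dx.
suff dG : is_diff x G ('d F x) by case: dG.
have e := diff_locally dF.
have : continuous ('d F x) /\ G \o shift x = cst (G x) + 'd F x +o_ 0 id.
  split; first exact: diff_continuous.
  apply/eqaddoP => eps eps0.
  have /eqaddoP/(_ _ eps0) := e.
  have : \forall y \near (0 : V), F (y + x) = G (y + x).
    have /= := nearFG _ _ _ FG Dx.
    rewrite (near_shift 0 x) /= => h'; near=> y.
    have : F (y + (x - 0)) = G (y + (x - 0)) by near: y; exact: h'.
    by rewrite subr0.
  apply: filterS2 => y /= Fy; rewrite !fctE /= Fy FG//.
move=> hG; apply: DiffDef; last exact: (diff_unique hG.1 hG.2).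
by apply/diff_locallyP; rewrite (diff_unique hG.1 hG.2).
Unshelve. all: by end_near. Qed.

Lemma Ck_cst V W k (D : set V) (a : W) : Ck k D (fun=> a).
Proof.
elim: k a => [|k IH] a; first by move=> x _; exact: cvg_cst.
split=> [x _|u]; first exact: differentiable_cst.
have -> : 'D_u (fun _ : V => a) = fun=> 0 by apply/funext => x; rewrite derive_cst.
exact: IH.
Qed.

Lemma Ck_linear V W k (D : set V) (L : {linear V -> W}) : continuous L -> Ck k D L.
Proof.
move=> Lc; case: k => [|k]; first by move=> x _; exact: Lc.
split=> [x _|u]; first exact: linear_differentiable.
have -> : 'D_u L = fun=> L u by apply/funext => x; rewrite der_linear.
exact: Ck_cst.
Qed.

Lemma Ck_lin V W k (D : set V) (L : V -> W) : linear L -> continuous L -> Ck k D L.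
Proof.
move=> Ll Lc.
pose L' : {linear V -> W} := HB.pack L (GRing.isLinear.Build _ _ _ _ _ Ll).
exact: (@Ck_linear _ _ _ _ L').
Qed.

Lemma Ck_id V k (D : set V) : Ck k D (fun x : V => x).
Proof. by apply: (@Ck_linear _ _ _ _ idfun) => x; exact: cvg_id. Qed.

Lemma Ck_snd V W k (D : set (V * W)) : Ck k D snd.
Proof. by apply: Ck_lin => [a x y//|x]; exact: cvg_snd. Qed.

Lemma CkD V W k (D : set V) (F G : V -> W) : open D ->
  Ck k D F -> Ck k D G -> Ck k D (fun x => F x + G x).
Proof.
move=> oD; elim: k F G => [|k IH] F G hF hG.
  by move=> x Dx; apply: continuousD; [exact: (hF x Dx)|exact: (hG x Dx)].
split=> [x Dx|u]; first by apply: differentiableD; [exact: hF.1|exact: hG.1].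
apply: (Ck_congr oD _ (IH _ _ (hF.2 u) (hG.2 u))) => x Dx.
by rewrite derD//; [exact: hF.1|exact: hG.1].
Qed.

Lemma Ck_scale V W k (D : set V) (a : V -> R) (F : V -> W) : open D ->
  Ck k D a -> Ck k D F -> Ck k D (fun x => a x *: F x).
Proof.
move=> oD; elim: k a F => [|k IH] a F ha hF.
  by move=> x Dx; apply: (continuousZ (ha _ Dx) (hF _ Dx)).
have dF x Dx := Ck_diff (x := x) hF Dx.
have da x Dx := Ck_diff (x := x) ha Dx.
split=> [x Dx|u]; first by apply: differentiable_scale; [exact: da|exact: dF].
have := CkD oD (IH _ _ (CkW ha) (hF.2 u)) (IH _ _ (ha.2 u) (CkW hF)).
by apply: Ck_congr => // x Dx; rewrite der_scale//; [exact: da|exact: dF].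
Qed.

Lemma CkZ V W k (D : set V) (a : R) (F : V -> W) : open D ->
  Ck k D F -> Ck k D (fun x => a *: F x).
Proof. by move=> oD hF; apply: Ck_scale => //; exact: Ck_cst. Qed.

Lemma CkN V W k (D : set V) (F : V -> W) : open D ->
  Ck k D F -> Ck k D (fun x => - F x).
Proof.
by move=> oD /(CkZ (- 1) oD); apply: Ck_congr => // x _; rewrite scaleN1r.
Qed.

Lemma CkB V W k (D : set V) (F G : V -> W) : open D ->
  Ck k D F -> Ck k D G -> Ck k D (fun x => F x - G x).
Proof. by move=> oD hF hG; apply: CkD => //; exact: CkN. Qed.

Lemma CkM V k (D : set V) (F G : V -> R) : open D ->
  Ck k D F -> Ck k D G -> Ck k D (fun x => F x * G x).
Proof. exact: Ck_scale. Qed.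

Lemma Ck_sum V W k (D : set V) I (s : seq I) (P : pred I) (F : I -> V -> W) : open D ->
  (forall i, Ck k D (F i)) -> Ck k D (fun x => \sum_(i <- s | P i) F i x).
Proof.
move=> oD hF; elim: s => [|i s IH].
  by apply: (Ck_congr oD _ (Ck_cst _ _ (0 : W))) => x _; rewrite big_nil.
case Pi: (P i).
  by apply: (Ck_congr oD _ (CkD oD (hF i) IH)) => x _; rewrite big_cons Pi.
by apply: (Ck_congr oD _ IH) => x _; rewrite big_cons Pi.
Qed.

Lemma Ck_pair U V W k (D : set U) (F : U -> V) (G : U -> W) : open D ->
  Ck k D F -> Ck k D G -> Ck k D (fun x => (F x, G x)).
Proof.
move=> oD; elim: k F G => [|k IH] F G hF hG.
  by move=> x Dx; apply: cvg_pair; [exact: (hF x Dx)|exact: (hG x Dx)].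
split=> [x Dx|u]; first by apply: differentiable_pair; [exact: hF.1|exact: hG.1].
apply: (Ck_congr oD _ (IH _ _ (hF.2 u) (hG.2 u))) => x Dx.
by rewrite der_pair//; [exact: hF.1|exact: hG.1].
Qed.

(** The derivative of a composite is the sum over a basis of the derivatives of
    the outer map along the basis vectors, weighted by the coordinates of the
    derivative of the inner map; this is where finite dimension enters, since
    only derivatives along fixed vectors are controlled. *)
Lemma Ck_comp U V W {fV : findim V} k (D : set U) (E : set V) (F : U -> V) (G : V -> W) :
  open D -> (forall x, D x -> E (F x)) ->
  Ck k D F -> Ck k E G -> Ck k D (fun x => G (F x)).
Proof.
move=> oD; elim: k W E F G => [|k IH] W E F G DE hF hG.
  by move=> x Dx; apply: continuous_comp; [exact: (hF x Dx)|exact: (hG _ (DE _ Dx))].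
have dF x Dx := Ck_diff (x := x) hF Dx.
have dG x Dx := Ck_diff hG (DE x Dx).
split=> [x Dx|u]; first by apply: differentiable_compf; [exact: dF|exact: dG].
have [[N [e [c [cc ce]]]]] := fV.
have : Ck k D (fun x => \sum_i c i ('D_u F x) *: 'D_(e i) G (F x)).
  apply: Ck_sum => // i; apply: Ck_scale => //; last exact: IH DE (CkW hF) (hG.2 _).
  by apply: (IH _ setT _ _ _ (hF.2 u)) => //; exact: Ck_linear.
apply: Ck_congr => // x Dx.
rewrite (der_comp _ (dF _ Dx) (dG _ Dx)) [in RHS](ce ('D_u F x)).
rewrite (der_dir_sum _ _ _ (dG _ Dx)).
by apply: eq_bigr => i _; rewrite der_dirZ//; exact: dG.
Qed.

End CkCalculus.

(** * Smoothness near a point *)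

Section SmoothNear.
Context {R : realType}.
Implicit Types (U V W : normedModType R).

(** Each order may come with its own neighborhood: the condition is pointwise
    at every order. *)
Lemma Ck_local V W k (D : set V) (F : V -> W) :
  (forall x, D x -> exists2 E, open_nbhs x E & Ck k E F) -> Ck k D F.
Proof.
elim: k F => [|k IH] F h.
  by move=> x /h[E [_ Ex] hE]; exact: (hE x Ex).
split=> [x /h[E [_ Ex] hE]|u]; first exact: hE.1.
by apply: IH => x /h[E Ex hE]; exists E => //; exact: hE.2.
Qed.

Lemma sn_Ck V W k (D : set V) (F : V -> W) :
  (forall x, D x -> smooth_near F x) -> Ck k D F.
Proof. by move=> h; apply: Ck_local => x /h[E Ex hE]; exists E. Qed.

Lemma sn_near V W (F : V -> W) x :
  smooth_near F x -> \forall y \near x, smooth_near F y.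
Proof.
move=> [E [oE Ex] hE]; apply: filterS (open_nbhs_nbhs (conj oE Ex)) => y Ey.
by exists E.
Qed.

Lemma sn_congr V W (F G : V -> W) x :
  (\forall y \near x, F y = G y) -> smooth_near F x -> smooth_near G x.
Proof.
have nE (P : set V) : (\forall y \near x, P y) -> exists2 E, open_nbhs x E & E `<=` P by move=> h; have : nbhs x P := h; rewrite nbhsE.
move=> /nE[E [oE Ex] FG] [E' [oE' E'x] hE'].
have oEE : open (E `&` E') by exact: openI.
exists (E `&` E'); first by split.
move=> k; apply: (@Ck_congr _ _ _ _ _ F) => // [y [/FG]//|].
by apply: (Ck_sub (D := E')) => // y [].
Qed.

Lemma sn_eq V W (F G : V -> W) x :
  (forall y, F y = G y) -> smooth_near F x -> smooth_near G x.
Proof. by move=> /funext ->. Qed.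

Lemma sn_diff V W (F : V -> W) x : smooth_near F x -> differentiable F x.
Proof. by move=> [E [_ Ex] /(_ 1%N) hE]; exact: hE.1. Qed.

Lemma sn_cont V W (F : V -> W) x : smooth_near F x -> {for x, continuous F}.
Proof. by move=> /sn_diff; exact: differentiable_continuous. Qed.

Lemma sn_der V W (F : V -> W) x u : smooth_near F x -> smooth_near ('D_u F) x.
Proof. by move=> [E Ex hE]; exists E => // k; exact: (hE k.+1).2. Qed.

Lemma sn_cst V W (a : W) (x : V) : smooth_near (fun=> a) x.
Proof. by exists setT => [|k]; [split=> //; exact: openT|exact: Ck_cst]. Qed.

Lemma sn_lin V W (L : V -> W) (x : V) : linear L -> continuous L -> smooth_near L x.
Proof. by exists setT => [|k]; [split=> //; exact: openT|exact: Ck_lin]. Qed.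

Lemma sn_id V (x : V) : smooth_near (fun y : V => y) x.
Proof. by exists setT => [|k]; [split=> //; exact: openT|exact: Ck_id]. Qed.

Lemma sn_two U V W (F : U -> V) (G : U -> W) x : smooth_near F x -> smooth_near G x ->
  exists2 E : set U, open_nbhs x E & forall k, Ck k E F /\ Ck k E G.
Proof.
move=> [E [oE Ex] hE] [E' [oE' E'x] hE']; exists (E `&` E').
  by split=> //; exact: openI.
by move=> k; split; [exact: (Ck_sub (@subIsetl _ _ _) (hE k))|exact: (Ck_sub (@subIsetr _ _ _) (hE' k))].
Qed.

Lemma snD V W (F G : V -> W) x :
  smooth_near F x -> smooth_near G x -> smooth_near (fun y => F y + G y) x.
Proof.
move=> /sn_two h /h[E [oE Ex] hE]; exists E => // k.
by have [? ?] := hE k; exact: CkD.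
Qed.

Lemma snB V W (F G : V -> W) x :
  smooth_near F x -> smooth_near G x -> smooth_near (fun y => F y - G y) x.
Proof.
move=> /sn_two h /h[E [oE Ex] hE]; exists E => // k.
by have [? ?] := hE k; exact: CkB.
Qed.

Lemma sn_scale V W (a : V -> R) (G : V -> W) x :
  smooth_near a x -> smooth_near G x -> smooth_near (fun y => a y *: G y) x.
Proof.
move=> /sn_two h /h[E [oE Ex] hE]; exists E => // k.
by have [? ?] := hE k; exact: Ck_scale.
Qed.

Lemma snM V (a G : V -> R) x :
  smooth_near a x -> smooth_near G x -> smooth_near (fun y => a y * G y) x.
Proof. exact: sn_scale. Qed.

Lemma sn_pair U V W (F : U -> V) (G : U -> W) x :
  smooth_near F x -> smooth_near G x -> smooth_near (fun y => (F y, G y)) x.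
Proof.
move=> /sn_two h /h[E [oE Ex] hE]; exists E => // k.
by have [? ?] := hE k; exact: Ck_pair.
Qed.

Lemma sn_sum V W I (s : seq I) (P : pred I) (F : I -> V -> W) x :
  (forall i, smooth_near (F i) x) -> smooth_near (fun y => \sum_(i <- s | P i) F i y) x.
Proof.
move=> h; elim: s => [|i s IH].
  by apply: (sn_eq _ (sn_cst (0 : W) x)) => y; rewrite big_nil.
case Pi: (P i).
  by apply: (sn_eq _ (snD (h i) IH)) => y; rewrite big_cons Pi.
by apply: (sn_eq _ IH) => y; rewrite big_cons Pi.
Qed.

Lemma sn_prod V I (s : seq I) (P : pred I) (F : I -> V -> R) x :
  (forall i, smooth_near (F i) x) -> smooth_near (fun y => \prod_(i <- s | P i) F i y) x.
Proof.
move=> h; elim: s => [|i s IH].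
  by apply: (sn_eq _ (sn_cst (1 : R) x)) => y; rewrite big_nil.
case Pi: (P i).
  by apply: (sn_eq _ (snM (h i) IH)) => y; rewrite big_cons Pi.
by apply: (sn_eq _ IH) => y; rewrite big_cons Pi.
Qed.

Lemma sn_comp U V W {fV : findim V} (F : U -> V) (G : V -> W) x :
  smooth_near F x -> smooth_near G (F x) -> smooth_near (fun y => G (F y)) x.
Proof.
move=> sF [E [oE Ex] hE]; have [D [oD Dx] hD] := sF.
have : nbhs x [set y | E (F y)] by apply: (sn_cont sF); exact: open_nbhs_nbhs.
rewrite nbhsE => -[D' [oD' D'x] D'E]; exists (D `&` D').
  by split=> //; exact: openI.
move=> k; apply: (Ck_comp (E := E) (openI oD oD')) => // [y [_ /D'E]//|].
by apply: Ck_sub (hD k) => y [].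
Qed.

Lemma sn_mx V m n (F : 'I_m -> 'I_n -> V -> R) x :
  (forall i j, smooth_near (F i j) x) -> smooth_near (fun y => \matrix_(i, j) F i j y) x.
Proof.
move=> h; apply: (@sn_eq _ _ (fun y => \sum_i \sum_j F i j y *: delta_mx i j)).
  by move=> y; rewrite [RHS]matrix_sum_delta; apply: eq_bigr => i _; apply: eq_bigr => j _; rewrite mxE.
apply: sn_sum => i; apply: sn_sum => j; apply: sn_scale => //; exact: sn_cst.
Qed.

Lemma sn_entry V m n (F : V -> 'M[R]_(m, n)) i j x :
  smooth_near F x -> smooth_near (fun y => F y i j) x.
Proof.
move=> h; apply: (sn_comp (G := fun A : 'M[R]_(m, n) => A i j) h).
by apply: sn_lin => [a A B|]; [rewrite !mxE|exact: coord_continuous].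
Qed.

Lemma sn_mulmx V m n p (F : V -> 'M[R]_(m, n)) (G : V -> 'M[R]_(n, p)) x :
  smooth_near F x -> smooth_near G x -> smooth_near (fun y => F y *m G y) x.
Proof.
move=> hF hG; apply: (@sn_eq _ _ (fun y => \matrix_(i, k) \sum_j F y i j * G y j k)).
  by move=> y; apply/matrixP => i k; rewrite !mxE.
by apply: sn_mx => i k; apply: sn_sum => j; apply: snM; exact: sn_entry.
Qed.

Lemma inv_Ck k : Ck k [set t : R | t != 0] (fun t : R => t^-1).
Proof.
have oD : open [set t : R | t != 0] by [].
elim: k => [t t0|k IH]; first exact: inv_continuous.
split=> [t t0|u]; first exact: differentiable_Rinv.
have h : Ck k [set t : R | t != 0] (fun t => (- u) * (t^-1 * t^-1)).
  by apply: CkM => //; [exact: Ck_cst|exact: CkM].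
apply: Ck_congr h => // t t0.
have dt : derivable (fun t : R => t) t u by exact: derivable_id.
rewrite [RHS](@deriveV _ _ (fun t : R => t) t u t0 dt) derive_id.
by rewrite expr2 invfM mulNr mulrC -mulNr.
Qed.

Lemma sn_inv V (a : V -> R) x : a x != 0 -> smooth_near a x -> smooth_near (fun y => (a y)^-1) x.
Proof.
move=> ax sa; apply: (@sn_comp V R R _ a (fun t : R => t^-1) x sa).
exists [set t : R | t != 0]; last by move=> k; exact: inv_Ck.
by split.
Qed.

Lemma sn_det V n (A : V -> 'M[R]_n) x : smooth_near A x -> smooth_near (fun y => \det (A y)) x.
Proof.
move=> sA; apply: sn_sum => s; apply: snM; first exact: sn_cst.
by apply: sn_prod => i; exact: sn_entry.
Qed.

(** Cramer's rule. *)
Lemma sn_invmx V n (A : V -> 'M[R]_n) x : A x \in unitmx ->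
  smooth_near A x -> smooth_near (fun y => invmx (A y)) x.
Proof.
move=> Ax sA; have sd := sn_det sA.
have dx : \det (A x) != 0 by rewrite unitmxE unitfE in Ax.
have : smooth_near (fun y => (\det (A y))^-1 *: \adj (A y)) x.
  apply: sn_scale; first exact: sn_inv.
  apply: (@sn_eq _ _ (fun y => \matrix_(i, j) cofactor (A y) j i)).
    by move=> y; apply/matrixP => i j; rewrite !mxE.
  apply: sn_mx => i j.
  apply: snM; first exact: sn_cst.
  apply: sn_det; apply: (@sn_eq _ _ (fun y => \matrix_(k, l) A y (lift j k) (lift i l))).
    by move=> y; apply/matrixP => k l; rewrite !mxE.
  by apply: sn_mx => k l; exact: sn_entry.
apply: sn_congr.
have : \forall y \near x, \det (A y) != 0.
  by apply: (sn_cont sd) [set t | t != 0] _; apply: open_nbhs_nbhs; split.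
by apply: filterS => y dy; rewrite /invmx unitmxE unitfE dy.
Qed.

(** Expanding the direction in a basis turns a derivative along a variable
    vector into a combination of derivatives along fixed vectors. *)
Lemma sn_tangent V W {fV : findim V} (F : V -> W) x v :
  smooth_near F x -> smooth_near (fun z : V * V => 'D_z.2 F z.1) (x, v).
Proof.
move=> sF; have [[N [e [c [cc ce]]]]] := fV.
have s1 : smooth_near (fst : V * V -> V) (x, v) by apply: sn_lin => // z; exact: cvg_fst.
have s2 : smooth_near (snd : V * V -> V) (x, v) by apply: sn_lin => // z; exact: cvg_snd.
have : smooth_near (fun z : V * V => \sum_i c i z.2 *: 'D_(e i) F z.1) (x, v).
  apply: sn_sum => i; apply: sn_scale.
    by apply: (sn_comp (G := c i) s2); apply: sn_lin => //; exact: linearP.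
  by apply: (sn_comp (G := 'D_(e i) F) s1); exact: sn_der.
apply: sn_congr.
have : \forall z \near (x, v), differentiable F z.1.
  have dF : nbhs x [set y | differentiable F y].
    by apply: filterS (sn_near sF) => y; exact: sn_diff.
  exact: (@cvg_fst _ _ (nbhs x) (nbhs v) _ _ dF).
apply: filterS => z dz; rewrite [in RHS](ce z.2) der_dir_sum//.
by apply: eq_bigr => i _; rewrite der_dirZ.
Qed.

Lemma sn_der_at U V W {fV : findim V} (F : V -> W) (g h : U -> V) x :
  smooth_near g x -> smooth_near h x -> smooth_near F (g x) ->
  smooth_near (fun y => 'D_(h y) F (g y)) x.
Proof.
move=> sg sh sF.
exact: (sn_comp (sn_pair sg sh) (sn_tangent (h x) sF)).
Qed.

End SmoothNear.

(** * Mean value estimates *)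

Section MeanValue.
Context {R : realType}.
Implicit Types (U V W : normedModType R).

Lemma scaleid_diff V (u : V) (t : R) : differentiable (fun s : R => s *: u) t.
Proof.
apply: (differentiable_scale (a := fun s : R => s)); last exact: differentiable_cst.
exact: sn_diff (sn_id t).
Qed.

Lemma line_diff V (x u : V) (t : R) : differentiable (fun s : R => x + s *: u) t.
Proof.
by apply: differentiableD; [exact: differentiable_cst|exact: scaleid_diff].
Qed.

Lemma line_der V (x u : V) (t a : R) : 'D_a (fun s : R => x + s *: u) t = a *: u.
Proof.
rewrite derD; [|exact: differentiable_cst|exact: scaleid_diff].
rewrite derive_cst add0r (der_scale (a := fun s : R => s)); last exact: differentiable_cst; last exact: sn_diff (sn_id t).
by rewrite derive_cst scaler0 add0r derive_id.
Qed.

(** The mean value theorem for the restriction of [f] to a line. *)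
Lemma mvt_line V (f : V -> R) (x u : V) (h : R) : 0 <= h ->
  (forall t : R, 0 <= t <= h -> differentiable f (x + t *: u)) ->
  exists2 t : R, 0 <= t <= h & f (x + h *: u) - f x = h * 'D_u f (x + t *: u).
Proof.
move=> h0 df; pose g (t : R) := f (x + t *: u).
have dg t : 0 <= t <= h -> differentiable g t.
  by move=> th; apply: differentiable_compf; [exact: line_diff|exact: df].
have [] := @MVT_segment R g (fun t => 'D_u f (x + t *: u)) 0 h h0.
- move=> t; rewrite in_itv /= => /andP[t0 th].
  have tt : 0 <= t <= h by rewrite !ltW.
  apply: DeriveDef; first exact/diff_derivable/dg.
  rewrite /g (der_comp (f := fun s : R => x + s *: u) (g := f)); [|exact: line_diff|exact: df].
  by rewrite line_der scale1r.
- apply/continuous_in_subspaceT => t; rewrite inE /= in_itv /= => th.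
  exact/differentiable_continuous/dg.
move=> t; rewrite in_itv /= => th; rewrite /g scale0r addr0 subr0 => E.
by exists t => //; rewrite E mulrC.
Qed.

Definition segment_convex V (K : set V) :=
  forall a b (t : R), K a -> K b -> 0 <= t <= 1 -> K (a + t *: (b - a)).

(** The norm is dominated by the coordinates, and the real mean value theorem
    applies to each coordinate separately; the price is a factor that depends
    on the target space only. *)
Lemma mean_value_bound W {fW : findim W} : exists2 k : R, 0 < k &
  forall V (F : V -> W) (a b : V) C,
  (forall t : R, 0 <= t <= 1 -> differentiable F (a + t *: (b - a))) ->
  (forall t : R, 0 <= t <= 1 -> `|'D_(b - a) F (a + t *: (b - a))| <= C) ->
  `|F b - F a| <= k * C.
Proof.
have [[N [e [c [cc ce]]]]] := fW.
pose l i := s2val (cid2 (linear_lipschitz (cc i))).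
have l0 i : 0 < l i by exact: (s2valP (cid2 (linear_lipschitz (cc i)))).
have lP i y : `|c i y| <= l i * `|y| by exact: (s2valP' (cid2 (linear_lipschitz (cc i)))).
exists (1 + \sum_i l i * `|e i|).
  by rewrite ltr_pwDl// sumr_ge0// => i _; rewrite mulr_ge0// ltW.
move=> V F a b C dF hC.
have C0 : 0 <= C by rewrite (le_trans _ (hC 0 _))// lexx ler01.
rewrite (ce (F b - F a)); apply: (@le_trans _ _ (\sum_i l i * `|e i| * C)).
  apply: (le_trans (ler_norm_sum _ _ _)); apply: ler_sum => i _.
  rewrite normrZ.
  have dci y : differentiable (c i) y by exact: linear_differentiable.
  have [|t t01] := @mvt_line _ (fun y => c i (F y)) a (b - a) 1 ler01.
    by move=> t t01; apply: differentiable_compf => //; exact: dF.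
  have -> : a + 1 *: (b - a) = b by rewrite scale1r addrC subrK.
  rewrite mul1r -linearB => ->.
  rewrite (der_comp (f := F) (g := c i))//; last exact: dF.
  rewrite der_linear// mulrAC; apply: ler_wpM2r => //.
  by apply: (le_trans (lP _ _)); rewrite ler_pM2l//; exact: hC.
by rewrite -mulr_suml ler_wpM2r// lerDr.
Qed.

Lemma compact_norm_bound V W (K : set V) (F : V -> W) : compact K ->
  (forall x, K x -> {for x, continuous F}) ->
  exists2 C : R, 0 < C & forall x, K x -> `|F x| <= C.
Proof.
move=> cK cF.
have : compact (F @` K).
  apply: continuous_compact cK; apply/continuous_in_subspaceT => x; rewrite inE; exact: cF.
move=> /compact_bounded [M [_ hM]].
exists (Num.max 1 (M + 1)); first by rewrite lt_max ltr01.
move=> x Kx; rewrite le_max; apply/orP; right.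
by apply: (hM (M + 1)); [rewrite ltrDl|exists x].
Qed.

(** Only finitely many directions have to be bounded, by linearity. *)
Lemma compact_derivative_bound V W {fV : findim V} (K D : set V) (F : V -> W) :
  compact K -> K `<=` D -> Ck 1 D F ->
  exists2 C : R, 0 < C & forall x v, K x -> `|'D_v F x| <= C * `|v|.
Proof.
move=> cK KD hF; have [[N [e [c [cc ce]]]]] := fV.
pose l i := s2val (cid2 (linear_lipschitz (cc i))).
have l0 i : 0 < l i by exact: (s2valP (cid2 (linear_lipschitz (cc i)))).
have lP i y : `|c i y| <= l i * `|y| by exact: (s2valP' (cid2 (linear_lipschitz (cc i)))).
have B i : exists2 C : R, 0 < C & forall x, K x -> `|'D_(e i) F x| <= C.
  by apply: compact_norm_bound cK _ => x /KD Dx; exact: (hF.2 (e i) x Dx).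
pose b i := s2val (cid2 (B i)).
have b0 i : 0 < b i by exact: (s2valP (cid2 (B i))).
have bP i x : K x -> `|'D_(e i) F x| <= b i by exact: (s2valP' (cid2 (B i))).
exists (1 + \sum_i l i * b i).
  by rewrite ltr_pwDl// sumr_ge0// => i _; rewrite mulr_ge0// ltW.
move=> x v Kx; rewrite {1}(ce v) der_dir_sum; last by apply: hF.1; exact: KD.
apply: (@le_trans _ _ (\sum_i l i * b i * `|v|)).
  apply: (le_trans (ler_norm_sum _ _ _)); apply: ler_sum => i _.
  rewrite der_dirZ; last by apply: hF.1; exact: KD.
  rewrite normrZ mulrAC; apply: ler_pM => //; exact: bP.
by rewrite -mulr_suml ler_wpM2r// lerDr.
Qed.

Lemma convex_compact_lipschitz V W {fV : findim V} {fW : findim W} (K D : set V) (F : V -> W) :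
  compact K -> segment_convex K -> K `<=` D -> Ck 1 D F ->
  exists2 C : R, 0 < C & forall a b, K a -> K b -> `|F b - F a| <= C * `|b - a|.
Proof.
move=> cK vK KD hF.
have [C C0 hC] := compact_derivative_bound cK KD hF.
have [k k0 hk] := @mean_value_bound W _.
exists (k * C) => [|a b Ka Kb]; first exact: mulr_gt0.
rewrite -mulrA; apply: hk => t t01.
  by apply: hF.1; apply: KD; exact: vK.
by apply: hC; exact: vK.
Qed.

(** The mean value bound for [F] minus its linear part at [a], whose
    derivative is at most a multiple of the distance to [a]. *)
Lemma convex_compact_taylor V W {fV : findim V} {fW : findim W} (K D : set V) (F : V -> W) :
  compact K -> segment_convex K -> K `<=` D -> Ck 2 D F ->
  exists2 C : R, 0 < C & forall a b, K a -> K b ->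
    `|F b - F a - 'D_(b - a) F a| <= C * `|b - a| ^+ 2.
Proof.
move=> cK vK KD hF; have [[N [e [c [cc ce]]]]] := fV.
pose l i := s2val (cid2 (linear_lipschitz (cc i))).
have l0 i : 0 < l i by exact: (s2valP (cid2 (linear_lipschitz (cc i)))).
have lP i y : `|c i y| <= l i * `|y| by exact: (s2valP' (cid2 (linear_lipschitz (cc i)))).
have B i := convex_compact_lipschitz (fV := fV) (fW := fW) cK vK KD (hF.2 (e i)).
pose m i := s2val (cid2 (B i)).
have m0 i : 0 < m i by exact: (s2valP (cid2 (B i))).
have mP i := s2valP' (cid2 (B i)); rewrite -/(m _) in mP.
have [k k0 hk] := @mean_value_bound W _.
have S0 : 0 <= \sum_i l i * m i by rewrite sumr_ge0// => i _; rewrite mulr_ge0// ltW.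
exists (k * (1 + \sum_i l i * m i)) => [|a b Ka Kb].
  by rewrite mulr_gt0// ltr_pwDl.
have da x : K x -> differentiable F x by move=> /KD; exact: hF.1.
have lina : linear ('d F a) by exact: linearP.
have dL y : differentiable (fun z => 'd F a z) y.
  by apply: linear_differentiable; exact/diff_continuous/da.
(* The linear part at [a] is subtracted, at both end points. *)
have -> : F b - F a - 'D_(b - a) F a = (F b - 'd F a b) - (F a - 'd F a a).
  rewrite deriveE; last exact: da.
  by rewrite linearB !opprB ['d F a a - _]addrC addrACA [- F a + _]addrC.
rewrite -mulrA; apply: (hk _ (fun y => F y - 'd F a y)) => t t01.
  by apply: differentiableB => //; apply: da; exact: vK.
set x := a + _; have Kx : K x by exact: vK.
rewrite derB//; last exact: da.
rewrite der_linear; last exact/diff_continuous/da.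
rewrite -deriveE; last exact: da.
rewrite {1 2}(ce (b - a)) !der_dir_sum; try exact: da.
rewrite -sumrB; apply: (@le_trans _ _ (\sum_i l i * m i * `|b - a| ^+ 2)).
  apply: (le_trans (ler_norm_sum _ _ _)); apply: ler_sum => i _.
  rewrite !der_dirZ; try exact: da.
  rewrite -scalerBr normrZ expr2 mulrACA; apply: ler_pM => //.
  apply: (le_trans (mP i _ _ Ka Kx)); rewrite (ler_pM2l (m0 i)) /x.
  have -> : a + t *: (b - a) - a = t *: (b - a) by rewrite addrC addKr.
  rewrite normrZ.
  by case/andP: t01 => t0 t1; rewrite ger0_norm// ler_piMl.
by rewrite -mulr_suml ler_wpM2r ?exprn_ge0// lerDr.
Qed.

(** The image of a cube under the coordinate map. *)
Lemma convex_compact_nbhs V {fV : findim V} (x : V) (D : set V) : nbhs x D ->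
  exists K : set V, [/\ nbhs x K, compact K, segment_convex K & K `<=` D].
Proof.
move=> xD; have [[N [e [c [cc ce]]]]] := fV.
pose s (y : 'rV[R]_N) := \sum_i y 0 i *: e i.
have sc : continuous s.
  move=> y; apply: sn_cont; apply: sn_sum => i; apply: sn_scale; last exact: sn_cst.
  by apply: sn_entry; exact: sn_id.
pose y0 := \row_i c i x.
have sy0 : s y0 = x by rewrite [RHS]ce; apply: eq_bigr => i _; rewrite mxE.
have : nbhs y0 [set y | D (s y)] by apply: sc; rewrite sy0.
move=> /nbhs_ballP[r r0 hr].
pose Q := [set y : 'rV[R]_N | forall i, `[y0 0 i - r / 2, y0 0 i + r / 2]%classic (y 0 i)].
have r20 : 0 < r / 2 by rewrite divr_gt0.
have QD y : Q y -> D (s y).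
  move=> Qy; apply: hr; rewrite -ball_normE /=.
  rewrite (@le_lt_trans _ _ (r / 2))// ?ltr_pdivrMr ?ltr_pMr ?ltr1n//.
  rewrite /Num.norm /= mx_normrE; apply/bigmax_leP; split; first exact: ltW.
  move=> [i j] _ /=; rewrite !mxE ord1; have := Qy j; rewrite /= in_itv /= !mxE => /andP[h1 h2].
  by rewrite ler_distlC h1 h2.
exists (s @` Q); split.
- have : \forall z \near x, forall i, `|c i x - c i z| < r / 2.
    by apply: filter_forall => i; have /cvgrPdist_lt := cc i x; apply.
  apply: filterS => z hz; exists (\row_i c i z).
    move=> i; rewrite /= in_itv /= !mxE; have := hz i.
    by move=> /ltW; rewrite /= ler_distlC.
  by rewrite [RHS]ce; apply: eq_bigr => i _; rewrite mxE.
- apply: continuous_compact; first exact: continuous_subspaceT.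
  by apply: (@rV_compact R N (fun i => `[y0 0 i - r / 2, y0 0 i + r / 2]%classic)) => i; exact: segment_compact.
- move=> _ _ t [y Qy <-] [z Qz <-] /andP[t0 t1]; exists (y + t *: (z - y)).
    move=> i; have := Qy i; have := Qz i; rewrite /= !in_itv /= !mxE => /andP[? ?] /andP[? ?].
    by apply/andP; split; nra.
  rewrite /s -sumrB scaler_sumr -big_split /=; apply: eq_bigr => i _.
  by rewrite !mxE -scalerBl scalerA -scalerDl.
- by move=> _ [y Qy <-]; exact: QD.
Qed.

End MeanValue.

(** * Symmetry of second derivatives *)

Section Symmetry.
Context {R : realType}.
Implicit Types (U V W : normedModType R).

Lemma shift_diff V W (f : V -> W) (c y : V) :
  differentiable f (y + c) -> differentiable (fun z => f (z + c)) y.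
Proof.
move=> df; apply: (differentiable_compf (f := fun z => z + c)) => //.
Qed.

Lemma shift_der V W (f : V -> W) (c y u : V) :
  differentiable f (y + c) -> 'D_u (fun z => f (z + c)) y = 'D_u f (y + c).
Proof.
move=> df; rewrite (der_comp (f := fun z => z + c) (g := f))//.
rewrite (derD (f := fun z => z) (g := fun=> c)); last 2 first.
- exact: sn_diff (sn_id y).
- exact: differentiable_cst.
by rewrite derive_id derive_cst addr0.
Qed.

(** The mean value theorem is applied to the increment of [f] in the direction
    [v], as a function along [u], and then to the derivative along [u]. *)
Lemma second_difference V (D : set V) (f : V -> R) (x u v : V) (h : R) : 0 <= h ->
  Ck 2 D f -> (forall s t : R, 0 <= s <= h -> 0 <= t <= h -> D (x + s *: u + t *: v)) ->
  exists s t : R, [/\ 0 <= s <= h, 0 <= t <= h &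
    f (x + h *: u + h *: v) - f (x + h *: u) - (f (x + h *: v) - f x) =
    h * (h * 'D_v ('D_u f) (x + s *: u + t *: v))].
Proof.
move=> h0 hf hD.
have hh : 0 <= h <= h by rewrite h0 lexx.
have h00 : 0 <= (0 : R) <= h by rewrite h0 lexx.
have D1 s : 0 <= s <= h -> D (x + s *: u + h *: v) by move=> sh; exact: hD.
have D0 s : 0 <= s <= h -> D (x + s *: u).
  by move=> sh; have := hD s 0 sh h00; rewrite scale0r addr0.
pose g y := f (y + h *: v) - f y.
have [|s sh] := @mvt_line _ _ g x u h h0.
  move=> s sh; apply: differentiableB; first by apply: shift_diff; apply: hf.1; exact: D1.
  by apply: hf.1; exact: D0.
rewrite {1 2}/g addrAC => ->.
have [|t th E] := @mvt_line _ _ ('D_u f) (x + s *: u) v h h0.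
  by move=> t th; apply: (hf.2 u).1; exact: hD.
exists s, t; split=> //; rewrite -E /g derB ?shift_der//.
- by apply: hf.1; exact: D1.
- by apply: shift_diff; apply: hf.1; exact: D1.
- by apply: hf.1; exact: D0.
Qed.

Lemma sub_interchange (a b c k : R) : a - b - (c - k) = a - c - (b - k).
Proof. by lra. Qed.

Lemma dist_le_halves (a b c e : R) : `|a - c| < e / 2 -> `|b - c| < e / 2 -> `|a - b| <= e.
Proof.
rewrite !ltr_norml ler_norml => /andP[? ?] /andP[? ?].
by apply/andP; split; lra.
Qed.

(** Both sides are approximated by the same second difference quotient of [f]
    at [x], computed in the two possible orders. *)
Lemma schwarz_real V (D : set V) (f : V -> R) (x u v : V) : open D -> D x ->
  Ck 2 D f -> 'D_v ('D_u f) x = 'D_u ('D_v f) x.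
Proof.
move=> oD Dx hf; apply/eqP; rewrite -subr_eq0 -normr_le0; apply/ler_addgt0Pr => e e0.
rewrite add0r.
have nD : nbhs x D by exact: open_nbhs_nbhs.
have nA : \forall y \near x, `|'D_v ('D_u f) x - 'D_v ('D_u f) y| < e / 2.
  by have /cvgrPdist_lt := (hf.2 u).2 v x Dx; apply; rewrite divr_gt0.
have nB : \forall y \near x, `|'D_u ('D_v f) x - 'D_u ('D_v f) y| < e / 2.
  by have /cvgrPdist_lt := (hf.2 v).2 u x Dx; apply; rewrite divr_gt0.
have [d d0 hd] : exists2 d : R, 0 < d & ball x d `<=` [set y | D y /\
    (`|'D_v ('D_u f) x - 'D_v ('D_u f) y| < e / 2 /\
     `|'D_u ('D_v f) x - 'D_u ('D_v f) y| < e / 2)].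
  by apply/nbhs_ballP; apply: filterS3 nD nA nB.
(* The parallelogram with sides h u and h v at [x] must lie in the ball of
   radius [d]. *)
pose h := d / 2 / (1 + `|u| + `|v|).
have k0 : 0 < 1 + `|u| + `|v| by rewrite -addrA ltr_pwDl// addr_ge0.
have h0 : 0 < h by rewrite !divr_gt0.
have hd' (s t : R) : 0 <= s <= h -> 0 <= t <= h -> ball x d (x + s *: u + t *: v).
  move=> /andP[s0 sh] /andP[t0 th]; rewrite -ball_normE /=.
  rewrite -addrA opprD addrA subrr add0r normrN.
  apply: (le_lt_trans (ler_normD _ _)); rewrite !normrZ !ger0_norm//.
  apply: (@le_lt_trans _ _ (h * (1 + `|u| + `|v|))).
    rewrite !mulrDr mulr1 -addrA ler_wpDl// ?(ltW h0)// lerD// ler_wpM2r//.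
  by rewrite /h mulfVK ?gt_eqF// ltr_pdivrMr// ltr_pMr// ltr1n.
have [|s [t [sh th E]]] := @second_difference V D f x u v h (ltW h0) hf.
  by move=> s t sh th; exact: (hd _ (hd' s t sh th)).1.
have [|s' [t' [sh' th' E']]] := @second_difference V D f x v u h (ltW h0) hf.
  by move=> s' t' sh' th'; rewrite addrAC; exact: (hd _ (hd' t' s' th' sh')).1.
have hn0 : h != 0 by rewrite gt_eqF.
move: E'; rewrite [x + h *: v + h *: u]addrAC sub_interchange => E'.
have {E E'} EE := mulfI hn0 (mulfI hn0 (etrans (esym E) E')).
have [_ [h1 _]] := hd _ (hd' s t sh th).
have := hd _ (hd' t' s' th' sh'); rewrite addrAC => -[_ [_ h2]].
rewrite /= EE in h1; rewrite /= in h2.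
exact: dist_le_halves h1 h2.
Qed.

Lemma schwarz V W {fW : findim W} (F : V -> W) (x u v : V) : smooth_near F x ->
  'D_v ('D_u F) x = 'D_u ('D_v F) x.
Proof.
move=> sF; have [[N [e [c [cc ce]]]]] := fW.
suff EE i : c i ('D_v ('D_u F) x) = c i ('D_u ('D_v F) x).
  by rewrite [LHS]ce [RHS]ce; apply: eq_bigr => i _; rewrite EE.
have dci y : differentiable (c i) y by exact: linear_differentiable.
have E (G : V -> W) w y : smooth_near G y -> 'D_w (fun z => c i (G z)) y = c i ('D_w G y).
  by move=> /sn_diff dG; rewrite (der_comp (f := G) (g := c i))// der_linear.
have E2 w w' : 'D_w' ('D_w (fun z => c i (F z))) x = c i ('D_w' ('D_w F) x).
  rewrite -E; last exact: sn_der.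
  apply: near_eq_derive; apply: filterS (sn_near sF) => y sFy; exact: E.
rewrite -!E2.
have [D [oD Dx] hD] : smooth_near (fun z => c i (F z)) x.
  by apply: (sn_comp (G := c i) sF); apply: sn_lin => //; exact: linearP.
exact: (schwarz_real _ _ oD Dx (hD 2%N)).
Qed.

End Symmetry.

(** * The dyadic Euler scheme *)

Section Sequences.
Context {R : realType}.
Implicit Types (V W : normedModType R).

Definition dyadic (i : nat) : R := (2 ^+ i)^-1.

Lemma dyadic_gt0 i : 0 < dyadic i.
Proof. by rewrite /dyadic invr_gt0 exprn_gt0. Qed.

Lemma dyadic_ge0 i : 0 <= dyadic i. Proof. exact/ltW/dyadic_gt0. Qed.

Lemma dyadicS i : dyadic i = dyadic i.+1 + dyadic i.+1.
Proof. by rewrite /dyadic exprS invfM; move: ((2 ^+ i)^-1) => a; field. Qed.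

Lemma dyadic_mul_le i k : (k <= 2 ^ i)%N -> k%:R * dyadic i <= 1.
Proof.
by move=> k2; rewrite /dyadic ler_pdivrMr ?exprn_gt0// mul1r -natrX ler_nat.
Qed.

Lemma dyadic_cvg0 : dyadic @ \oo --> (0 : R).
Proof.
have -> : dyadic = geometric 1 (2^-1).
  by apply/funext => i; rewrite /dyadic /geometric /= mul1r exprVn.
by apply: cvg_geometric; rewrite ger0_norm ?invr_ge0// invf_lt1// ltr1n.
Qed.

Lemma near_dyadic (e C : R) : 0 < e -> \forall i \near \oo, C * dyadic i < e.
Proof.
move=> e0; have h : (fun i => C * dyadic i) @ \oo --> C * 0 by apply: cvgMl_tmp; exact: dyadic_cvg0.
rewrite mulr0 in h; have /cvgrPdist_lt/(_ _ e0) := h.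
by apply: filterS => i; rewrite sub0r normrN; apply: le_lt_trans; exact: ler_norm.
Qed.

(** With step 2^-i, at most 2^i steps multiply the error by no more than (1 +
    2^-i L)^(2^i), which is bounded by exp L; the local errors, of second
    order, add up to a global error of first order. *)
Lemma dyadic_gronwall (e : nat -> R) i (L c : R) : 0 <= L -> 0 <= c -> 0 <= e 0%N ->
  (forall k, (k < 2 ^ i)%N -> e k.+1 <= (1 + dyadic i * L) * e k + dyadic i ^+ 2 * c) ->
  forall k, (k <= 2 ^ i)%N -> e k <= expR L * (e 0%N + dyadic i * c).
Proof.
move=> L0 c0 e0 he k ki; set h := dyadic i in he *.
have h0 : 0 < h by exact: dyadic_gt0.
have q1 : 1 <= 1 + h * L by rewrite lerDl mulr_ge0// ltW.
have q0 : 0 <= 1 + h * L by rewrite (le_trans _ q1).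
have H : e k <= (1 + h * L) ^+ k * (e 0%N + k%:R * (h ^+ 2 * c)).
  elim: k ki => [|k IH] ki; first by rewrite expr0 mul1r mul0r addr0.
  apply: (le_trans (he _ ki)); rewrite [(1 + h * L) ^+ _]exprS -[X in _ <= X]mulrA.
  have {}IH := IH (ltnW ki).
  have hc0 : 0 <= h ^+ 2 * c by rewrite mulr_ge0// exprn_ge0// ltW.
  apply: (@le_trans _ _ ((1 + h * L) * ((1 + h * L) ^+ k * (e 0%N + k%:R * (h ^+ 2 * c)) + h ^+ 2 * c))).
    rewrite mulrDr; apply: lerD; first by rewrite ler_wpM2l.
    by rewrite ler_peMl.
  rewrite ler_wpM2l//; have : 1 <= (1 + h * L) ^+ k by rewrite exprn_ege1.
  move: hc0; rewrite -natr1; move: (h ^+ 2 * c) ((1 + h * L) ^+ k) (e 0%N) (k%:R) => X q a kr X0 q2.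
  by have := ler_peMl X0 q2; lra.
apply: (le_trans H); apply: ler_pM.
- by rewrite exprn_ge0.
- by rewrite addr_ge0// mulr_ge0// mulr_ge0// exprn_ge0// ltW.
- apply: (@le_trans _ _ (expR (h * L) ^+ k)).
    by rewrite lerXn2r ?nnegrE ?expR_ge0// expR_ge1Dx.
  rewrite -expRM_natl ler_expR mulrA ler_piMl//.
  exact: dyadic_mul_le.
- rewrite lerD2l expr2 !mulrA ler_wpM2r// ler_piMl ?(ltW h0)//.
  exact: dyadic_mul_le.
Qed.

Lemma lim_norm_le V (u : nat -> V) (l a : V) (B : R) :
  u @ \oo --> l -> (\forall n \near \oo, `|a - u n| <= B) -> `|a - l| <= B.
Proof.
move=> ul hB; apply/ler_addgt0Pr => e e0.
have /cvgrPdist_lt/(_ _ e0) ul' := ul.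
have [n [h1 h2]] := filter_ex (filterI hB ul').
have -> : a - l = (a - u n) - (l - u n) by rewrite opprB addrA subrK.
by apply: (le_trans (ler_normB _ _)); apply: lerD => //; exact: ltW.
Qed.

(** Finite-dimensional spaces are complete: a sequence with geometrically
    decaying increments converges, coordinate by coordinate. *)
Lemma geometric_cvg V {fV : findim V} (u : nat -> V) (C : R) :
  (forall i, `|u i.+1 - u i| <= C * dyadic i) ->
  exists l, u @ \oo --> l /\ forall i, `|u i - l| <= 2 * C * dyadic i.
Proof.
move=> hu; have [[N [e [c [cc ce]]]]] := fV.
have C0 : 0 <= C by have := le_trans (normr_ge0 _) (hu 0%N); rewrite /dyadic expr0 invr1 mulr1.
have cv j : cvgn (fun i => c j (u i)).
  have [k k0 hk] := linear_lipschitz (cc j).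
  pose x i := c j (u i).
  have : cvgn (series (telescope x)).
    apply: normed_cvg; apply: (series_le_cvg (v_ := geometric (k * C) (2^-1))).
    - by move=> n; exact: normr_ge0.
    - by move=> n; rewrite geometric_ge0// mulr_ge0// ltW.
    - move=> n; rewrite /geometric /= /telescope /= /x -linearB.
      apply: (le_trans (hk _)); rewrite -mulrA ler_pM2l// exprVn; exact: hu.
    - by apply: is_cvg_geometric_series; rewrite ger0_norm ?invr_ge0// invf_lt1// ltr1n.
  rewrite telescopeK => h.
  have -> : (fun i => c j (u i)) = (fun n => [sequence x m - x 0%N]_m n + x 0%N).
    by apply/funext => n /=; rewrite subrK.
  by apply: is_cvgD => //; exact: is_cvg_cst.
pose l := \sum_j lim ((fun i => c j (u i)) @ \oo) *: e j.
have ul : u @ \oo --> l.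
  have -> : u = (fun i => \sum_j c j (u i) *: e j) by apply/funext => i; exact: ce.
  apply: (@cvg_big _ _ _ _ xpredT add_continuous) => j _.
  by apply: cvgZr_tmp; exact: cv.
exists l; split=> // i; apply: (lim_norm_le ul).
near=> n; have ni : (i <= n)%N by near: n; exact: nbhs_infty_ge.
rewrite -(subnKC ni); move: (n - i)%N => m {ni}.
have : `|u (i + m)%N - u i| <= 2 * C * (dyadic i - dyadic (i + m)).
  elim: m => [|m IH]; first by rewrite addn0 !subrr normr0 mulr0.
  have -> : u (i + m.+1)%N - u i = (u (i + m).+1%N - u (i + m)%N) + (u (i + m)%N - u i).
    by rewrite addnS addrA subrK.
  apply: (le_trans (ler_normD _ _)); apply: (le_trans (lerD (hu _) IH)).
  rewrite addnS (dyadicS (i + m)); move: (dyadic _) (dyadic (i + m).+1) => a b.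
  by rewrite le_eqVlt; apply/orP; left; apply/eqP; ring.
rewrite distrC => h; apply: (le_trans h).
by rewrite ler_wpM2l ?mulr_ge0// lerBlDr lerDl dyadic_ge0.
Unshelve. all: by end_near. Qed.

End Sequences.
Arguments dyadic {R} i.

Section Euler.
Context {R : realType}.
Implicit Types (V W : normedModType R).

Definition euler_step V (F : V -> V) (h : R) (z : V) : V := z + h *: F z.

Definition euler_iter V (F : V -> V) i k (z : V) : V :=
  iter k (euler_step F (dyadic i)) z.

Definition euler V (F : V -> V) i (z : V) : V := euler_iter F i (2 ^ i) z.

(** The flow at time one; at time t it is the flow at time one of t F. *)
Definition flow1 V (F : V -> V) (z : V) : V := lim (euler F ^~ z @ \oo).

Lemma euler_iterS V (F : V -> V) i k z :
  euler_iter F i k.+1 z = euler_iter F i k z + dyadic i *: F (euler_iter F i k z).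
Proof. by []. Qed.

(** The scheme is confined near [z0] to a convex compact set on which the field
    is smooth: this makes all the estimates below uniform. *)
Definition tame V (F : V -> V) (z0 : V) : Prop :=
  exists D K : set V, [/\ forall x, D x -> smooth_near F x, K `<=` D, compact K, segment_convex K &
    \forall z \near z0, forall i k, (k <= 2 ^ i)%N -> K (euler_iter F i k z)].

Lemma tame_near V (F : V -> V) z0 : tame F z0 -> \forall z \near z0, tame F z.
Proof.
move=> [D [K [sD KD cK vK h]]]; apply: filterS (nbhs_interior h) => z hz.
by exists D, K.
Qed.

Lemma tame_open V (F : V -> V) : open (tame F).
Proof. by rewrite openE => z /tame_near. Qed.

Lemma refine_identity V (h : R) (p q r s t : V) :
  p + h *: r + h *: t - (q + (h + h) *: s) =
  (p - q) + (h + h) *: (r - s) + h *: (t - r).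
Proof.
have E (x y z : V) : p + x + z - (q + (x - y)) = p - q + y + z.
  rewrite opprD opprB [y - x]addrC !addrA [p + x + z]addrAC [p + z + x - q - x]addrAC.
  by rewrite addrK [p + z - q]addrAC [_ + z + y]addrAC.
rewrite -(E ((h + h) *: r)); congr (_ - (_ + _)); last by rewrite -scalerBr subKr.
by rewrite scalerDl scalerBr -!addrA; congr (_ + (_ + _)); rewrite addrC subrK.
Qed.

(** Two half steps differ from one full step by a term of second order, and
    this error accumulates to first order over the unit time interval. *)
Lemma euler_refine V {fV : findim V} (F : V -> V) (D K : set V) :
  (forall x, D x -> smooth_near F x) -> K `<=` D -> compact K -> segment_convex K ->
  exists2 C : R, 0 < C & forall z, (forall i k, (k <= 2 ^ i)%N -> K (euler_iter F i k z)) ->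
    forall i, `|euler F i.+1 z - euler F i z| <= C * dyadic i.
Proof.
move=> sD KD cK vK.
have hF k : Ck k D F by exact: sn_Ck.
have [L L0 hL] := convex_compact_lipschitz (fV := fV) (fW := fV) cK vK KD (hF 1%N).
have [B B0 hB] := compact_norm_bound cK (fun x Kx => sn_cont (sD x (KD x Kx))).
exists (expR L * (L * B)) => [|z hz i]; first by rewrite !mulr_gt0// expR_gt0.
pose h := dyadic i.+1 : R; have h0 : 0 < h by exact: dyadic_gt0.
(* Two fine steps of [a] are compared with one coarse step of [b]. *)
pose a k := euler_iter F i.+1 k.*2 z; pose b k := euler_iter F i k z.
have E : `|a (2 ^ i)%N - b (2 ^ i)%N| <= expR L * (`|a 0%N - b 0%N| + dyadic i * (L * B)).
  apply: (@dyadic_gronwall R (fun k => `|a k - b k|)) => //; first exact: ltW.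
    by rewrite mulr_ge0// ltW.
  move=> k ki; have k2 : (k.*2.+2 <= 2 ^ i.+1)%N by rewrite -doubleS expnS mul2n leq_double.
  have k1 : (k.*2.+1 <= 2 ^ i.+1)%N by exact: ltnW.
  have Ka : K (a k) by apply: hz; exact: ltnW.
  have Ka' : K (euler_iter F i.+1 k.*2.+1 z) by exact: hz.
  have Kb : K (b k) by apply: hz; exact: ltnW.
  have aS : a k.+1 = a k + h *: F (a k) + h *: F (euler_iter F i.+1 k.*2.+1 z) by [].
  have bS : b k.+1 = b k + (h + h) *: F (b k) by rewrite /h -dyadicS.
  set a' := euler_iter F i.+1 k.*2.+1 z in aS Ka'.
  have a'E : a' - a k = h *: F (a k) by rewrite addrC addKr.
  have -> : a k.+1 - b k.+1 = (a k - b k) + (h + h) *: (F (a k) - F (b k)) + h *: (F a' - F (a k)).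
    rewrite aS bS; exact: refine_identity.
  apply: (le_trans (ler_normD _ _)).
  apply: (@le_trans _ _ (`|a k - b k| + (h + h) * (L * `|a k - b k|) + h * (L * (h * B)))).
    apply: lerD.
      apply: (le_trans (ler_normD _ _)); rewrite lerD2l normrZ ger0_norm ?addr_ge0 ?(ltW h0)//.
      by rewrite ler_wpM2l ?addr_ge0 ?(ltW h0)//; exact: hL.
    rewrite normrZ ger0_norm ?(ltW h0)// ler_wpM2l ?(ltW h0)//.
    apply: (le_trans (hL _ _ Ka Ka')); rewrite ler_wpM2l ?(ltW L0)// a'E.
    by rewrite normrZ ger0_norm ?(ltW h0)// ler_wpM2l ?(ltW h0)//; exact: hB.
  rewrite dyadicS -/h; move: (`|a k - b k|) => x.
  have : 0 <= h * h * (L * B) by rewrite !mulr_ge0// ltW.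
  by move: h0 B0 L0; clear; move=> *; nra.
move: E; rewrite /a /b /= -mul2n -expnS subrr normr0 add0r => E.
by rewrite mulrAC -mulrA; exact: E.
Qed.

Lemma tame_flow V {fV : findim V} (F : V -> V) z0 : tame F z0 ->
  exists2 C : R, 0 < C & \forall z \near z0,
    forall i, `|euler F i z - flow1 F z| <= C * dyadic i.
Proof.
move=> [D [K [sD KD cK vK h]]].
have [C C0 hC] := euler_refine (fV := fV) sD KD cK vK.
exists (2 * C); first by rewrite mulr_gt0.
apply: filterS h => z hz.
have [l [hl]] := geometric_cvg (fV := fV) (hC z hz).
by rewrite /flow1 (cvg_lim (@norm_hausdorff _ _) hl).
Qed.

Lemma tame_cvg V {fV : findim V} (F : V -> V) z0 : tame F z0 ->
  euler F ^~ z0 @ \oo --> flow1 F z0.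
Proof.
move=> /tame_flow [C C0 /nbhs_singleton hC].
apply/cvgrPdist_lt => e e0; have := @near_dyadic R e C e0.
by apply: filterS => i; apply: le_lt_trans; rewrite distrC.
Qed.

(** The tangent field governs the derivatives of the flow of [F], and the Euler
    scheme commutes with this construction. *)
Definition tangent_field V (F : V -> V) : V * V -> V * V :=
  fun z => (F z.1, 'D_z.2 F z.1).

Lemma tangent_smooth V {fV : findim V} (F : V -> V) z v :
  smooth_near F z -> smooth_near (tangent_field F) (z, v).
Proof.
move=> sF; apply: sn_pair; last exact: sn_tangent.
apply: (sn_comp (F := fst)) => //.
by apply: sn_lin => // z'; exact: cvg_fst.
Qed.

(** The chain rule, one step at a time. *)
Lemma euler_tangent V {fV : findim V} (F : V -> V) i k z u :
  (forall j, (j < k)%N -> smooth_near F (euler_iter F i j z)) ->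
  smooth_near (euler_iter F i k) z /\
  euler_iter (tangent_field F) i k (z, u) = (euler_iter F i k z, 'D_u (euler_iter F i k) z).
Proof.
elim: k => [|k IH] h; first by split; [exact: sn_id|rewrite /= derive_id].
have [sk Ek] : smooth_near (euler_iter F i k) z /\
  euler_iter (tangent_field F) i k (z, u) = (euler_iter F i k z, 'D_u (euler_iter F i k) z).
  by apply: IH => j jk; apply: h; exact: ltnW.
have sFk : smooth_near F (euler_iter F i k z) by exact: h.
have s2 : smooth_near (fun y => F (euler_iter F i k y)) z by exact: (sn_comp sk sFk).
split; first by apply: snD => //; apply: sn_scale => //; exact: sn_cst.
rewrite euler_iterS Ek /tangent_field /=.
have -> : 'D_u (euler_iter F i k.+1) z =
    'D_u (euler_iter F i k) z + dyadic i *: 'D_('D_u (euler_iter F i k) z) F (euler_iter F i k z).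
  rewrite (derD (f := euler_iter F i k) (g := fun y => dyadic i *: F (euler_iter F i k y))).
  - rewrite (der_scale (a := fun=> dyadic i) (f := fun y => F (euler_iter F i k y))).
    + rewrite derive_cst scale0r addr0 (der_comp (f := euler_iter F i k) (g := F))//; exact: sn_diff.
    + exact: differentiable_cst.
    + exact: sn_diff.
  - exact: sn_diff.
  - by apply: differentiable_scale; [exact: differentiable_cst|exact: sn_diff].
by [].
Qed.

End Euler.

(** * Smoothness of the flow *)

Section Flow.
Context {R : realType}.
Implicit Types (V W : normedModType R).

(** Rescaling a small convex compact neighborhood of the origin. *)
Lemma convex_compact_ball V {fV : findim V} (r : R) : 0 < r ->
  exists K : set V, [/\ forall v, `|v| <= r -> K v, compact K & segment_convex K].
Proof.
move=> r0; have [K [K0 cK vK _]] := convex_compact_nbhs (fV := fV) (@filterT _ (nbhs (0 : V)) _).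
have /nbhs_ballP[d d0 hd] := K0.
pose s := 2 * r / d; have s0 : 0 < s by rewrite divr_gt0// mulr_gt0.
exists (( *:%R s) @` K); split.
- move=> v vr; exists (s^-1 *: v); last by rewrite scalerA divff ?gt_eqF// scale1r.
  apply: hd; rewrite -ball_normE /= sub0r normrN normrZ ger0_norm ?invr_ge0 ?(ltW s0)//.
  rewrite mulrC ltr_pdivrMr// (le_lt_trans vr)// /s mulrC divfK ?gt_eqF//.
  by rewrite ltr_pMl// ltr1n.
- apply: continuous_compact cK; apply: continuous_subspaceT; exact: scaler_continuous.
- move=> _ _ t [a Ka <-] [b Kb <-] t01; exists (a + t *: (b - a)); first exact: vK.
  by rewrite scalerDr !scalerBr !scalerA mulrC.
Qed.

Lemma segment_convexX V W (K : set V) (L : set W) :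
  segment_convex K -> segment_convex L -> segment_convex (K `*` L).
Proof.
by move=> vK vL [a a'] [b b'] t [/= Ka La] [/= Kb Lb] t01; split; [exact: vK|exact: vL].
Qed.

Lemma euler_tangent1 V {fV : findim V} (F : V -> V) (D K : set V) i k z u :
  (forall x, D x -> smooth_near F x) -> K `<=` D ->
  (forall i k, (k <= 2 ^ i)%N -> K (euler_iter F i k z)) -> (k <= 2 ^ i)%N ->
  smooth_near (euler_iter F i k) z /\
  euler_iter (tangent_field F) i k (z, u) = (euler_iter F i k z, 'D_u (euler_iter F i k) z).
Proof.
move=> sD KD hz ki; apply: euler_tangent => j jk; apply: sD; apply: KD; apply: hz.
exact: ltnW (leq_trans jk ki).
Qed.

(** The field component stays in [K] by hypothesis, and the vector component
    grows at most exponentially, so it stays in a ball. *)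
Lemma tame_tangent V {fV : findim V} (F : V -> V) z0 v0 :
  tame F z0 -> tame (tangent_field F) (z0, v0).
Proof.
move=> [D [K [sD KD cK vK h]]].
have [C C0 hC] := compact_derivative_bound (fV := fV) cK KD (sn_Ck 1 sD).
(* The growth factor exp C bounds the vector component for all initial vectors
   of norm at most |v0| + 1. *)
pose r := expR C * (`|v0| + 1).
have r0 : 0 < r by rewrite mulr_gt0 ?expR_gt0// ltr_wpDl.
have [L [hL cL vL]] := convex_compact_ball (fV := fV) r0.
exists (D `*` setT), (K `*` L); split.
- by move=> [x v] [/= Dx _]; apply: tangent_smooth; exact: sD.
- by move=> [x v] [/= Kx _]; split=> //; exact: KD.
- exact: compact_setX.
- exact: segment_convexX.
have hv : \forall v \near v0, `|v| <= `|v0| + 1.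
  apply/nbhs_ballP; exists 1 => //= v; rewrite -ball_normE /= => v1.
  rewrite -[v](subrK v0) addrC; apply: (le_trans (ler_normD _ _)).
  by rewrite lerD2l distrC ltW.
exists ([set z | forall i k, (k <= 2 ^ i)%N -> K (euler_iter F i k z)], [set v | `|v| <= `|v0| + 1]).
  by split.
move=> [z v] [/= hz vv] i k ki.
have T j : (j <= 2 ^ i)%N -> _ := fun hj => @euler_tangent1 V fV F D K i j z v sD KD hz hj.
rewrite (T _ ki).2; split => /=; first exact: hz.
apply: hL; pose e j := `|'D_v (euler_iter F i j) z|.
have e0 : e 0%N = `|v| by rewrite /e [X in `|X|](derive_id).
apply: (@le_trans _ _ (expR C * (e 0%N + dyadic i * 0))).
  apply: (@dyadic_gronwall R e) => //; [exact: ltW|exact: normr_ge0|].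
  move=> j ji; rewrite mulr0 addr0.
  have [_ E1] := T _ ji; have [_ E2] := T _ (ltnW ji).
  move/(congr1 snd): E1; rewrite euler_iterS E2 /= => E1; rewrite /e -E1.
  rewrite mulrDl mul1r; apply: (le_trans (ler_normD _ _)); rewrite lerD2l normrZ.
  rewrite ger0_norm ?dyadic_ge0// -mulrA ler_wpM2l ?dyadic_ge0//; apply: hC.
  by apply: hz; exact: ltnW.
by rewrite mulr0 addr0 e0 /r ler_wpM2l// expR_ge0.
Qed.

(** One step is Lipschitz with constant 1 + 2^-i L, so [dyadic_gronwall]
    applies without local error. *)
Lemma euler_lipschitz V {fV : findim V} (F : V -> V) (D K : set V) :
  (forall x, D x -> smooth_near F x) -> K `<=` D -> compact K -> segment_convex K ->
  exists2 C : R, 0 < C & forall a b i,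
    (forall k, (k <= 2 ^ i)%N -> K (euler_iter F i k a)) ->
    (forall k, (k <= 2 ^ i)%N -> K (euler_iter F i k b)) ->
    `|euler F i a - euler F i b| <= C * `|a - b|.
Proof.
move=> sD KD cK vK.
have [L L0 hL] := convex_compact_lipschitz (fV := fV) (fW := fV) cK vK KD (sn_Ck 1 sD).
exists (expR L) => [|a b i ha hb]; first exact: expR_gt0.
have -> : `|a - b| = `|a - b| + dyadic i * 0 by rewrite mulr0 addr0.
apply: (@dyadic_gronwall R (fun k => `|euler_iter F i k a - euler_iter F i k b|)) => //.
  exact: ltW.
move=> k ki; rewrite mulr0 addr0 !euler_iterS opprD addrACA -scalerBr mulrDl mul1r.
apply: (le_trans (ler_normD _ _)); rewrite lerD2l normrZ ger0_norm ?dyadic_ge0//.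
rewrite -mulrA ler_wpM2l ?dyadic_ge0//; apply: hL; [apply: hb|apply: ha]; exact: ltnW.
Qed.

Lemma quadratic_diff V W (f : V -> W) (L : V -> W) (z : V) (C : R) :
  linear L -> continuous L ->
  (\forall h \near (0 : V), `|f (z + h) - f z - L h| <= C * `|h| ^+ 2) ->
  differentiable f z /\ forall h, 'D_h f z = L h.
Proof.
move=> Ll Lc hC.
pose L' : {linear V -> W} := HB.pack L (GRing.isLinear.Build _ _ _ _ _ Ll).
have E : f \o shift z = cst (f z) + L' +o_ (0 : V) id.
  apply/eqaddoP => e e0.
  have hs : \forall h \near (0 : V), C * `|h| <= e.
    have [C0|C0] := leP C 0.
      by apply: nearW => h; rewrite (le_trans _ (ltW e0))// mulr_le0_ge0.
    have : \forall h \near (0 : V), `|h| < e / C.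
      by apply: cvgr0_norm_lt; [exact: cvg_id|rewrite divr_gt0].
    by apply: filterS => h /ltW; rewrite ler_pdivlMr// mulrC.
  apply: filterS2 hC hs => h h1 h2; rewrite !fctE /= [h + z]addrC.
  have -> : f (z + h) - (f z + L h) = f (z + h) - f z - L h by rewrite opprD addrA.
  by apply: (le_trans h1); rewrite expr2 mulrA ler_wpM2r.
have dE := diff_unique (df := L') Lc E.
have df : differentiable f z by apply/diff_locallyP; rewrite dE.
by split=> // h; rewrite deriveE// dE.
Qed.

Lemma findim_linear_continuous V W {fV : findim V} (L : V -> W) : linear L -> continuous L.
Proof.
move=> Ll x; have [[N [e [c [cc ce]]]]] := fV.
pose L' : {linear V -> W} := HB.pack L (GRing.isLinear.Build _ _ _ _ _ Ll).
have -> : L = fun y => \sum_i c i y *: L (e i).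
  apply/funext => y; rewrite {1}(ce y) -[L]/(L' : V -> W) linear_sum.
  by apply: eq_bigr => i _; rewrite linearZ.
apply: sn_cont; apply: sn_sum => i; apply: sn_scale; last exact: sn_cst.
by apply: sn_lin => //; exact: linearP.
Qed.

Lemma dyadic_cvg V (u : nat -> V) (l : V) (C : R) :
  (forall i, `|u i - l| <= C * dyadic i) -> u @ \oo --> l.
Proof.
move=> hC; apply/cvgrPdist_lt => e e0; have := @near_dyadic R e C e0.
by apply: filterS => i; apply: le_lt_trans; rewrite distrC.
Qed.

(** The Taylor remainders of the maps [euler F i] at [z0] are quadratic with a
    constant independent of [i], because the derivatives of these maps are
    given by the scheme of the tangent field, which is uniformly Lipschitz.
    The estimate passes to the limit. *)
Lemma flow_tangent V {fV : findim V} (F : V -> V) z0 : tame F z0 ->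
  differentiable (flow1 F) z0 /\
  forall u, 'D_u (flow1 F) z0 = (flow1 (tangent_field F) (z0, u)).2.
Proof.
move=> tF.
have tT := @tame_tangent V fV F z0 0 tF.
have [C1 C10 nC1] := tame_flow (fV := fV) tF.
have [D [K [sD KD cK vK nK]]] := tF.
have [D' [K' [sD' KD' cK' vK' nK']]] := tT.
have [L L0 hL] := euler_lipschitz (fV := findimX fV fV) sD' KD' cK' vK'.
have [k k0 hk] := @mean_value_bound R V fV.
(* A common radius for the confinement of the scheme, its convergence, and the
   confinement of the tangent scheme. *)
have [r r0 hr] : exists2 r : R, 0 < r & forall z v, `|z - z0| < r -> `|v| < r ->
    [/\ forall i k, (k <= 2 ^ i)%N -> K (euler_iter F i k z),
        forall i, `|euler F i z - flow1 F z| <= C1 * dyadic i &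
        forall i k, (k <= 2 ^ i)%N -> K' (euler_iter (tangent_field F) i k (z, v))].
  have n1 : nbhs z0 ([set z | forall i k, (k <= 2 ^ i)%N -> K (euler_iter F i k z)] `&`
                     [set z | forall i, `|euler F i z - flow1 F z| <= C1 * dyadic i]).
    exact: filterI nK nC1.
  have n2 : nbhs (z0, 0 : V)
    [set z | forall i k, (k <= 2 ^ i)%N -> K' (euler_iter (tangent_field F) i k z)] := nK'.
  have /nbhs_ballP[r1 r10 hr1] := n1.
  have /nbhs_ballP[r2 r20 hr2] := n2.
  exists (Num.min r1 r2); first by rewrite lt_min r10.
  move=> z v; rewrite !lt_min => /andP[z1 z2] /andP[v1 v2].
  have [|h1 h2] := hr1 z; first by rewrite -ball_normE /= distrC.
  split=> //; apply: hr2; rewrite -ball_normE /= prod_normE /=.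
  by rewrite gt_max /= sub0r normrN distrC z2.
have r00 : `|z0 - z0| < r by rewrite subrr normr0.
have Kz0 : forall i k, (k <= 2 ^ i)%N -> K (euler_iter F i k z0).
  by have [|//] := hr z0 0 r00; rewrite normr0.
have T i z v : `|z - z0| < r -> smooth_near (euler F i) z /\
    euler (tangent_field F) i (z, v) = (euler F i z, 'D_v (euler F i) z).
  move=> zr; apply: (@euler_tangent1 V fV F D K i (2 ^ i) z v sD KD _ (leqnn _)).
  by have [|//] := hr z 0 zr; rewrite normr0.
pose A u := (flow1 (tangent_field F) (z0, u)).2.
have cA u : (fun i => 'D_u (euler F i) z0) @ \oo --> A u.
  have c := tame_cvg (fV := findimX fV fV) (@tame_tangent V fV F z0 u tF).
  have H : (fun i => (euler (tangent_field F) i (z0, u)).2) @ \oo --> A u.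
    by apply: (cvg_comp _ _ c); exact: cvg_snd.
  apply: cvg_trans H; apply: near_eq_cvg; apply: nearW => i /=.
  by rewrite (T i z0 u r00).2.
have dE i : differentiable (euler F i) z0 by exact: sn_diff (T i z0 0 r00).1.
have lA : linear A.
  move=> a x y; apply: (cvg_unique (@norm_hausdorff _ _) (cA (a *: x + y))).
  have : (fun i => a *: 'D_x (euler F i) z0 + 'D_y (euler F i) z0) @ \oo --> a *: A x + A y.
    by apply: cvgD => //; apply: cvgZl_tmp.
  move=> H; apply: cvg_trans H; apply: near_eq_cvg; apply: nearW => i /=.
  by rewrite der_dirD// der_dirZ.
have cvE z : `|z - z0| < r -> euler F ^~ z @ \oo --> flow1 F z.
  by move=> zr; have [|_ h _] := hr z 0 zr; [rewrite normr0|exact: dyadic_cvg h].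
pose s := r / 2; have s0 : 0 < s by rewrite divr_gt0.
have sr : s < r by rewrite ltr_pdivrMr// ltr_pMr// ltr1n.
(* The tangent scheme is Lipschitz for vectors of fixed length [s], while the
   derivative is linear in the vector: rescaling [h] to the length [s]
   produces the second factor |h|. *)
have dvar i h t : 0 < `|h| < s -> 0 <= t <= 1 ->
    `|'D_h (euler F i) (z0 + t *: h) - 'D_h (euler F i) z0| <= L / s * `|h| ^+ 2.
  move=> /andP[h0 hs] /andP[t0 t1].
  have zr : `|z0 + t *: h - z0| < r.
    rewrite [z0 + _]addrC addrK normrZ ger0_norm//.
    by rewrite (le_lt_trans _ (lt_trans hs sr))// ler_piMl.
  pose l := s / `|h|; have l0 : 0 < l by rewrite divr_gt0.
  have lr : `|l *: h| < r by rewrite normrZ gtr0_norm// /l divfK// gt_eqF.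
  have [_ _ h1] := hr _ _ zr lr; have [_ _ h2] := hr _ _ r00 lr.
  have := hL _ _ i (h1 i) (h2 i); rewrite (T _ _ _ zr).2 (T _ _ _ r00).2.
  have -> : (z0 + t *: h, l *: h) - (z0, l *: h) = (z0 + t *: h - z0, l *: h - l *: h) by [].
  rewrite subrr [z0 + _]addrC addrK => hh.
  have {}hh : `|'D_(l *: h) (euler F i) (t *: h + z0) - 'D_(l *: h) (euler F i) z0| <= L * `|h|.
    have n2 (x y : V) : `|y| <= `|(x, y)| by rewrite prod_normE /= le_max lexx orbT.
    apply: (le_trans (n2 (euler F i (t *: h + z0) - euler F i z0) _)).
    apply: (le_trans hh); rewrite ler_wpM2l ?(ltW L0)//.
    by rewrite prod_normE /= normr0 max_l// normrZ ger0_norm// ler_piMl.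
  move: hh; rewrite [t *: h + z0]addrC !der_dirZ ?dE//; last exact: sn_diff (T i _ 0 zr).1.
  rewrite -scalerBr normrZ (gtr0_norm l0) /l -ler_pdivlMl// => hh; apply: (le_trans hh).
  rewrite le_eqVlt; apply/orP; left; apply/eqP.
  by field; rewrite !gt_eqF.
have tay i h : `|h| < s ->
    `|euler F i (z0 + h) - euler F i z0 - 'D_h (euler F i) z0| <= k * (L / s) * `|h| ^+ 2.
  move=> hs; have [->|hn] := eqVneq h 0.
    by rewrite addr0 subrr derive0 subr0 normr0 expr0n mulr0.
  have h0 : 0 < `|h| by rewrite normr_gt0.
  have zz (t : R) : 0 <= t <= 1 -> `|z0 + t *: (z0 + h - z0) - z0| < r.
    move=> /andP[t0 t1]; rewrite [z0 + h]addrC addrK [z0 + _]addrC addrK normrZ ger0_norm//.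
    by rewrite (le_lt_trans _ (lt_trans hs sr))// ler_piMl.
  have dL y : differentiable (fun z => 'd (euler F i) z0 z) y.
    by apply: linear_differentiable; exact/diff_continuous/dE.
  have -> : euler F i (z0 + h) - euler F i z0 - 'D_h (euler F i) z0 =
      (euler F i (z0 + h) - 'd (euler F i) z0 (z0 + h)) -
      (euler F i z0 - 'd (euler F i) z0 z0).
    rewrite deriveE ?dE// linearD; move: (euler F i (z0 + h)) (euler F i z0) ('d _ z0 z0) ('d _ z0 h).
    by move=> a b c d; rewrite opprD opprB !addrA [a - c - d]addrAC subrK addrAC.
  rewrite -mulrA; apply: (hk _ (fun y => euler F i y - 'd (euler F i) z0 y)) => t t01.
    by apply: differentiableB => //; exact: sn_diff (T i _ 0 (zz _ t01)).1.
  rewrite derB//; last exact: sn_diff (T i _ 0 (zz _ t01)).1.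
  rewrite der_linear; last exact/diff_continuous/dE.
  rewrite -deriveE ?dE// [z0 + h]addrC addrK; apply: dvar => //.
  by rewrite h0.
apply: (quadratic_diff (L := A) (C := k * (L / s))) => //.
  exact: findim_linear_continuous.
have : \forall h \near (0 : V), `|h| < s by apply: cvgr0_norm_lt; [exact: cvg_id|].
apply: filterS => h hs.
have X : (fun i => euler F i (z0 + h) - euler F i z0 - 'D_h (euler F i) z0) @ \oo -->
    flow1 F (z0 + h) - flow1 F z0 - A h.
  apply: cvgB => //; apply: cvgB; last exact: cvE.
  by apply: cvE; rewrite [z0 + h]addrC addrK (lt_trans hs).
have := lim_norm_le (a := 0) X; rewrite sub0r normrN; apply.
by apply: nearW => i; rewrite sub0r normrN; exact: tay.
Qed.

(** The derivative of the flow is a component of the flow of the tangent field,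
    so smoothness propagates to all orders by induction, for all fields at once. *)
Lemma flow_Ck k : forall V (fV : findim V) (F : V -> V), Ck k (tame F) (flow1 F).
Proof.
elim: k => [|k IH] V fV F.
  by move=> z tz; apply: differentiable_continuous; exact: (flow_tangent tz).1.
split=> [z tz|u]; first exact: (flow_tangent tz).1.
have oT : open (tame F) by exact: tame_open.
have : Ck k (tame F) (fun z => (flow1 (tangent_field F) (z, u)).2).
  apply: (Ck_comp (fV := findimX fV fV) (E := setT) (F := fun z => flow1 (tangent_field F) (z, u)) (G := snd)) => //; last exact: Ck_snd.
  apply: (Ck_comp (fV := findimX fV fV) (E := tame (tangent_field F)) (F := fun z => (z, u))) => //.
  - by move=> z tz; exact: tame_tangent.
  - by apply: Ck_pair => //; [exact: Ck_id|exact: Ck_cst].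
  - exact: (IH (V * V)%type (findimX fV fV)).
by apply: Ck_congr => // z tz; rewrite (flow_tangent tz).2.
Qed.

Lemma flow_smooth V {fV : findim V} (F : V -> V) z : tame F z -> smooth_near (flow1 F) z.
Proof.
by move=> tz; exists (tame F) => [|k]; [split=> //; exact: tame_open|exact: flow_Ck].
Qed.

End Flow.

(** * Stationary points and naturality of the flow *)

Section FlowProperties.
Context {R : realType}.
Implicit Types (V W : normedModType R).

Lemma sn_preim V W (F : V -> W) x (A : set W) :
  smooth_near F x -> nbhs (F x) A -> \forall y \near x, A (F y).
Proof. by move=> /sn_cont sF nA; exact: (sF A nA). Qed.

Lemma near0_norm_lt V (e : R) : 0 < e -> \forall h \near (0 : V), `|h| < e.
Proof. by move=> e0; apply: cvgr0_norm_lt; [exact: cvg_id|]. Qed.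

Lemma sn_neq0 V (a : V -> R) x :
  smooth_near a x -> a x != 0 -> \forall y \near x, a y != 0.
Proof.
move=> sa a0; apply: (sn_preim (A := [set t : R | t != 0]) sa).
by apply: open_nbhs_nbhs; split.
Qed.

(** The distance to a zero of the field grows at most by the factor exp L up
    to time one, so polygons that start close to the zero stay close to it. *)
Lemma stationary_confined V {fV : findim V} (F : V -> V) z0 (N : set V) :
  smooth_near F z0 -> F z0 = 0 -> nbhs z0 N ->
  exists K, [/\ nbhs z0 K, K `<=` N, compact K, segment_convex K &
    \forall z \near z0, forall i k, (k <= 2 ^ i)%N -> K (euler_iter F i k z)].
Proof.
move=> sF F0 zN.
have nN : nbhs z0 (N `&` [set x | smooth_near F x]) by exact: filterI zN (sn_near sF).
have [K [zK cK vK KN]] := convex_compact_nbhs (fV := fV) nN.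
exists K; split=> //; first by move=> x /KN [].
have [L L0 hL] := convex_compact_lipschitz (fV := fV) (fW := fV) (D := [set x | smooth_near F x])
  cK vK (fun x Kx => (KN x Kx).2) (sn_Ck 1 (fun x h => h)).
have /nbhs_ballP[d d0 hd] := zK.
have Kz0 : K z0 by exact: nbhs_singleton.
apply/nbhs_ballP; exists (d / expR L); first by rewrite /= divr_gt0// expR_gt0.
move=> z; rewrite -ball_normE /= distrC ltr_pdivlMr ?expR_gt0// mulrC => zd i k ki.
have q0 : 0 <= 1 + dyadic i * L by rewrite addr_ge0// mulr_ge0 ?dyadic_ge0// ltW.
have growth j : (j <= 2 ^ i)%N -> (1 + dyadic i * L) ^+ j <= expR L.
  move=> ji; apply: (@le_trans _ _ (expR (dyadic i * L) ^+ j)).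
    by rewrite lerXn2r ?nnegrE ?expR_ge0// expR_ge1Dx.
  rewrite -expRM_natl ler_expR mulrA ler_piMl ?(ltW L0)//.
  exact: dyadic_mul_le.
have near_K j : (j <= 2 ^ i)%N ->
    `|euler_iter F i j z - z0| <= (1 + dyadic i * L) ^+ j * `|z - z0| -> K (euler_iter F i j z).
  move=> ji h; apply: hd; rewrite -ball_normE /= distrC; apply: le_lt_trans zd.
  by apply: (le_trans h); rewrite ler_wpM2r// growth.
apply: (near_K _ ki).
elim: k ki => [|k IH] ki; first by rewrite expr0 mul1r.
have {}IH := IH (ltnW ki).
have Kk : K (euler_iter F i k z) by exact: near_K (ltnW ki) IH.
rewrite euler_iterS exprS -mulrA addrAC.
apply: (le_trans (ler_normD _ _)).
apply: (@le_trans _ _ ((1 + dyadic i * L) * `|euler_iter F i k z - z0|)); last by rewrite ler_wpM2l.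
rewrite mulrDl mul1r lerD2l normrZ ger0_norm ?dyadic_ge0// -mulrA ler_wpM2l ?dyadic_ge0//.
by have := hL _ _ Kz0 Kk; rewrite F0 subr0.
Qed.

Lemma stationary_tame V {fV : findim V} (F : V -> V) z0 :
  smooth_near F z0 -> F z0 = 0 -> tame F z0.
Proof.
move=> sF F0; have [K [zK KN cK vK h]] := stationary_confined (fV := fV) sF F0 (sn_near sF).
by exists [set x | smooth_near F x], K.
Qed.

Lemma stationary_flow V (F : V -> V) z0 : F z0 = 0 -> flow1 F z0 = z0.
Proof.
move=> F0; have E i k : euler_iter F i k z0 = z0.
  by elim: k => [//|k IH]; rewrite euler_iterS IH F0 scaler0 addr0.
rewrite /flow1 (_ : euler F ^~ z0 = fun=> z0); last by apply/funext => i; exact: E.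
exact: (lim_cst (@norm_hausdorff _ _)).
Qed.

(** One step of the scheme of [F] is mapped by [h] to one step of the scheme
    of [G] up to second order, by Taylor's formula; these errors are summed by
    [dyadic_gronwall]. *)
Lemma euler_natural V W {fV : findim V} {fW : findim W} (h : V -> W) (F : V -> V) (G : W -> W)
    (K : set V) (L : set W) (z : V) :
  compact K -> segment_convex K -> (forall x, K x -> smooth_near h x) ->
  (forall x, K x -> {for x, continuous F}) ->
  compact L -> segment_convex L -> (forall y, L y -> smooth_near G y) ->
  (forall x, K x -> L (h x)) -> (forall x, K x -> 'D_(F x) h x = G (h x)) ->
  (forall i k, (k <= 2 ^ i)%N -> K (euler_iter F i k z)) ->
  (forall i k, (k <= 2 ^ i)%N -> L (euler_iter G i k (h z))) ->
  exists C, forall i, `|h (euler F i z) - euler G i (h z)| <= C * dyadic i.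
Proof.
move=> cK vK sh cF cL vL sG KL FG hK hL.
have [C C0 hC] := convex_compact_taylor (fV := fV) (fW := fW) (D := [set x | smooth_near h x])
  cK vK sh (sn_Ck 2 (fun x hx => hx)).
have [M M0 hM] := convex_compact_lipschitz (fV := fW) (fW := fW) (D := [set x | smooth_near G x])
  cL vL sG (sn_Ck 1 (fun x hx => hx)).
have [B B0 hB] := compact_norm_bound cK cF.
exists (expR M * (C * B ^+ 2)) => i.
have CB0 : 0 <= C * B ^+ 2 by rewrite mulr_ge0 ?exprn_ge0 ?(ltW C0)// ltW.
pose e k := `|h (euler_iter F i k z) - euler_iter G i k (h z)|.
have e0 : e 0%N = 0 by rewrite /e /= subrr normr0.
have : e (2 ^ i)%N <= expR M * (e 0%N + dyadic i * (C * B ^+ 2)).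
  apply: (@dyadic_gronwall R e) => //; [exact: ltW|by rewrite e0|].
  move=> k ki; rewrite /e !euler_iterS.
  have Ka : K (euler_iter F i k z) by apply: hK; exact: ltnW.
  have Ka' : K (euler_iter F i k z + dyadic i *: F (euler_iter F i k z)).
    by rewrite -euler_iterS; exact: hK.
  have Lb : L (euler_iter G i k (h z)) by apply: hL; exact: ltnW.
  move: (euler_iter F i k z) (euler_iter G i k (h z)) Ka Ka' Lb => a b Ka Ka' Lb.
  have := hC _ _ Ka Ka'; rewrite [a + _]addrC addrK der_dirZ; last exact: sn_diff (sh _ Ka).
  rewrite FG//; set a' := _ + a => h1.
  have {}h1 : `|h a' - h a - dyadic i *: G (h a)| <= dyadic i ^+ 2 * (C * B ^+ 2).
    apply: (le_trans h1); rewrite [X in _ <= X]mulrCA ler_wpM2l ?(ltW C0)// normrZ exprMn ger0_norm ?dyadic_ge0//.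
    by rewrite ler_wpM2l ?exprn_ge0 ?dyadic_ge0// lerXn2r ?nnegrE ?(ltW B0)//; exact: hB.
  have -> : h a' - (b + dyadic i *: G b) =
      (h a - b) + dyadic i *: (G (h a) - G b) + (h a' - h a - dyadic i *: G (h a)).
    rewrite scalerBr; move: (h a') (h a) (dyadic i *: G (h a)) (dyadic i *: G b) => p q r s.
    rewrite opprD addrA [RHS]addrC [p - q - r]addrAC !addrA subrK.
    by rewrite [p - r - b]addrAC subrK.
  apply: (le_trans (ler_normD _ _)); apply: lerD => //.
  rewrite mulrDl mul1r; apply: (le_trans (ler_normD _ _)); rewrite lerD2l normrZ.
  rewrite ger0_norm ?dyadic_ge0// -mulrA ler_wpM2l ?dyadic_ge0//.
  by apply: hM => //; exact: KL.
by rewrite e0 add0r mulrCA mulrC.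
Qed.

Lemma flow_natural V W {fV : findim V} {fW : findim W} (h : V -> W) (F : V -> V) (G : W -> W)
    (K : set V) (L : set W) (z w : V) :
  compact K -> segment_convex K -> (forall x, K x -> smooth_near h x) ->
  (forall x, K x -> {for x, continuous F}) ->
  compact L -> segment_convex L -> (forall y, L y -> smooth_near G y) ->
  (forall x, K x -> L (h x)) -> (forall x, K x -> 'D_(F x) h x = G (h x)) ->
  (forall i k, (k <= 2 ^ i)%N -> K (euler_iter F i k z)) ->
  (forall i k, (k <= 2 ^ i)%N -> L (euler_iter G i k (h z))) ->
  euler F ^~ z @ \oo --> w -> euler G ^~ (h z) @ \oo --> h w.
Proof.
move=> cK vK sh cF cL vL sG KL FG hK hL zw.
have Kw : K w.
  have clK := compact_closed (@norm_hausdorff _ _) cK.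
  by apply: (closed_cvg _ clK _ _ zw); apply: nearW => i; exact: hK.
have [C hC] := euler_natural (fV := fV) (fW := fW) cK vK sh cF cL vL sG KL FG hK hL.
have h1 : (fun i => h (euler F i z)) @ \oo --> h w.
  by apply: continuous_cvg => //; exact: sn_cont (sh _ Kw).
apply/cvgrPdist_lt => e e0.
have e20 : 0 < e / 2 by rewrite divr_gt0.
have /cvgrPdist_lt/(_ _ e20) h2 := h1.
have h3 := near_dyadic C e20.
apply: filterS2 h2 h3 => i h2 h3.
have -> : h w - euler G i (h z) = (h w - h (euler F i z)) + (h (euler F i z) - euler G i (h z)).
  by rewrite addrA subrK.
apply: (le_lt_trans (ler_normD _ _)); rewrite (splitr e); apply: ltrD => //.
exact: le_lt_trans (hC i) h3.
Qed.

End FlowProperties.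

(** * The inverse function theorem *)

Section InverseFunction.
Context {R : realType}.

(** Vectors are rows, so the rows of this matrix are the partial derivatives
    and the chain rule multiplies from left to right. *)
Definition jac m n (f : 'rV[R]_m -> 'rV[R]_n) (x : 'rV[R]_m) : 'M[R]_(m, n) :=
  \matrix_(i, j) ('D_(delta_mx 0 i) f x) 0 j.

Lemma derive_jac m n (f : 'rV[R]_m -> 'rV[R]_n) x w :
  differentiable f x -> 'D_w f x = w *m jac f x.
Proof.
move=> df; rewrite {1}(row_sum_delta w) der_dir_sum//.
apply/rowP => j; rewrite summxE mxE; apply: eq_bigr => i _.
by rewrite der_dirZ// !mxE.
Qed.

Lemma sn_jac m n (f : 'rV[R]_m -> 'rV[R]_n) x : smooth_near f x -> smooth_near (jac f) x.
Proof. by move=> sf; apply: sn_mx => i j; apply: sn_entry; exact: sn_der. Qed.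

Lemma jacP m n (f : 'rV[R]_m -> 'rV[R]_n) x (A : 'M[R]_(m, n)) :
  (forall w, 'D_w f x = w *m A) -> jac f x = A.
Proof. by move=> fA; apply/matrixP => i j; rewrite mxE fA -rowE mxE. Qed.

Lemma jac_comp m n p (f : 'rV[R]_m -> 'rV[R]_n) (g : 'rV[R]_n -> 'rV[R]_p) x :
  differentiable f x -> differentiable g (f x) ->
  jac (fun y => g (f y)) x = jac f x *m jac g (f x).
Proof.
move=> df dg; apply: jacP => w.
by rewrite (der_comp (f := f) (g := g))// !derive_jac// mulmxA.
Qed.

Lemma jac_near_id m (f : 'rV[R]_m -> 'rV[R]_m) x :
  (\forall y \near x, f y = y) -> jac f x = 1%:M.
Proof.
move=> h; apply: jacP => w.
by rewrite (near_eq_derive (g := id) _ h) derive_id mulmx1.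
Qed.

(** The velocity [w] is carried along as a second, constant, component, which
    makes the field vanish at w = 0; the same device is used in
    [constant_field], the image of this field under [f]. *)
Definition newton_field m (f : 'rV[R]_m -> 'rV[R]_m) (z : 'rV[R]_m * 'rV[R]_m) :
  'rV[R]_m * 'rV[R]_m := (z.2 *m invmx (jac f z.1), 0).

Definition constant_field m (z : 'rV[R]_m * 'rV[R]_m) : 'rV[R]_m * 'rV[R]_m := (z.2, 0).

Lemma constant_euler m i k (y w : 'rV[R]_m) :
  euler_iter (@constant_field m) i k (y, w) = (y + (k%:R * dyadic i) *: w, w).
Proof.
elim: k => [|k IH]; first by rewrite mul0r scale0r addr0.
rewrite euler_iterS IH /constant_field /= -natr1 mulrDl mul1r scalerDl addrA.
have -> (a b c d : 'rV[R]_m) : (a, b) + dyadic i *: (c, d) = (a + dyadic i *: c, b + dyadic i *: d) by [].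
by rewrite scaler0 addr0.
Qed.

(** The inverse is obtained by moving along the field dx/dt = Df(x)^-1 w: then
    f x moves with constant velocity w, so at time one it has moved by w. *)
Lemma smooth_right_inverse m (f : 'rV[R]_m -> 'rV[R]_m) (x0 : 'rV[R]_m) :
  smooth_near f x0 -> jac f x0 \in unitmx ->
  exists g : 'rV[R]_m -> 'rV[R]_m, [/\ smooth_near g (f x0), g (f x0) = x0 &
    \forall y \near f x0, f (g y) = y].
Proof.
move=> sf uf; pose F := newton_field f.
pose g y := (flow1 F (x0, y - f x0)).1.
have s1 z : smooth_near (fst : 'rV[R]_m * 'rV[R]_m -> _) z by apply: sn_lin => // ?; exact: cvg_fst.
have s2 z : smooth_near (snd : 'rV[R]_m * 'rV[R]_m -> _) z by apply: sn_lin => // ?; exact: cvg_snd.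
have sF z : smooth_near f z.1 -> jac f z.1 \in unitmx -> smooth_near F z.
  move=> sfz ufz; apply: sn_pair; last exact: sn_cst.
  apply: sn_mulmx => //; apply: (sn_invmx (A := fun z => jac f z.1)) => //.
  by apply: (sn_comp (F := fst)) => //; exact: sn_jac.
have F0 : F (x0, 0) = 0 by rewrite /F /newton_field mul0mx.
have tF : tame F (x0, 0) by apply: stationary_tame => //; exact: sF.
exists g; split.
- apply: (sn_comp (G := fst)) => //; apply: (sn_comp (F := fun y => (x0, y - f x0))).
    by apply: sn_pair; [exact: sn_cst|apply: snB; [exact: sn_id|exact: sn_cst]].
  by rewrite subrr; exact: flow_smooth.
- by rewrite /g subrr stationary_flow.
have nN : nbhs ((x0, 0) : 'rV[R]_m * 'rV[R]_m) [set z | smooth_near f z.1 /\ jac f z.1 \in unitmx].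
  have nx : nbhs x0 [set x | smooth_near f x /\ jac f x \in unitmx].
    apply: filterI; first exact: (sn_near sf).
    have : \forall x \near x0, \det (jac f x) != 0.
      by apply: sn_neq0; [exact: sn_det (sn_jac sf)|move: uf; rewrite unitmxE unitfE].
    by apply: filterS => x; rewrite /= unitmxE unitfE.
  exact: (sn_preim (s1 (x0, 0)) nx).
have [K [zK KN cK vK hK]] := stationary_confined (sF (x0, 0) sf uf) F0 nN.
(* [h] intertwines [newton_field f] with [constant_field]. *)
pose h (z : 'rV[R]_m * 'rV[R]_m) := (f z.1, z.2).
have sh z : smooth_near f z.1 -> smooth_near h z.
  by move=> sfz; apply: sn_pair => //; apply: (sn_comp (F := fst) (G := f)).
have [B B0 hB] := compact_norm_bound cK (fun z Kz => sn_cont (sh z (KN z Kz).1)).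
have [L [hL cL vL]] := @convex_compact_ball R _ (findimX (findimM 1 m) (findimM 1 m)) (B + `|f x0| + 1)
   (ltr_wpDl (addr_ge0 (ltW B0) (normr_ge0 _)) ltr01).
have sw : smooth_near (fun w : 'rV[R]_m => (x0, w)) 0.
  by apply: sn_pair; [exact: sn_cst|exact: sn_id].
have n0 := sn_preim (A := [set z | forall i k, (k <= 2 ^ i)%N -> K (euler_iter F i k z)]) sw hK.
have n0' := sn_preim (A := tame F) sw (tame_near tF).
have n1 : \forall w \near (0 : 'rV[R]_m), `|w| < 1 by apply: near0_norm_lt.
have n2 : \forall w \near (0 : 'rV[R]_m), f (flow1 F (x0, w)).1 = f x0 + w.
  apply: filterS3 n0 n0' n1 => w Kw tw w1.
  have C1 : euler F ^~ (x0, w) @ \oo --> flow1 F (x0, w) by exact: tame_cvg.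
  have C2 : euler (@constant_field m) ^~ (h (x0, w)) @ \oo --> h (flow1 F (x0, w)).
    apply: (flow_natural (K := K) (L := L) (F := F)) => //.
    - by move=> z Kz; apply: sh; exact: (KN z Kz).1.
    - by move=> z Kz; apply: sn_cont; apply: sF; [exact: (KN z Kz).1|exact: (KN z Kz).2].
    - move=> y _; apply: sn_pair => //; exact: sn_cst.
    - move=> z Kz; apply: hL; apply: (le_trans (hB _ Kz)).
      by rewrite -addrA lerDl addr_ge0.
    - move=> z Kz; have [sfz ufz] := KN z Kz.
      have dfz : differentiable (fun z : 'rV[R]_m * 'rV[R]_m => f z.1) z.
        by apply: sn_diff; apply: (sn_comp (F := fst) (G := f)).
      rewrite /h der_pair//; last exact: sn_diff.
      rewrite (der_comp (f := fst) (g := f)); [|exact: sn_diff|exact: sn_diff].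
      rewrite (der_linear (L := fst)); last by move=> ?; exact: cvg_fst.
      rewrite (der_linear (L := snd)); last by move=> ?; exact: cvg_snd.
      rewrite derive_jac; last exact: sn_diff.
      by rewrite /= mulmxKV.
    - move=> i k ki; rewrite constant_euler; apply: hL; rewrite prod_normE /= ge_max.
      apply/andP; split.
        apply: (le_trans (ler_normD _ _)); rewrite normrZ.
        have -> : `|k%:R * dyadic i : R| = k%:R * dyadic i by rewrite ger0_norm// mulr_ge0 ?dyadic_ge0.
        rewrite -[B + _ + _]addrA [B + _]addrC -addrA lerD2l.
        have := dyadic_mul_le (R := R) ki.
        have : `|w| <= 1 by exact: ltW.
        have : 0 <= k%:R * dyadic i :> R by rewrite mulr_ge0// dyadic_ge0.
        move: (k%:R * dyadic i) (`|w|) (normr_ge0 w) B0; clear; move=> *; nra.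
      by rewrite (le_trans (ltW w1))// lerDr addr_ge0// ltW.
  have C3 : euler (@constant_field m) ^~ (h (x0, w)) @ \oo --> (f x0 + w, w).
    have -> : euler (@constant_field m) ^~ (h (x0, w)) = fun=> (f x0 + w, w).
      apply/funext => i; rewrite /euler constant_euler /=.
      by rewrite /dyadic natrX divff ?expf_neq0// scale1r.
    exact: cvg_cst.
  have E : h (flow1 F (x0, w)) = (f x0 + w, w).
    exact: (cvg_unique (@norm_hausdorff _ _) C2 C3).
  exact: (congr1 fst E).
have sc : smooth_near (fun y : 'rV[R]_m => y - f x0) (f x0).
  by apply: snB; [exact: sn_id|exact: sn_cst].
have : \forall y \near f x0, f (flow1 F (x0, y - f x0)).1 = f x0 + (y - f x0).
  apply: (sn_preim (A := [set w | f (flow1 F (x0, w)).1 = f x0 + w]) sc).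
  by rewrite subrr.
by apply: filterS => y; rewrite /g => ->; rewrite addrC subrK.
Qed.

(** The right inverse [g] has an invertible differential and hence a right
    inverse itself, which must agree with [f]. *)
Theorem inverse_function m (f : 'rV[R]_m -> 'rV[R]_m) (x0 : 'rV[R]_m) :
  smooth_near f x0 -> jac f x0 \in unitmx ->
  exists g : 'rV[R]_m -> 'rV[R]_m, [/\ smooth_near g (f x0), g (f x0) = x0,
    \forall y \near f x0, f (g y) = y & \forall x \near x0, g (f x) = x].
Proof.
move=> sf uf; have [g [sg gf fg]] := smooth_right_inverse sf uf.
have ug : jac g (f x0) \in unitmx.
  have := jac_near_id fg; rewrite (jac_comp (f := g) (g := f)) ?gf => [E||].
  - by case/mulmx1_unit: E.
  - exact: sn_diff.
  - exact: sn_diff.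
(* [f'] is a right inverse of [g], and f' = f (g f') = f near [x0]. *)
have [f' [sf' f'g gf']] := smooth_right_inverse sg ug; rewrite gf in sf' f'g gf'.
exists g; split=> //.
have n1 : \forall x \near x0, f (g (f' x)) = f' x.
  by apply: (sn_preim (A := [set y | f (g y) = y]) sf'); rewrite f'g.
apply: filterS2 n1 gf' => x h1 h2.
by move: h1; rewrite h2 => ->.
Qed.

End InverseFunction.

(** * A bump function *)

Section Bump.
Context {R : realType}.

(** The family of all t^-k exp(-1/t), extended by zero: it is stable under
    differentiation, up to linear combinations. *)
Definition flat k (t : R) : R := if 0 < t then t^-1 ^+ k * expR (- t^-1) else 0.

(** The exponential dominates the term of degree k + 2 of its series at 1/t. *)
Lemma flat_le k (t : R) : `|flat k t| <= k.+2`!%:R * `|t| ^+ 2.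
Proof.
rewrite /flat; case: ifPn => [t0|_]; last by rewrite normr0 mulr_ge0// exprn_ge0.
rewrite (gtr0_norm t0) ger0_norm; last by rewrite mulr_ge0 ?expR_ge0// exprn_ge0// invr_ge0 ltW.
have x0 : 0 < t^-1 by rewrite invr_gt0.
have h : t^-1 ^+ k.+2 <= k.+2`!%:R * expR t^-1.
  have := expR_ge1Dxn k.+1 (ltW x0); rewrite -ler_pdivrMl ?ltr0n ?fact_gt0// mulrC.
  by apply: le_trans; rewrite lerDr.
rewrite expRN ler_pdivrMr ?expR_gt0// mulrAC -ler_pdivrMr ?exprn_gt0//.
by rewrite -exprVn -exprD addn2.
Qed.

Lemma flat_near_pos k (t : R) : 0 < t ->
  \forall s \near t, flat k s = s^-1 ^+ k * expR (- s^-1).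
Proof.
move=> t0; have : \forall s \near t, 0 < s by exact: lt_nbhsr.
by apply: filterS => s s0; rewrite /flat s0.
Qed.

Lemma inv_der (t u : R) : t != 0 -> 'D_u (fun s : R => s^-1) t = - (t^-1 ^+ 2) * u.
Proof.
move=> t0; have dt : derivable (fun t : R => t) t u by exact: derivable_id.
rewrite (@deriveV _ _ (fun t : R => t) t u t0 dt) derive_id.
by rewrite exprVn.
Qed.

Lemma expR_diff (t : R) : differentiable (@expR R) t.
Proof. exact/derivable1_diffP/derivable_expR. Qed.

Lemma expR_der (t u : R) : 'D_u (@expR R) t = u * expR t.
Proof.
have u1 : u = u *: (1 : R) by rewrite /GRing.scale /= mulr1.
rewrite {1}u1 der_dirZ; last exact: expR_diff.
by have /= -> := congr1 (fun f : R -> R => f t) (@derive_expR R).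
Qed.

(** At 0 the function is bounded by a multiple of t^2, so its derivative
    vanishes; elsewhere the formula is computed. *)
Lemma flat_der k (t u : R) : differentiable (flat k) t /\
  'D_u (flat k) t = u * (flat k.+2 t - k%:R * flat k.+1 t).
Proof.
have [t0|t0|->] := ltgtP t 0.
- have E : \forall s \near t, (fun=> 0 : R) s = flat k s.
    have : \forall s \near t, s < 0 by exact: lt_nbhsl.
    by apply: filterS => s s0; rewrite /flat ltNge (ltW s0).
  split; first by apply: sn_diff; apply: sn_congr E _; exact: sn_cst.
  rewrite -(near_eq_derive _ E) derive_cst /flat ltNge (ltW t0) /=.
  by rewrite mulr0 subr0 mulr0.
- have tn0 : t != 0 by rewrite gt_eqF.
  pose X (s : R) := s^-1 ^+ k; pose Y (s : R) := expR (- s^-1).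
  have dI : differentiable (fun s : R => s^-1) t by exact: differentiable_Rinv.
  have dN : differentiable (fun s : R => - s^-1) t by exact: differentiableN.
  have dX : differentiable X t.
    by apply: (@differentiable_compf _ R R R (fun s => s^-1) (fun s => s ^+ k)) => //; exact/derivable1_diffP/exprn_derivable.
  have dY : differentiable Y t.
    by apply: (@differentiable_compf _ R R R (fun s => - s^-1) expR) => //; exact: expR_diff.
  have E : \forall s \near t, X s *: Y s = flat k s.
    by apply: filterS (flat_near_pos k t0) => s ->.
  have dXY : differentiable (fun s => X s *: Y s) t by exact: differentiable_scale.
  have dXY' : 'D_u (fun s => X s *: Y s) t = u * (flat k.+2 t - k%:R * flat k.+1 t).
    rewrite der_scale// /Y (der_comp (f := fun s : R => - s^-1) (g := @expR R))//; last exact: expR_diff.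
    rewrite expR_der derN// inv_der//.
    rewrite /X (der_comp (f := fun s : R => s^-1) (g := fun s => s ^+ k))//; last exact/derivable1_diffP/exprn_derivable.
    rewrite inv_der// /flat t0 /GRing.scale /=.
    have -> : 'D_(- (t^-1 ^+ 2) * u) (fun s : R => s ^+ k) t^-1 = - (t^-1 ^+ 2) * u * (k%:R * t^-1 ^+ k.-1).
      by rewrite exp_derive /GRing.scale /=; ring.
    case: k {X Y E dX dY dXY} => [|k] /=.
      by ring.
    by rewrite !exprS; ring.
  split; last by rewrite -(near_eq_derive _ E).
  apply/derivable1_diffP; apply: near_eq_derivable E _; exact/derivable1_diffP.
- have lin0 : linear (fun _ : R => 0 : R) by move=> a x y; rewrite scaler0 addr0.
  have [|dd D0] := @quadratic_diff R R R (flat k) (fun=> 0) 0 (k.+2`!%:R) lin0 (@cst_continuous _ _ 0).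
    have h0 (h : R) : `|flat k (0 + h) - flat k 0 - 0| <= k.+2`!%:R * `|h| ^+ 2.
      by rewrite add0r {2}/flat ltxx !subr0; exact: flat_le.
    exact: (@nearW _ (nbhs (0 : R))).
  by split=> //; rewrite D0 /flat ltxx mulr0 subr0 mulr0.
Qed.

Lemma flat_Ck n k : Ck n setT (flat k).
Proof.
have oT : open [set: R] by exact: openT.
elim: n k => [|n IH] k.
  by move=> t _; apply: differentiable_continuous; exact: (flat_der k t 0).1.
split=> [t _|u]; first exact: (flat_der k t 0).1.
have : Ck n setT (fun t => u * (flat k.+2 t - k%:R * flat k.+1 t)).
  apply: CkM => //; first exact: Ck_cst.
  by apply: CkB => //; apply: CkM => //; exact: Ck_cst.
by apply: Ck_congr => // t _; rewrite (flat_der k t u).2.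
Qed.

Definition bumpf (e t : R) : R := flat 0 (e ^+ 2 - t ^+ 2) / flat 0 (e ^+ 2).

Lemma bump0 e : 0 < e -> bumpf e 0 = 1.
Proof.
move=> e0; rewrite /bumpf expr0n subr0 divff// /flat exprn_gt0//.
by rewrite expr0 mul1r gt_eqF// expR_gt0.
Qed.

Lemma bump_support e t : 0 < e -> bumpf e t != 0 -> `|t| < e.
Proof.
move=> e0; apply: contra_neqT; rewrite -leNgt => et.
rewrite /bumpf {1}/flat ifF ?mul0r//; apply/negbTE; rewrite -leNgt subr_le0.
by rewrite -[t ^+ 2]real_normK ?num_real// lerXn2r ?nnegrE// ltW.
Qed.

Lemma sn_bump (V : normedModType R) e (a : V -> R) x :
  smooth_near a x -> smooth_near (fun y => bumpf e (a y)) x.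
Proof.
move=> sa; apply: snM; last exact: sn_cst.
apply: (@sn_comp R V R R _ (fun y => e ^+ 2 - a y ^+ 2) (flat 0)).
  apply: snB; first exact: sn_cst.
  by apply: (sn_eq _ (snM sa sa)) => y; rewrite expr2.
by exists setT => [|k]; [split=> //; exact: openT|exact: flat_Ck].
Qed.

End Bump.

(** * Smooth atlases *)

Section Atlases.
Context {R : realType}.
Implicit Types (X Y Z : topologicalType) (U V W : normedModType R).

(** What manifolds, their products and jet bundles have in common. *)
Record smooth_atlas X V (A : atlas X V) : Prop := SmoothAtlas {
  sa_open : forall phi, A phi -> open (cdom phi);
  sa_inj : forall phi, A phi -> set_inj (cdom phi) (cmap phi);
  sa_cont : forall phi, A phi -> forall x, cdom phi x -> {for x, continuous (cmap phi)};
  sa_open_map : forall phi, A phi -> forall O, open O -> O `<=` cdom phi -> open (cmap phi @` O);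
  sa_compat : forall phi psi x, charts_at A x phi -> charts_at A x psi ->
    smooth_near (inchart phi (cmap psi)) (cmap phi x) }.

Lemma manifold_smooth_atlas m (M : manifold R m) : smooth_atlas (matlas M).
Proof.
split.
- exact: matlas_open.
- exact: matlas_inj.
- exact: matlas_continuous.
- exact: matlas_open_map.
- exact: matlas_compatible.
Qed.

Lemma inchartE X V W (phi : chart X V) (g : X -> W) (x : X) :
  set_inj (cdom phi) (cmap phi) -> cdom phi x -> inchart phi g (cmap phi x) = g x.
Proof.
move=> inj dx; rewrite /inchart.
have /(xgetPex (0 : W)) : exists w, [set g y | y in [set y | cdom phi y /\ cmap phi y = cmap phi x]] w.
  by exists (g x); exists x.
move=> [y [dy e] <-]; congr g.
by apply: inj => //; rewrite inE.
Qed.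

Lemma chart_near X V (A : atlas X V) (sA : smooth_atlas A) x phi (P : X -> Prop) :
  charts_at A x phi -> (\forall y \near x, P y) ->
  \forall v \near cmap phi x, exists y, [/\ cdom phi y, cmap phi y = v & P y].
Proof.
move=> [Ap dx] nP.
have : nbhs x ([set y | P y] `&` cdom phi).
  by apply: filterI => //; apply: open_nbhs_nbhs; split=> //; exact: (sa_open sA Ap).
rewrite nbhsE => -[E [oE Ex] EP].
have Ed : E `<=` cdom phi by move=> y /EP [].
have oI := sa_open_map sA Ap oE Ed.
have : nbhs (cmap phi x) (cmap phi @` E) by apply: open_nbhs_nbhs; split=> //; exists x.
by apply: filterS => v [y Ey <-]; exists y; have [] := EP y Ey.
Qed.

Lemma near_chart X V (A : atlas X V) (sA : smooth_atlas A) x phi (Q : V -> Prop) :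
  charts_at A x phi -> (\forall v \near cmap phi x, Q v) ->
  \forall y \near x, Q (cmap phi y).
Proof. by move=> [Ap dx] nQ; exact: (sa_cont sA Ap dx nQ). Qed.

Lemma near_cdom X V (A : atlas X V) (sA : smooth_atlas A) x phi :
  charts_at A x phi -> \forall y \near x, cdom phi y.
Proof.
by move=> [Ap dx]; apply: open_nbhs_nbhs; split=> //; exact: (sa_open sA Ap).
Qed.

Lemma chart_near_eq X V W (A : atlas X V) (sA : smooth_atlas A) x phi (F G : V -> W) :
  charts_at A x phi -> (\forall y \near x, cdom phi y -> F (cmap phi y) = G (cmap phi y)) ->
  \forall v \near cmap phi x, F v = G v.
Proof.
move=> Ax h; apply: filterS (chart_near sA Ax h) => v [y [dy <- e]]; exact: e.
Qed.

Lemma chart_inv_cont X V (A : atlas X V) (sA : smooth_atlas A) x phi (O : set X) :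
  charts_at A x phi -> nbhs x O ->
  \forall v \near cmap phi x, forall y, cdom phi y -> cmap phi y = v -> O y.
Proof.
move=> Ax /(chart_near sA Ax); apply: filterS => v [y [dy <- Oy]] z dz zy.
by rewrite (sa_inj sA Ax.1 _ _ zy)// inE.
Qed.

(** One pair of charts suffices, since coordinate changes are smooth. *)
Lemma smooth_at_intro X Y V W (A : atlas X V) (B : atlas Y W) {fV : findim V} {fW : findim W}
    (sA : smooth_atlas A) (sB : smooth_atlas B) (f : X -> Y) x phi psi :
  charts_at A x phi -> charts_at B (f x) psi -> {for x, continuous f} ->
  smooth_near (inchart phi (cmap psi \o f)) (cmap phi x) -> smooth_at A B f x.
Proof.
move=> Ax Bx cf sf; split=> // phi' psi' Ax' Bx'.
have s1 := sa_compat sA Ax' Ax.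
have s2 := sa_compat sB Bx Bx'.
have e1 : inchart phi' (cmap phi) (cmap phi' x) = cmap phi x.
  by rewrite inchartE //; [exact: (sa_inj sA Ax'.1)|exact: Ax'.2].
have e2 : inchart phi (cmap psi \o f) (cmap phi x) = cmap psi (f x).
  by rewrite inchartE //; [exact: (sa_inj sA Ax.1)|exact: Ax.2].
have s3 : smooth_near (fun v => inchart phi (cmap psi \o f) (inchart phi' (cmap phi) v)) (cmap phi' x).
  by apply: (sn_comp s1); rewrite e1.
have s4 : smooth_near (fun v => inchart psi (cmap psi')
     (inchart phi (cmap psi \o f) (inchart phi' (cmap phi) v))) (cmap phi' x).
  by apply: (sn_comp s3); rewrite e1 e2.
apply: sn_congr s4.
apply: (chart_near_eq sA Ax').
have n1 := near_cdom sA Ax.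
have n2 : \forall y \near x, cdom psi (f y) by apply: cf; exact: (near_cdom sB Bx).
apply: filterS2 n1 n2 => y dy dfy dy'.
have i1 := sa_inj sA Ax.1; have i1' := sa_inj sA Ax'.1; have i2 := sa_inj sB Bx.1.
by rewrite !inchartE//= inchartE.
Qed.

Lemma smooth_at_near X Y V W (A : atlas X V) (B : atlas Y W) {fV : findim V} {fW : findim W}
    (sA : smooth_atlas A) (sB : smooth_atlas B) (f : X -> Y) x phi psi :
  charts_at A x phi -> charts_at B (f x) psi ->
  smooth_at A B f x -> \forall y \near x, smooth_at A B f y.
Proof.
move=> Ax Bx [cf sf]; have {}sf := sf _ _ Ax Bx.
have n1 := near_cdom sA Ax.
have n2 : \forall y \near x, cdom psi (f y) by apply: cf; exact: (near_cdom sB Bx).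
have n3 := near_chart sA Ax (sn_near sf).
have i1 := sa_inj sA Ax.1; have i2 := sa_inj sB Bx.1.
apply: filterS3 n1 (nbhs_interior n2) n3 => y dy n2y sy.
have Ay : charts_at A y phi by split=> //; exact: Ax.1.
have dfy : cdom psi (f y) := nbhs_singleton n2y.
have By : charts_at B (f y) psi by split=> //; exact: Bx.1.
apply: (smooth_at_intro (fV := fV) (fW := fW) sA sB Ay By) => // O fO.
have nW := chart_inv_cont sB By fO.
have sy' := sn_preim sy; rewrite inchartE// in sy'.
have := near_chart sA Ay (sy' _ nW).
move=> h; apply: filterS3 h n2y (near_cdom sA Ay) => z hz dfz dz.
by apply: hz => //; rewrite inchartE.
Qed.

(** Builds maps between manifolds, such as representatives of jets and local
    inverses, from coordinate expressions; the value [y] is used where the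
    coordinate expression leaves the chart. *)
Lemma chart_lift X Y V W (A : atlas X V) (B : atlas Y W) {fV : findim V} {fW : findim W}
    (sA : smooth_atlas A) (sB : smooth_atlas B) x y phi psi (F : V -> W) :
  charts_at A x phi -> charts_at B y psi -> smooth_near F (cmap phi x) ->
  F (cmap phi x) = cmap psi y ->
  exists f : X -> Y, [/\ f x = y, smooth_at A B f x &
    \forall x' \near x, cdom psi (f x') /\ cmap psi (f x') = F (cmap phi x')].
Proof.
move=> Ax By sF Fx.
pose f x' := xget y [set y' | cdom psi y' /\ cmap psi y' = F (cmap phi x')].
have i1 := sa_inj sA Ax.1; have i2 := sa_inj sB By.1.
have fP y' x' : cdom psi y' -> cmap psi y' = F (cmap phi x') -> f x' = y'.
  move=> dy' e; have /(xgetPex y) [dz ez] : exists y', [set y' | cdom psi y' /\ cmap psi y' = F (cmap phi x')] y'.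
    by exists y'.
  by apply: i2; rewrite ?inE// ez.
have fx : f x = y by apply: fP => //; exact: By.2.
have nf O : nbhs y O -> \forall x' \near x, [/\ cdom psi (f x'), cmap psi (f x') = F (cmap phi x') & O (f x')].
  move=> yO; have := chart_near sB By yO; rewrite -Fx => /(sn_preim sF) /(near_chart sA Ax).
  by apply: filterS => x' [y' [dy' ey' Oy']]; rewrite (fP y').
have cf : {for x, continuous f} by move=> O; rewrite fx => /nf; apply: filterS => x' [].
have nF : \forall x' \near x, cdom psi (f x') /\ cmap psi (f x') = F (cmap phi x').
  have yT : nbhs y setT by exact: filterT.
  have h := nf setT yT; apply: (filterS _ h) => x' [d e _].
  by split.
exists f; split=> //.
apply: (smooth_at_intro (fV := fV) (fW := fW) (phi := phi) (psi := psi) sA sB) => //.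
  by rewrite fx.
apply: sn_congr sF; apply: (chart_near_eq sA Ax).
by move: nF; apply: filterS => x' [_ e] dx'; rewrite inchartE.
Qed.

Lemma prod_smooth_atlas X Y V W (A : atlas X V) (B : atlas Y W) {fV : findim V} {fW : findim W} :
  smooth_atlas A -> smooth_atlas B -> smooth_atlas (prod_atlas A B).
Proof.
move=> sA sB.
have inj phi psi : A phi -> B psi -> set_inj (cdom (prod_chart phi psi)) (cmap (prod_chart phi psi)).
  move=> Ap Bp [x y] [x' y']; rewrite !inE /= => -[dx dy] [dx' dy'] [e1 e2].
  by rewrite (sa_inj sA Ap _ _ e1) ?inE// (sa_inj sB Bp _ _ e2) ?inE.
split.
- move=> _ [phi [psi [Ap Bp ->]]]; rewrite openE => -[x y] [/= dx dy].
  exists (cdom phi, cdom psi); last by move=> [].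
  by split; apply: open_nbhs_nbhs; split=> //; [exact: (sa_open sA Ap)|exact: (sa_open sB Bp)].
- by move=> _ [phi [psi [Ap Bp ->]]]; exact: inj.
- move=> _ [phi [psi [Ap Bp ->]]] [x y] [/= dx dy].
  apply: cvg_pair => /=.
    by apply: cvg_comp; [exact: cvg_fst|exact: (sa_cont sA Ap dx)].
  by apply: cvg_comp; [exact: cvg_snd|exact: (sa_cont sB Bp dy)].
- move=> _ [phi [psi [Ap Bp ->]]] O oO Od; rewrite openE => _ [[x y] Oxy <-].
  have [/= dx dy] := Od _ Oxy.
  have : nbhs (x, y) O by exact: open_nbhs_nbhs.
  move=> [[P Q] [/= xP yQ] PQ].
  have h1 := chart_near sA (conj Ap dx) xP; have h2 := chart_near sB (conj Bp dy) yQ.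
  exists ([set v | exists y, [/\ cdom phi y, cmap phi y = v & P y]],
          [set v | exists z, [/\ cdom psi z, cmap psi z = v & Q z]]) => //.
  move=> [v w] [/= [x' [dx' <- Px']] [y' [dy' <- Qy']]].
  by exists (x', y') => //; exact: PQ.
- move=> _ _ [x y] [[phi [psi [Ap Bp ->]]] [/= dx dy]] [[phi' [psi' [Ap' Bp' ->]]] [/= dx' dy']].
  have s1 : smooth_near (fun z : V * W => inchart phi (cmap phi') z.1) (cmap phi x, cmap psi y).
    apply: (sn_comp (F := fst) (G := inchart phi (cmap phi'))); last exact: (sa_compat sA (conj Ap dx) (conj Ap' dx')).
    by apply: sn_lin => // ?; exact: cvg_fst.
  have s2 : smooth_near (fun z : V * W => inchart psi (cmap psi') z.2) (cmap phi x, cmap psi y).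
    apply: (sn_comp (F := snd) (G := inchart psi (cmap psi'))); last exact: (sa_compat sB (conj Bp dy) (conj Bp' dy')).
    by apply: sn_lin => // ?; exact: cvg_snd.
  apply: sn_congr (sn_pair s1 s2).
  have xT : nbhs x [set _ | True] by exact: filterT.
  have yT : nbhs y [set _ | True] by exact: filterT.
  have h1 := chart_near sA (conj Ap dx) xT; have h2 := chart_near sB (conj Bp dy) yT.
  exists ([set v | exists y, [/\ cdom phi y, cmap phi y = v & True]],
          [set v | exists z, [/\ cdom psi z, cmap psi z = v & True]]) => //.
  move=> [v w] [/= [x1 [dx1 <- _]] [y1 [dy1 <- _]]].
  rewrite inchartE//; last exact: (sa_inj sA Ap).
  rewrite inchartE//; last exact: (sa_inj sB Bp).
  have := @inchartE _ _ _ (prod_chart phi psi) (cmap (prod_chart phi' psi')) (x1, y1) (inj _ _ Ap Bp).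
  by move=> ->.
Qed.

End Atlases.

(** * Partial derivatives and jets in coordinates *)

Section Partials.
Context {R : realType} {m : nat}.
Implicit Types (W : normedModType R) (s : seq 'I_m).

(** The iterated partial derivative along a list of directions. Lists are
    easier to concatenate and to permute than multi-indices, to which they are
    related by [alist] and [midx]. *)
Definition Dl W s (F : 'rV[R]_m -> W) : 'rV[R]_m -> W :=
  foldr (fun i G => 'D_(delta_mx 0 i) G) F s.

Definition alist k (a : multi_index m k) : seq 'I_m :=
  flatten [seq nseq (val a i) i | i <- enum 'I_m].

Lemma Dl_cat W s t (F : 'rV[R]_m -> W) : Dl (s ++ t) F = Dl s (Dl t F).
Proof. exact: foldr_cat. Qed.

Lemma partialE W k (a : multi_index m k) (F : 'rV[R]_m -> W) :
  partial a F = Dl (alist a) F.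
Proof.
rewrite /partial /alist; elim: (enum 'I_m) => [//|i s IH] /=.
rewrite /Dl foldr_cat -/(Dl _ F) IH.
by elim: (nat_of_ord _) => [//|n IHn] /=; rewrite IHn.
Qed.

Lemma sn_Dl W s (F : 'rV[R]_m -> W) x : smooth_near F x -> smooth_near (Dl s F) x.
Proof. by move=> sF; elim: s => [//|i s IH] /=; exact: sn_der. Qed.

Lemma Dl_near W s (F G : 'rV[R]_m -> W) (x : 'rV[R]_m) :
  (\forall y \near x, F y = G y) -> \forall y \near x, Dl s F y = Dl s G y.
Proof.
move=> FG; elim: s => [//|i s IH] /=.
apply: filterS (nbhs_interior IH) => y h; exact: near_eq_derive.
Qed.

Lemma Dl_rem W {fW : findim W} s i (F : 'rV[R]_m -> W) x : i \in s -> smooth_near F x ->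
  Dl s F x = Dl (i :: rem i s) F x.
Proof.
elim: s x => [//|j s IH] x; rewrite inE /=; have [->//|ji] := eqVneq i j.
move=> /= is_ sF.
rewrite schwarz; last exact: sn_Dl.
apply: near_eq_derive; apply: filterS (sn_near sF) => y sFy; exact: IH.
Qed.

Lemma Dl_perm W {fW : findim W} s t (F : 'rV[R]_m -> W) x : perm_eq s t -> smooth_near F x ->
  Dl s F x = Dl t F x.
Proof.
elim: s t x => [|i s IH] t x st sF; first by have := perm_size st; case: t st.
have it : i \in t by rewrite -(perm_mem st) mem_head.
rewrite (Dl_rem it sF) /=; apply: near_eq_derive; apply: filterS (sn_near sF) => y sFy.
apply: IH => //; rewrite -(perm_cons i); apply: (perm_trans st); exact: perm_to_rem.
Qed.

Lemma sum_count_mem s : (\sum_(i < m) count_mem i s)%N = size s.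
Proof.
elim: s => [|j s IH] /=; first by rewrite big1.
rewrite big_split /= IH (bigD1 j)//= eqxx big1 ?addn0// => i ij.
by rewrite eq_sym (negbTE ij).
Qed.

Lemma mindex0P k : (\sum_i ([ffun _ : 'I_m => ord0 : 'I_k.+1] i) <= k)%N.
Proof. by rewrite big1// => i _; rewrite ffunE. Qed.

Definition mindex0 k : multi_index m k :=
  exist (fun a : {ffun 'I_m -> 'I_k.+1} => is_true (\sum_i a i <= k)%N) [ffun=> ord0] (mindex0P k).

(** Counts the occurrences of each direction; meaningful for lists of at most
    [k] directions. *)
Definition midx k s : multi_index m k :=
  insubd (mindex0 k) [ffun i => inord (count_mem i s)].

Lemma midxE k s i : (size s <= k)%N -> val (midx k s) i = count_mem i s :> nat.
Proof.
move=> sk; have ck j : (count_mem j s <= k)%N by exact: leq_trans (count_size _ _) sk.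
rewrite /midx val_insubd ifT; first by rewrite ffunE inordK// ltnS.
apply: leq_trans sk; rewrite -sum_count_mem; apply: leq_sum => j _.
by rewrite ffunE inordK// ltnS.
Qed.

Lemma count_alist k (a : multi_index m k) i : count_mem i (alist a) = val a i.
Proof.
rewrite /alist count_flatten -map_comp sumnE big_map big_enum /=.
rewrite (bigD1 i)//= count_nseq /= eqxx mul1n big1 ?addn0// => j ji.
by rewrite count_nseq /= (negbTE ji).
Qed.

Lemma size_alist k (a : multi_index m k) : (size (alist a) <= k)%N.
Proof.
rewrite -sum_count_mem; under eq_bigr => i _ do rewrite count_alist.
exact: (valP a).
Qed.

Lemma alist_midx k s : (size s <= k)%N -> perm_eq (alist (midx k s)) s.
Proof.
by move=> sk; apply/allP => i _; rewrite /= count_alist midxE.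
Qed.

Lemma midx_perm k s t : perm_eq s t -> midx k s = midx k t.
Proof.
move=> /permP st; congr (insubd _ _); apply/ffunP => i; rewrite !ffunE.
by rewrite (st (pred1 i)).
Qed.

End Partials.

Section JetCoordinates.
Context {R : realType} {m m' : nat}.
Implicit Types (F G : 'rV[R]_m -> 'rV[R]_m').

(** Indexed as in [jet_chart], whose fiber coordinates these are. *)
Definition jetc k F (x : 'rV[R]_m) : 'M[R]_(#|{: multi_index m k}|, m') :=
  \matrix_(a, l) partial (enum_val a) F x 0 l.

(** On the jet of [F] this is the derivative of [F] along [s]; for the empty
    list, the value of [F]. *)
Definition jrow k s (u : 'M[R]_(#|{: multi_index m k}|, m')) : 'rV[R]_m' :=
  row (enum_rank (midx k s)) u.

(** Maps the jet of [F] of order [k1] to the jet of order [k2] of the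
    derivative of [F] along [s]; for the empty list, this is the truncation of
    jets. *)
Definition jop k1 k2 s (u : 'M[R]_(#|{: multi_index m k1}|, m')) :
    'M[R]_(#|{: multi_index m k2}|, m') :=
  \matrix_(a, l) jrow (s ++ alist (enum_val a)) u 0 l.

Lemma row_jetc k F x a : row a (jetc k F x) = Dl (alist (enum_val a)) F x.
Proof. by apply/rowP => l; rewrite !mxE partialE. Qed.

Lemma jrow_jetc k s F x : (size s <= k)%N -> smooth_near F x ->
  jrow s (jetc k F x) = Dl s F x.
Proof.
move=> sk sF; rewrite /jrow row_jetc enum_rankK.
by apply: Dl_perm sF; exact: alist_midx.
Qed.

Lemma jop_jetc k1 k2 s F x : (size s + k2 <= k1)%N -> smooth_near F x ->
  jop k2 s (jetc k1 F x) = jetc k2 (Dl s F) x.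
Proof.
move=> sk sF; apply/matrixP => a l; rewrite [LHS]mxE [RHS]mxE.
rewrite jrow_jetc//; last first.
  by rewrite size_cat (leq_trans _ sk)// leq_add2l size_alist.
rewrite partialE -Dl_cat.
by rewrite (@Dl_perm R m _ _ (s ++ _) (alist (enum_val a) ++ s))// perm_catC.
Qed.

Lemma jrow_jop0 k1 k2 (u : 'M[R]_(#|{: multi_index m k1}|, m')) :
  jrow [::] (jop k2 [::] u) = jrow [::] u.
Proof.
apply/rowP => l; rewrite [in LHS]mxE mxE enum_rankK.
by rewrite /jrow !mxE (@midx_perm m k1 _ [::])//; exact: alist_midx.
Qed.

Lemma jetc_near k F G (x : 'rV[R]_m) : (\forall y \near x, F y = G y) -> jetc k F x = jetc k G x.
Proof.
move=> FG; apply/matrixP => a l; rewrite !mxE !partialE.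
by rewrite (nbhs_singleton (Dl_near (alist (enum_val a)) FG)).
Qed.

Lemma sn_jetc k F x : smooth_near F x -> smooth_near (jetc k F) x.
Proof.
by move=> sF; apply: sn_mx => a l; apply: sn_entry; rewrite partialE; exact: sn_Dl.
Qed.

Lemma sn_jrow (V : normedModType R) k s (u : V -> 'M[R]_(#|{: multi_index m k}|, m')) x :
  smooth_near u x -> smooth_near (fun y => jrow s (u y)) x.
Proof.
move=> su; apply: (@sn_eq _ _ _ (fun y => \matrix_(i < 1, l < m') u y (enum_rank (midx k s)) l)).
  by move=> y; apply/rowP => l; rewrite !mxE.
by apply: sn_mx => i l; exact: sn_entry.
Qed.

Lemma sn_jop (V : normedModType R) k1 k2 s (u : V -> 'M[R]_(#|{: multi_index m k1}|, m')) x :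
  smooth_near u x -> smooth_near (fun y => jop k2 s (u y)) x.
Proof.
move=> su; apply: sn_mx => a l; apply: sn_entry; exact: sn_jrow.
Qed.

(** The mechanism by which a prescription of jets of order k + 1 becomes a
    differential equation for jets of order k. *)
Lemma jetc_der k F x w : smooth_near F x ->
  'D_w (jetc k F) x = \sum_j w 0 j *: jop k [:: j] (jetc k.+1 F x).
Proof.
move=> sF; have sj := sn_jetc k sF.
rewrite {1}(row_sum_delta w) der_dir_sum; last exact: sn_diff.
apply: eq_bigr => j _; rewrite der_dirZ; last exact: sn_diff.
congr (_ *: _); rewrite jop_jetc//=; apply/matrixP => a l; rewrite mxE partialE.
have le : linear (fun A : 'M[R]_(#|{: multi_index m k}|, m') => A a l) by move=> ? ? ?; rewrite !mxE.
pose E : {linear 'M[R]_(#|{: multi_index m k}|, m') -> R} :=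
  HB.pack (fun A : 'M[R]_(#|{: multi_index m k}|, m') => A a l) (GRing.isLinear.Build _ _ _ _ _ le).
have cE : continuous E by exact: coord_continuous.
rewrite -[LHS]/(E ('D_(delta_mx 0 j) (jetc k F) x)) -(der_linear (jetc k F x) _ cE).
rewrite -(der_comp (f := jetc k F) (g := E)); [|exact: sn_diff|exact: linear_differentiable].
have le' : linear (fun A : 'rV[R]_m' => A 0 l) by move=> ? ? ?; rewrite !mxE.
pose E' : {linear 'rV[R]_m' -> R} :=
  HB.pack (fun A : 'rV[R]_m' => A 0 l) (GRing.isLinear.Build _ _ _ _ _ le').
have cE' : continuous E' by exact: coord_continuous.
have -> : (fun y => E (jetc k F y)) = fun y => E' (Dl (alist (enum_val a)) F y).
  by apply/funext => y; rewrite /E /E' /= mxE partialE.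
have sD := sn_Dl (alist (enum_val a)) sF.
rewrite (der_comp (f := Dl (alist (enum_val a)) F) (g := E')); [|exact: sn_diff|exact: linear_differentiable].
rewrite der_linear//.
have p : perm_eq (j :: alist (enum_val a)) (alist (enum_val a) ++ [:: j]) by rewrite -cat1s perm_catC.
have h := Dl_perm (fW := findimM 1 m') p sF; rewrite Dl_cat in h.
exact: (congr1 (fun A : 'rV[R]_m' => A 0 l) h).
Qed.

End JetCoordinates.

(** * Jets under a change of variables *)

Section ChangeOfVariables.
Context {R : realType} {m m' : nat}.
Variables (tau : 'rV[R]_m -> 'rV[R]_m) (sigma : 'rV[R]_m' -> 'rV[R]_m').

(** By induction on the list of directions: differentiating once more gives
    the derivative of [H] along the derivative of z |-> (z, jet of F at tau
    z), and that is read off the jet of the next order. *)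
Lemma change_partial (s : seq 'I_m) :
  exists H : 'rV[R]_m * 'M[R]_(#|{: multi_index m (size s)}|, m') -> 'rV[R]_m',
    (forall y u, smooth_near tau y -> smooth_near sigma (jrow [::] u) -> smooth_near H (y, u)) /\
    (forall F y, smooth_near tau y -> smooth_near F (tau y) -> smooth_near sigma (F (tau y)) ->
       Dl s (fun z => sigma (F (tau z))) y = H (y, jetc (size s) F (tau y))).
Proof.
elim: s => [|i s [H [sH HE]]] /=.
  exists (fun z => sigma (jrow [::] z.2)); split=> [y u st ss|F y st sF ss].
    apply: (sn_comp (F := fun z : 'rV[R]_m * _ => jrow [::] z.2) (G := sigma)) => //.
    by apply: sn_jrow; apply: sn_lin => // ?; exact: cvg_snd.
  by rewrite /= jrow_jetc.
pose n := size s.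
(* [pt] truncates the jet to the order on which [H] depends, and [dir] is the
   derivative of z |-> (z, jet of F at tau z) in the direction [i]. *)
pose dir (z : 'rV[R]_m * 'M[R]_(#|{: multi_index m n.+1}|, m')) :=
  (delta_mx 0 i : 'rV[R]_m, \sum_j ('D_(delta_mx 0 i) tau z.1) 0 j *: jop n [:: j] z.2).
pose pt (z : 'rV[R]_m * 'M[R]_(#|{: multi_index m n.+1}|, m')) := (z.1, jop n [::] z.2).
exists (fun z => 'D_(dir z) H (pt z)); split=> [y u st ss|F y st sF ss].
  have s1 : smooth_near (fst : 'rV[R]_m * 'M[R]_(#|{: multi_index m n.+1}|, m') -> _) (y, u).
    by apply: sn_lin => // ?; exact: cvg_fst.
  have s2 : smooth_near (snd : 'rV[R]_m * 'M[R]_(#|{: multi_index m n.+1}|, m') -> _) (y, u).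
    by apply: sn_lin => // ?; exact: cvg_snd.
  apply: (sn_der_at (g := pt) (h := dir) (F := H)).
  - by apply: sn_pair => //; exact: sn_jop.
  - apply: sn_pair; first exact: sn_cst.
    apply: sn_sum => j; apply: sn_scale; last exact: sn_jop.
    apply: sn_entry; apply: (sn_comp (F := fst) (G := 'D_(delta_mx 0 i) tau)) => //.
    exact: sn_der.
  - by apply: sH => //=; rewrite jrow_jop0.
have sFt : smooth_near (fun z => F (tau z)) y by exact: sn_comp.
have E : \forall z \near y, Dl s (fun z => sigma (F (tau z))) z = H (z, jetc n F (tau z)).
  have n1 := sn_preim st (sn_near sF).
  have n2 := sn_preim sFt (sn_near ss).
  by apply: filterS3 (sn_near st) n1 n2 => z; exact: HE.
rewrite /= (near_eq_derive _ E).
have sj := sn_jetc n sF.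
have sjt : smooth_near (fun z => jetc n F (tau z)) y by exact: (sn_comp (F := tau) (G := jetc n F)).
have sHy : smooth_near H (y, jetc n F (tau y)) by apply: sH => //; rewrite jrow_jetc.
rewrite (der_comp (f := fun z => (z, jetc n F (tau z))) (g := H)); last 2 first.
- by apply: sn_diff; apply: sn_pair => //; exact: sn_id.
- exact: sn_diff.
rewrite (der_pair (f := fun z => z)); last 2 first.
- exact: sn_diff (sn_id y).
- exact: sn_diff.
rewrite derive_id (der_comp (f := tau) (g := jetc n F)); [|exact: sn_diff|exact: sn_diff].
by rewrite jetc_der// /dir /pt /= jop_jetc.
Qed.

Lemma change_jet k :
  exists H : 'rV[R]_m * 'M[R]_(#|{: multi_index m k}|, m') -> 'M[R]_(#|{: multi_index m k}|, m'),
    (forall y u, smooth_near tau y -> smooth_near sigma (jrow [::] u) -> smooth_near H (y, u)) /\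
    (forall F y, smooth_near tau y -> smooth_near F (tau y) -> smooth_near sigma (F (tau y)) ->
       jetc k (fun z => sigma (F (tau z))) y = H (y, jetc k F (tau y))).
Proof.
pose L (a : 'I_#|{: multi_index m k}|) := alist (enum_val a : multi_index m k).
pose Ha a := projT1 (cid (change_partial (L a))).
have sHa a := (projT2 (cid (change_partial (L a)))).1.
have EHa a := (projT2 (cid (change_partial (L a)))).2.
exists (fun z => \matrix_(a, l) Ha a (z.1, jop (size (L a)) [::] z.2) 0 l).
split=> [y u st ss|F y st sF ss].
  apply: sn_mx => a l; apply: sn_entry.
  have sp : smooth_near (fun z : 'rV[R]_m * 'M[R]_(#|{: multi_index m k}|, m') => (z.1, jop (size (L a)) [::] z.2)) (y, u).
    apply: sn_pair; first by apply: sn_lin => // ?; exact: cvg_fst.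
    by apply: sn_jop; apply: sn_lin => // ?; exact: cvg_snd.
  apply: (sn_comp (G := Ha a) sp); apply: sHa => //=.
  by rewrite jrow_jop0.
apply/matrixP => a l; rewrite [LHS]mxE [RHS]mxE partialE.
rewrite -/(L a) EHa//= jop_jetc//=; exact: size_alist.
Qed.

End ChangeOfVariables.

(** * Taylor polynomials *)

Section Taylor.
Context {R : realType} {m : nat}.

(** A product of polynomials in the single coordinates, centered at [x0]: this
    form is stable under partial derivatives. *)
Definition monomial (x0 : 'rV[R]_m) (p : 'I_m -> {poly R}) (y : 'rV[R]_m) : R :=
  \prod_i (p i).[y 0 i - x0 0 i].

Lemma sn_horner (p : {poly R}) (V : normedModType R) (a : V -> R) x :
  smooth_near a x -> smooth_near (fun y => p.[a y]) x.
Proof.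
move=> sa; elim/poly_ind: p => [|p c IH].
  by apply: (sn_eq _ (sn_cst (0 : R) x)) => y; rewrite horner0.
apply: (sn_eq _ (snD (snM IH sa) (sn_cst c x))) => y.
by rewrite hornerMXaddC.
Qed.

Lemma sn_monomial x0 p y : smooth_near (monomial x0 p) y.
Proof.
apply: sn_prod => i; apply: sn_horner; apply: snB; last exact: sn_cst.
by apply: sn_entry; exact: sn_id.
Qed.

Lemma derive_invariant (V W : normedModType R) (F : V -> W) (x v : V) :
  (forall h : R, F (h *: v + x) = F x) -> 'D_v F x = 0.
Proof.
move=> h; rewrite /derive.
have -> : (fun t : R => t^-1 *: ((F \o shift x) (t *: v) - F x)) = fun=> 0.
  by apply/funext => t; rewrite /= h subrr scaler0.
exact: (lim_cst (@norm_hausdorff _ _)).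
Qed.

Lemma horner_der (p : {poly R}) (t u : R) : 'D_u (horner p) t = u * p^`().[t].
Proof.
have dp : differentiable (horner p) t by exact: sn_diff (sn_horner p (sn_id t)).
have u1 : u = u *: (1 : R) by rewrite /GRing.scale /= mulr1.
by rewrite {1}u1 der_dirZ// -derive1E derivE.
Qed.

Definition derivp (j : 'I_m) (p : 'I_m -> {poly R}) (i : 'I_m) : {poly R} :=
  if i == j then (p i)^`() else p i.

Lemma monomial_der x0 p j y : 'D_(delta_mx 0 j) (monomial x0 p) y = monomial x0 (derivp j p) y.
Proof.
pose A (z : 'rV[R]_m) := (p j).[z 0 j - x0 0 j].
pose B (z : 'rV[R]_m) := \prod_(i | i != j) (p i).[z 0 i - x0 0 i].
have sa : smooth_near (fun z : 'rV[R]_m => z 0 j - x0 0 j) y.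
  by apply: snB; [apply: sn_entry; exact: sn_id|exact: sn_cst].
have sA : smooth_near A y by exact: sn_horner.
have sB : smooth_near B y.
  apply: sn_prod => i; apply: sn_horner; apply: snB; last exact: sn_cst.
  by apply: sn_entry; exact: sn_id.
have -> : monomial x0 p = fun z => A z *: B z by apply/funext => z; rewrite /monomial (bigD1 j).
rewrite (der_scale (a := A) (f := B)); [|exact: sn_diff|exact: sn_diff].
have -> : 'D_(delta_mx 0 j) B y = 0.
  apply: derive_invariant => h; apply: eq_bigr => i ij.
  by rewrite !mxE (negbTE ij) andbF mulr0 add0r.
rewrite scaler0 add0r.
have -> : 'D_(delta_mx 0 j) A y = (p j)^`().[y 0 j - x0 0 j].
  rewrite (der_comp (f := fun z : 'rV[R]_m => z 0 j - x0 0 j) (g := horner (p j))); last 2 first.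
  - exact: sn_diff.
  - exact: sn_diff (sn_horner (p j) (sn_id _)).
  rewrite horner_der.
  rewrite (derB (f := fun z : 'rV[R]_m => z 0 j) (g := fun=> x0 0 j)); last 2 first.
  - by apply: sn_diff; apply: sn_entry; exact: sn_id.
  - exact: differentiable_cst.
  have le : linear (fun A : 'rV[R]_m => A 0 j) by move=> ? ? ?; rewrite !mxE.
  pose E : {linear 'rV[R]_m -> R} := HB.pack (fun A : 'rV[R]_m => A 0 j) (GRing.isLinear.Build _ _ _ _ _ le).
  have cE : continuous E by exact: coord_continuous.
  rewrite derive_cst subr0 (der_linear (L := E))// /E /= mxE !eqxx /=.
  by rewrite mul1r.
rewrite /monomial (bigD1 j)//= /derivp eqxx; congr (_ * _).
by apply: eq_bigr => i ij; rewrite (negbTE ij).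
Qed.

(** The representative is the Taylor polynomial with the coefficients [u] a /
    a!. *)
Lemma jet_exists m' k (x0 : 'rV[R]_m) (u : 'M[R]_(#|{: multi_index m k}|, m')) :
  exists P : 'rV[R]_m -> 'rV[R]_m', (forall y, smooth_near P y) /\ jetc k P x0 = u.
Proof.
pose mon (p : 'I_#|{: multi_index m k}| -> 'I_m -> {poly R}) (y : 'rV[R]_m) :=
  \sum_a monomial x0 (p a) y *: row a u.
have smon p y : smooth_near (mon p) y.
  by apply: sn_sum => a; apply: sn_scale; [exact: sn_monomial|exact: sn_cst].
have dmon p j : 'D_(delta_mx 0 j) (mon p) = mon (fun a => derivp j (p a)).
  apply/funext => y; rewrite /mon.
  have -> : (fun y => \sum_a monomial x0 (p a) y *: row a u) =
            \sum_a (fun y => monomial x0 (p a) y *: row a u).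
    by apply/funext => z; rewrite fct_sumE.
  rewrite derive_sum; last first.
    move=> a; apply/diff_derivable/sn_diff; apply: sn_scale; [exact: sn_monomial|exact: sn_cst].
  apply: eq_bigr => a _.
  rewrite (der_scale (a := monomial x0 (p a)) (f := fun=> row a u)); last 2 first.
  - exact: sn_diff (sn_monomial _ _ _).
  - exact: differentiable_cst.
  by rewrite derive_cst scaler0 add0r monomial_der.
have Dmon s p : Dl s (mon p) = mon (fun a i => (p a i)^`(count_mem i s)).
  elim: s p => [|j s IH] p; first by congr mon; apply/funext => a; apply/funext => i.
  rewrite /= IH dmon; congr mon; apply/funext => a; apply/funext => i.
  by rewrite /derivp eq_sym; case: eqP => _; rewrite ?add1n ?add0n ?derivnS.
pose c (a : 'I_#|{: multi_index m k}|) i := val (enum_val a) i.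
(* The derivative number b of this monomial at [x0] is 1 if b = a and 0
   otherwise. *)
pose p a i : {poly R} := ((c a i)`!%:R)^-1 *: 'X^(c a i).
exists (mon p); split=> //.
apply/row_matrixP => b; rewrite row_jetc Dmon /mon (bigD1 b)//= big1 ?addr0.
  rewrite [X in X *: _](_ : _ = 1) ?scale1r// /monomial big1// => i _.
  rewrite subrr count_alist /p derivnZ derivnXn hornerZ hornerMn subnn expr0 hornerC.
  by rewrite ffactnn mulVf// pnatr_eq0 -lt0n fact_gt0.
move=> a ab; rewrite [X in X *: _](_ : _ = 0) ?scale0r//.
have [i ci] : exists i, c a i != c b i.
  apply/existsP; apply: contraNT ab; rewrite negb_exists => /forallP h.
  apply/eqP; apply: enum_val_inj; apply: val_inj; apply/ffunP => i.
  by apply/eqP; have := h i; rewrite negbK.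
rewrite /monomial (bigD1 i)//= subrr count_alist /p derivnZ derivnXn hornerZ hornerMn hornerXn.
rewrite -/(c b i) expr0n subn_eq0.
have [lt|le] := ltnP (c a i) (c b i); first by rewrite ffact_small// mulr0n mulr0 mul0r.
by rewrite leqNgt ltn_neqAle le eq_sym ci /= mul0rn mulr0 mul0r.
Qed.

End Taylor.

(** * The smooth structure of jet spaces *)

Section JetSpace.
Context {R : realType} {m m' : nat} (M : manifold R m) (M' : manifold R m').

Let sM : smooth_atlas (matlas M) := manifold_smooth_atlas M.
Let sM' : smooth_atlas (matlas M') := manifold_smooth_atlas M'.

(** The map [f] in coordinates. *)
Definition loc (phi : chart M 'rV[R]_m) (psi : chart M' 'rV[R]_m') (f : M -> M') :
  'rV[R]_m -> 'rV[R]_m' := inchart phi (cmap psi \o f).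

Lemma locE phi psi f x : charts_at (matlas M) x phi -> loc phi psi f (cmap phi x) = cmap psi (f x).
Proof. by move=> [Ap dx]; rewrite /loc inchartE//; exact: (sa_inj sM Ap). Qed.

Lemma sn_loc phi psi f x : charts_at (matlas M) x phi -> charts_at (matlas M') (f x) psi ->
  smooth_at (matlas M) (matlas M') f x -> smooth_near (loc phi psi f) (cmap phi x).
Proof. by move=> Ax Bx [_ sf]; exact: sf. Qed.

Lemma loc_change phi psi phi' psi' f x :
  charts_at (matlas M) x phi -> charts_at (matlas M) x phi' ->
  charts_at (matlas M') (f x) psi -> charts_at (matlas M') (f x) psi' ->
  {for x, continuous f} ->
  \forall v \near cmap phi' x, inchart psi (cmap psi') (loc phi psi f (inchart phi' (cmap phi) v)) =
    loc phi' psi' f v.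
Proof.
move=> Ax Ax' Bx Bx' cf; apply: (chart_near_eq sM Ax').
have n2 : \forall y \near x, cdom psi (f y) by apply: cf; exact: (near_cdom sM' Bx).
apply: filterS2 (near_cdom sM Ax) n2 => y dy dfy dy'.
have i1 := sa_inj sM Ax.1; have i1' := sa_inj sM Ax'.1; have i2 := sa_inj sM' Bx.1.
by rewrite /loc !inchartE//= inchartE.
Qed.

(** The pair of charts determines one smooth function that transforms the jets
    of all maps; this is [change_jet] for the two coordinate changes. *)
Lemma jet_change k phi psi phi' psi' :
  exists H : 'rV[R]_m * 'M[R]_(#|{: multi_index m k}|, m') -> 'M[R]_(#|{: multi_index m k}|, m'),
  forall f x, charts_at (matlas M) x phi -> charts_at (matlas M) x phi' ->
    charts_at (matlas M') (f x) psi -> charts_at (matlas M') (f x) psi' ->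
    smooth_at (matlas M) (matlas M') f x ->
    smooth_near H (cmap phi' x, jetc k (loc phi psi f) (cmap phi x)) /\
    jetc k (loc phi' psi' f) (cmap phi' x) = H (cmap phi' x, jetc k (loc phi psi f) (cmap phi x)).
Proof.
have [H [sH HE]] := change_jet (inchart phi' (cmap phi)) (inchart psi (cmap psi')) k.
exists H => f x Ax Ax' Bx Bx' sf.
have st := sa_compat sM Ax' Ax; have ss := sa_compat sM' Bx Bx'.
have tx : inchart phi' (cmap phi) (cmap phi' x) = cmap phi x.
  by rewrite inchartE//; [exact: (sa_inj sM Ax'.1)|exact: Ax'.2].
have sl := sn_loc Ax Bx sf.
split.
  by apply: sH => //; rewrite jrow_jetc//= locE.
rewrite -(jetc_near k (loc_change Ax Ax' Bx Bx' sf.1)).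
by rewrite HE ?tx ?locE.
Qed.

Lemma same_jet_sym k x (f g : M -> M') : same_jet k x f g -> same_jet k x g f.
Proof.
by move=> [e h]; split=> // phi psi a Ax; rewrite -e => Bx; rewrite h.
Qed.

Lemma same_jet_trans k x (f g h : M -> M') :
  same_jet k x f g -> same_jet k x g h -> same_jet k x f h.
Proof.
move=> [e1 h1] [e2 h2]; split=> [|phi psi a Ax Bx]; first by rewrite e1.
by rewrite h1// h2// -e1.
Qed.

Lemma jet_class_eq k x (f g : M -> M') : same_jet k x f g -> jet_class k x f = jet_class k x g.
Proof.
move=> fg; apply/seteqP; split=> h [sh jh]; split=> //.
  exact: same_jet_trans (same_jet_sym fg) jh.
exact: same_jet_trans fg jh.
Qed.

Lemma same_jetP k x (f g : M -> M') phi psi :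
  charts_at (matlas M) x phi -> charts_at (matlas M') (f x) psi ->
  same_jet k x f g -> jetc k (loc phi psi f) (cmap phi x) = jetc k (loc phi psi g) (cmap phi x).
Proof.
by move=> Ax Bx [_ h]; apply/matrixP => a l; rewrite !mxE /loc h.
Qed.

(** The coordinates of a jet in one pair of charts determine those in any
    other, by [jet_change]. *)
Lemma same_jet_intro k x (f g : M -> M') phi psi :
  charts_at (matlas M) x phi -> charts_at (matlas M') (f x) psi ->
  smooth_at (matlas M) (matlas M') f x -> smooth_at (matlas M) (matlas M') g x -> f x = g x ->
  jetc k (loc phi psi f) (cmap phi x) = jetc k (loc phi psi g) (cmap phi x) ->
  same_jet k x f g.
Proof.
move=> Ax Bx sf sg fg E; split=> // phi' psi' a Ax' Bx'.
have [H HE] := jet_change k phi psi phi' psi'.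
have [_ hf] := HE f x Ax Ax' Bx Bx' sf.
have Bg : charts_at (matlas M') (g x) psi by rewrite -fg.
have Bg' : charts_at (matlas M') (g x) psi' by rewrite -fg.
have [_ hg] := HE g x Ax Ax' Bg Bg' sg.
have : row (enum_rank a) (jetc k (loc phi' psi' f) (cmap phi' x)) =
       row (enum_rank a) (jetc k (loc phi' psi' g) (cmap phi' x)) by rewrite hf hg E.
by rewrite !row_jetc enum_rankK !partialE.
Qed.

Lemma jet_eq k (j1 j2 : jet M M' k) :
  jsource j1 = jsource j2 -> jmaps j1 = jmaps j2 -> j1 = j2.
Proof.
case: j1 j2 => [x1 J1 p1] [x2 J2 p2] /= e1 e2; subst x2 J2.
by congr Jet; exact: Prop_irrelevance.
Qed.

Lemma jreprP k (j : jet M M' k) :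
  smooth_at (matlas M) (matlas M') (jrepr j) (jsource j) /\
  jmaps j = jet_class k (jsource j) (jrepr j).
Proof. by rewrite /jrepr; case: (cid2 _). Qed.

Lemma jmapsP k (j : jet M M' k) f : jmaps j f ->
  smooth_at (matlas M) (matlas M') f (jsource j) /\ same_jet k (jsource j) (jrepr j) f.
Proof. by rewrite (jreprP j).2. Qed.

Lemma same_jet_refl k x (f : M -> M') : same_jet k x f f.
Proof. by []. Qed.

Lemma jmaps_repr k (j : jet M M' k) : jmaps j (jrepr j).
Proof. by rewrite (jreprP j).2; split; [exact: (jreprP j).1|exact: same_jet_refl]. Qed.

Lemma jet_at_repr k f x (fx : smooth_at (matlas M) (matlas M') f x) :
  same_jet k x f (jrepr (jet_at k fx)).
Proof. exact: (jmaps_repr (jet_at k fx)).2. Qed.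

Lemma jtarget_at k f x (fx : smooth_at (matlas M) (matlas M') f x) :
  jtarget (jet_at k fx) = f x.
Proof. by have [] := jet_at_repr k fx. Qed.

Lemma jet_cmapE k phi psi (j : jet M M' k) :
  cmap (jet_chart k phi psi) j =
  (cmap phi (jsource j), jetc k (loc phi psi (jrepr j)) (cmap phi (jsource j))).
Proof. by []. Qed.

Lemma jet_at_cmap k phi psi f x (fx : smooth_at (matlas M) (matlas M') f x) :
  charts_at (matlas M) x phi -> charts_at (matlas M') (f x) psi ->
  cmap (jet_chart k phi psi) (jet_at k fx) = (cmap phi x, jetc k (loc phi psi f) (cmap phi x)).
Proof.
by move=> Ax Bx; rewrite jet_cmapE /= (same_jetP Ax Bx (jet_at_repr k fx)).
Qed.

Lemma jet_at_dom k phi psi f x (fx : smooth_at (matlas M) (matlas M') f x) :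
  cdom phi x -> cdom psi (f x) -> cdom (jet_chart k phi psi) (jet_at k fx).
Proof. by move=> dx dfx; split=> //; rewrite jtarget_at. Qed.

Lemma jrow_cmap k phi psi (j : jet M M' k) : matlas M phi -> matlas M' psi ->
  cdom (jet_chart k phi psi) j ->
  jrow [::] (cmap (jet_chart k phi psi) j).2 = cmap psi (jtarget j).
Proof.
move=> Ap Bp [/= dx dy].
have s := sn_loc (conj Ap dx) (conj Bp dy) (jreprP j).1.
transitivity (jrow [::] (jetc k (loc phi psi (jrepr j)) (cmap phi (jsource j)))) => //.
by rewrite (@jrow_jetc _ _ _ k [::] _ _ (leq0n _) s) /= locE.
Qed.

Lemma jet_transition k phi psi phi' psi' :
  matlas M phi -> matlas M' psi -> matlas M phi' -> matlas M' psi' ->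
  exists T : 'rV[R]_m * 'M[R]_(#|{: multi_index m k}|, m') -> 'rV[R]_m * 'M[R]_(#|{: multi_index m k}|, m'),
  forall j : jet M M' k, cdom (jet_chart k phi psi) j -> cdom (jet_chart k phi' psi') j ->
    smooth_near T (cmap (jet_chart k phi psi) j) /\
    cmap (jet_chart k phi' psi') j = T (cmap (jet_chart k phi psi) j).
Proof.
move=> Ap Bp Ap' Bp'.
have [H HE] := jet_change k phi psi phi' psi'.
exists (fun v => (inchart phi (cmap phi') v.1, H (inchart phi (cmap phi') v.1, v.2))).
move=> j [dx dy] [dx' dy'].
have [sH E] := HE (jrepr j) (jsource j) (conj Ap dx) (conj Ap' dx') (conj Bp dy) (conj Bp' dy') (jreprP j).1.
have e1 : inchart phi (cmap phi') (cmap phi (jsource j)) = cmap phi' (jsource j).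
  by rewrite inchartE//; exact: (sa_inj sM Ap).
rewrite !jet_cmapE /= e1 -E; split=> //.
set v := (_, _).
have s1 : smooth_near (fun v : 'rV[R]_m * 'M[R]_(#|{: multi_index m k}|, m') => inchart phi (cmap phi') v.1) v.
  apply: (sn_comp (F := fst) (G := inchart phi (cmap phi'))).
    by apply: sn_lin => // ?; exact: cvg_fst.
  exact: (sa_compat sM (conj Ap dx) (conj Ap' dx')).
have s2 : smooth_near (snd : 'rV[R]_m * 'M[R]_(#|{: multi_index m k}|, m') -> _) v.
  by apply: sn_lin => // ?; exact: cvg_snd.
apply: sn_pair => //; apply: (sn_comp (G := H) (sn_pair s1 s2)) => /=.
by rewrite e1.
Qed.

(** Says that the source and target maps are continuous on the jet space,
    whose topology is defined by coordinates. It is put in terms of one chart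
    because the continuity of jet charts is proved from it. *)
Lemma jet_near_dom k phi psi (j : jet M M' k) (P : set M) (Q : set M') :
  matlas M phi -> matlas M' psi -> cdom (jet_chart k phi psi) j ->
  nbhs (jsource j) P -> nbhs (jtarget j) Q ->
  \forall v \near cmap (jet_chart k phi psi) j, forall i : jet M M' k,
    cdom (jet_chart k phi psi) i -> cmap (jet_chart k phi psi) i = v ->
    P (jsource i) /\ Q (jtarget i).
Proof.
move=> Ap Bp dj nP nQ; have [dx dy] := dj.
set v := cmap _ j.
have s1 : smooth_near (fst : 'rV[R]_m * 'M[R]_(#|{: multi_index m k}|, m') -> _) v.
  by apply: sn_lin => // ?; exact: cvg_fst.
have s2 : smooth_near (fun w : 'rV[R]_m * 'M[R]_(#|{: multi_index m k}|, m') => jrow [::] w.2) v.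
  by apply: sn_jrow; apply: sn_lin => // ?; exact: cvg_snd.
have n1 := sn_preim s1 (chart_inv_cont sM (conj Ap dx) nP).
have n2 := sn_preim (A := [set w | forall y, cdom psi y -> cmap psi y = w -> Q y]) s2.
rewrite /v jrow_cmap// in n2; have {}n2 := n2 (chart_inv_cont sM' (conj Bp dy) nQ).
apply: filterS2 n1 n2 => w h1 h2 i di iw.
split; first by apply: h1; [exact: di.1|rewrite -iw].
by apply: h2; [exact: di.2|rewrite -iw jrow_cmap].
Qed.

Lemma jet_open_dom k phi psi : matlas M phi -> matlas M' psi ->
  open (cdom (jet_chart k phi psi : chart (jet M M' k) _)).
Proof.
move=> Ap Bp; rewrite /open /= => _ j [[phi' [psi' [Ap' Bp' ->]]] dj'] [dx dy].
have := jet_near_dom Ap' Bp' dj' (near_cdom sM (conj Ap dx)) (near_cdom sM' (conj Bp dy)).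
by apply: filterS => v h i di iv; have [] := h i di iv.
Qed.

Lemma jet_chart_inj k phi psi : matlas M phi -> matlas M' psi ->
  set_inj (cdom (jet_chart k phi psi : chart (jet M M' k) _)) (cmap (jet_chart k phi psi)).
Proof.
move=> Ap Bp j1 j2; rewrite !inE => d1 d2 e12.
have e1 : jsource j1 = jsource j2.
  by apply: (sa_inj sM Ap); rewrite ?inE; [exact: d1.1|exact: d2.1|exact: (congr1 fst e12)].
have et : jtarget j1 = jtarget j2.
  apply: (sa_inj sM' Bp); rewrite ?inE; [exact: d1.2|exact: d2.2|].
  by rewrite -!(jrow_cmap Ap Bp)// e12.
apply: jet_eq => //; rewrite (jreprP j1).2 (jreprP j2).2 -e1; apply: jet_class_eq.
apply: (same_jet_intro (conj Ap d1.1) (conj Bp d1.2)).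
- exact: (jreprP j1).1.
- by rewrite e1; exact: (jreprP j2).1.
- by move: et; rewrite /jtarget -e1.
- by have := congr1 snd e12; rewrite !jet_cmapE /= -e1.
Qed.

(** Jet charts map onto open sets: close to the coordinates of a jet, any
    value is realized by a Taylor polynomial, lifted to the manifolds. *)
Lemma jet_chart_nbhs k phi psi (j : jet M M' k) : matlas M phi -> matlas M' psi ->
  cdom (jet_chart k phi psi) j ->
  \forall v \near cmap (jet_chart k phi psi) j,
    exists2 i : jet M M' k, cdom (jet_chart k phi psi) i & cmap (jet_chart k phi psi) i = v.
Proof.
move=> Ap Bp dj; have [dx dy] := dj; set v := cmap _ j.
have s1 : smooth_near (fst : 'rV[R]_m * 'M[R]_(#|{: multi_index m k}|, m') -> _) v.
  by apply: sn_lin => // ?; exact: cvg_fst.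
have s2 : smooth_near (fun w : 'rV[R]_m * 'M[R]_(#|{: multi_index m k}|, m') => jrow [::] w.2) v.
  by apply: sn_jrow; apply: sn_lin => // ?; exact: cvg_snd.
have xT : nbhs (jsource j) [set _ | True] by exact: filterT.
have yT : nbhs (jtarget j) [set _ | True] by exact: filterT.
have n1 := sn_preim s1 (chart_near sM (conj Ap dx) xT).
have n2 := sn_preim (A := [set w | exists y, [/\ cdom psi y, cmap psi y = w & True]]) s2.
rewrite /v jrow_cmap// in n2; have {}n2 := n2 (chart_near sM' (conj Bp dy) yT).
apply: filterS2 n1 n2 => -[x0 u] [x [dx' ex _]] [y [dy' ey _]].
rewrite [fst _]/= in ex; rewrite [snd _]/= in ey.
have [P [sP EP]] := jet_exists x0 u.
have Ax : charts_at (matlas M) x phi by [].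
have By : charts_at (matlas M') y psi by [].
have Px : P (cmap phi x) = cmap psi y by rewrite ex ey -EP jrow_jetc.
have [f [fx sf nf]] := chart_lift (fV := findimM 1 m) (fW := findimM 1 m') sM sM' Ax By (sP _) Px.
have Bf : charts_at (matlas M') (f x) psi by rewrite fx.
exists (jet_at k sf); first by apply: jet_at_dom => //; rewrite fx.
rewrite jet_at_cmap// ex -EP; congr (_, _).
rewrite -ex; apply: jetc_near; apply: (chart_near_eq sM Ax).
by apply: filterS nf => z [dz ez] dz'; rewrite /loc inchartE//; exact: (sa_inj sM Ap).
Qed.

(** In any other chart the condition of being mapped near a given point is
    expressed by the smooth transition map, so it is an open condition. *)
Lemma jet_chart_cont k phi psi (j : jet M M' k) : matlas M phi -> matlas M' psi ->
  cdom (jet_chart k phi psi) j -> {for j, continuous (cmap (jet_chart k phi psi) : jet M M' k -> _)}.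
Proof.
move=> Ap Bp dj W nW.
pose O := [set i : jet M M' k | cdom (jet_chart k phi psi) i /\ nbhs (cmap (jet_chart k phi psi) i) W].
have oO : open O.
  rewrite /open /= => _ i [[phi' [psi' [Ap' Bp' ->]]] di'] [di nWi].
  have [T hT] := jet_transition k Ap' Bp' Ap Bp.
  have [sT ET] := hT i di' di.
  have n1 := jet_near_dom Ap' Bp' di' (near_cdom sM (conj Ap di.1)) (near_cdom sM' (conj Bp di.2)).
  rewrite ET in nWi.
  have n2 := sn_preim sT (nbhs_interior nWi).
  apply: filterS2 n1 n2 => v h1 h2 l dl lv.
  have dl' := h1 l dl lv; split=> //.
  by rewrite (hT l dl dl').2 lv.
have : nbhs j O by apply: open_nbhs_nbhs; split.
by apply: filterS => i [_ /nbhs_singleton].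
Qed.

Lemma jatlas_smooth_atlas k : smooth_atlas (jatlas M M' k).
Proof.
split.
- by move=> _ [phi [psi [Ap Bp ->]]]; exact: jet_open_dom.
- by move=> _ [phi [psi [Ap Bp ->]]]; exact: jet_chart_inj.
- by move=> _ [phi [psi [Ap Bp ->]]] j dj; exact: jet_chart_cont.
- move=> _ [phi [psi [Ap Bp ->]]] O oO Od; rewrite openE => _ [j Oj <-].
  have dj := Od _ Oj.
  have Aj : charts_at (jatlas M M' k) j (jet_chart k phi psi) by split=> //; exists phi, psi.
  have n1 := oO _ _ Aj Oj.
  have n2 := jet_chart_nbhs Ap Bp dj.
  apply: filterS2 n1 n2 => v h [i di iv]; exists i => //; exact: h.
- move=> _ _ j [[phi [psi [Ap Bp ->]]] dj] [[phi' [psi' [Ap' Bp' ->]]] dj'].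
  have [T hT] := jet_transition k Ap Bp Ap' Bp'.
  have [sT ET] := hT j dj dj'.
  apply: sn_congr sT.
  have n1 := jet_near_dom Ap Bp dj (near_cdom sM (conj Ap' dj'.1)) (near_cdom sM' (conj Bp' dj'.2)).
  have n2 := jet_chart_nbhs Ap Bp dj.
  apply: filterS2 n1 n2 => v h [i di iv].
  have di' := h i di iv; rewrite -iv inchartE//; last exact: jet_chart_inj.
  by rewrite (hT i di di').2.
Qed.

End JetSpace.

(** * Local diffeomorphisms and invertible jets *)

Section SmoothCoord.
Context {R : realType}.

Lemma smooth_at_of_coord (X Y : topologicalType) (V W : normedModType R)
    (A : atlas X V) (B : atlas Y W) {fV : findim V} {fW : findim W}
    (sA : smooth_atlas A) (sB : smooth_atlas B) (f : X -> Y) x phi psi (F : V -> W) :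
  charts_at A x phi -> B psi -> smooth_near F (cmap phi x) ->
  (\forall x' \near x, cdom psi (f x') /\ cmap psi (f x') = F (cmap phi x')) ->
  smooth_at A B f x.
Proof.
move=> Ax Bp sF h; have [dfx efx] := nbhs_singleton h.
have Bx : charts_at B (f x) psi by [].
apply: (smooth_at_intro (fV := fV) (fW := fW) sA sB Ax Bx).
  move=> O nO; have := chart_inv_cont sB Bx nO; rewrite efx => nO'.
  have n1 := near_chart sA Ax (sn_preim sF nO').
  by apply: filterS2 h n1 => z [dz ez] h1; exact: h1.
apply: sn_congr sF; apply: (chart_near_eq sA Ax).
by apply: filterS h => z [dz ez] dz'; rewrite inchartE//; exact: (sa_inj sA Ax.1).
Qed.

End SmoothCoord.

Section LocalInverse.
Context {R : realType} {m m' : nat} (M : manifold R m) (M' : manifold R m').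

Lemma loc_cancel (U : set M) (f : M -> M') (g : M' -> M) x phi psi :
  open U -> U x -> (forall y, U y -> g (f y) = y) -> {for x, continuous f} ->
  charts_at (matlas M) x phi -> charts_at (matlas M') (f x) psi ->
  \forall v \near cmap phi x, loc psi phi g (loc phi psi f v) = v.
Proof.
move=> oU Ux gf cf Ax Bx.
have sM := manifold_smooth_atlas M; have sM' := manifold_smooth_atlas M'.
apply: (chart_near_eq sM Ax).
have n1 : nbhs x U by exact: open_nbhs_nbhs.
have n2 : \forall y \near x, cdom psi (f y) by apply: cf; exact: (near_cdom sM' Bx).
apply: filterS2 n1 n2 => y Uy dfy dy.
have Ay : charts_at (matlas M) y phi by split=> //; exact: Ax.1.
have By : charts_at (matlas M') (f y) psi by split=> //; exact: Bx.1.
by rewrite (locE _ _ Ay) (locE _ _ By) gf.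
Qed.

End LocalInverse.

Section LocalDiffeo.
Context {R : realType} {m : nat} (M M' : manifold R m).

Let sM : smooth_atlas (matlas M) := manifold_smooth_atlas M.
Let sM' : smooth_atlas (matlas M') := manifold_smooth_atlas M'.

Lemma diffeo_jac U U' (f : M -> M') x phi psi : diffeo U U' f -> U x ->
  charts_at (matlas M) x phi -> charts_at (matlas M') (f x) psi ->
  jac (loc phi psi f) (cmap phi x) \in unitmx.
Proof.
move=> [oU oU' sf [g [gf fg] sg]] Ux Ax Bx.
have [U'fx gfx] := gf x Ux.
have sfx := sf x Ux; have sgx := sg (f x) U'fx.
have Agx : charts_at (matlas M) (g (f x)) phi by rewrite gfx.
have sl := sn_loc Ax Bx sfx; have sl' := sn_loc Bx Agx sgx.
have E := loc_cancel oU Ux (fun y Uy => (gf y Uy).2) sfx.1 Ax Bx.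
have := jac_near_id E; rewrite (jac_comp (f := loc phi psi f) (g := loc psi phi g)).
- by case/mulmx1_unit.
- exact: sn_diff.
- by rewrite (locE _ _ Ax); exact: sn_diff.
Qed.

(** The inverse function theorem on manifolds; [N] restricts the source. *)
Lemma jac_local_diffeo (f : M -> M') x phi psi (N : set M) :
  charts_at (matlas M) x phi -> charts_at (matlas M') (f x) psi ->
  smooth_at (matlas M) (matlas M') f x -> jac (loc phi psi f) (cmap phi x) \in unitmx ->
  nbhs x N ->
  exists U U', [/\ U x, U `<=` N & diffeo U U' f].
Proof.
move=> Ax Bx sf uf nN.
have sl := sn_loc Ax Bx sf.
have [g0 [sg0 g0x fg0 gf0]] := inverse_function sl uf.
rewrite (locE _ _ Ax) in sg0 g0x fg0.
have [g [gx sg ng]] := chart_lift (fV := findimM 1 m) (fW := findimM 1 m) sM' sM Bx Ax sg0 g0x.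
have n1 : \forall y \near x, cdom psi (f y) by apply: sf.1; exact: (near_cdom sM' Bx).
have n2 : \forall y \near f x, cdom phi (g y).
  by apply: filterS ng => y [].
have nA : \forall y \near x, [/\ g (f y) = y, smooth_at (matlas M) (matlas M') f y & N y].
  have n3 : \forall y \near x, cdom phi (g (f y)) /\ cmap phi (g (f y)) = g0 (cmap psi (f y)).
    exact: (sf.1 _ ng).
  have n4 := near_chart sM Ax gf0.
  have n5 := smooth_at_near (fV := findimM 1 m) (fW := findimM 1 m) sM sM' Ax Bx sf.
  have n6 : \forall y \near x, [/\ cdom phi y, N y & smooth_at (matlas M) (matlas M') f y].
    by apply: filterS3 (near_cdom sM Ax) nN n5.
  apply: filterS3 n3 n4 n6 => y [dy ey] h [dy' Ny sy]; split=> //.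
  apply: (sa_inj sM Ax.1); rewrite ?inE//.
  by rewrite ey -[RHS]h (locE _ _ (conj Ax.1 dy')).
have nB : \forall y \near f x, f (g y) = y /\ smooth_at (matlas M') (matlas M) g y.
  have n3 : \forall y \near f x, cdom psi (f (g y)).
    have cg := sg.1; rewrite /prop_for /continuous_at gx in cg; exact: (cg _ n1).
  have n4 := near_chart sM' Bx fg0.
  have Agx : charts_at (matlas M) (g (f x)) phi by rewrite gx.
  have n5 := smooth_at_near (fV := findimM 1 m) (fW := findimM 1 m) sM' sM Bx Agx sg.
  have n6 : \forall y \near f x, [/\ cdom psi y, cdom phi (g y) /\ cmap phi (g y) = g0 (cmap psi y) &
       smooth_at (matlas M') (matlas M) g y].
    by apply: filterS3 (near_cdom sM' Bx) ng n5.
  apply: filterS3 n3 n4 n6 => y dfg h [dy [dg eg] sgy]; split=> //.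
  apply: (sa_inj sM' Bx.1); rewrite ?inE//.
  by rewrite -(locE _ _ (conj Ax.1 dg)) eg.
pose A := interior [set y | [/\ g (f y) = y, smooth_at (matlas M) (matlas M') f y & N y]].
pose B := interior [set y | f (g y) = y /\ smooth_at (matlas M') (matlas M) g y].
have oA : open A by exact: open_interior.
have oB : open B by exact: open_interior.
have AP y : A y -> [/\ g (f y) = y, smooth_at (matlas M) (matlas M') f y & N y] by move=> /nbhs_singleton.
have BP y : B y -> f (g y) = y /\ smooth_at (matlas M') (matlas M) g y by move=> /nbhs_singleton.
(* The maps f and g exchange these two sets. *)
pose U' := [set y | B y /\ A (g y)].
pose U := [set y | A y /\ U' (f y)].
have oU' : open U'.
  rewrite openE => y [By Agy]; apply: filterI; first exact: open_nbhs_nbhs.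
  by apply: (BP y By).2.1; exact: open_nbhs_nbhs.
have oU : open U.
  rewrite openE => y [Ay U'fy]; apply: filterI; first exact: open_nbhs_nbhs.
  by have [_ [cf _] _] := AP y Ay; apply: cf; exact: open_nbhs_nbhs.
exists U, U'; split.
- by split; [exact: nA|split; [exact: nB|rewrite gx; exact: nA]].
- by move=> y [/AP[]].
split=> //; first by move=> y [/AP[]].
exists g; last by move=> y [/BP[]].
split=> [y [Ay U'fy]|y [By Agy]]; first by split=> //; have [] := AP y Ay.
have [fgy _] := BP y By; split=> //.
by split=> //; rewrite fgy.
Qed.

(** The jacobian matrix of a map as a function of its jet. *)
Definition jet_jac k (u : 'M[R]_(#|{: multi_index m k}|, m)) : 'M[R]_m :=
  \matrix_(i, l) jrow [:: i] u 0 l.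

Lemma jet_jacE k (F : 'rV[R]_m -> 'rV[R]_m) x : (0 < k)%N -> smooth_near F x ->
  jet_jac (jetc k F x) = jac F x.
Proof. by move=> k0 sF; apply/matrixP => i l; rewrite [LHS]mxE [RHS]mxE jrow_jetc. Qed.

(** Invertible jets are thus given by an open condition in coordinates;
    positive order is essential, as the jacobian matrix has to be part of the
    jet. *)
Lemma invertible_jetP k (j : jet M M' k) phi psi : (0 < k)%N ->
  matlas M phi -> matlas M' psi -> cdom (jet_chart k phi psi) j ->
  invertible_jet M M' k j <-> jet_jac (cmap (jet_chart k phi psi) j).2 \in unitmx.
Proof.
move=> k0 Ap Bp [dx dy].
have Ax : charts_at (matlas M) (jsource j) phi by [].
have Bx : charts_at (matlas M') (jrepr j (jsource j)) psi by [].
have sj := sn_loc Ax Bx (jreprP j).1.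
rewrite jet_cmapE /= jet_jacE//; split=> [[f [U [U' [/jmapsP[sf jf] Ux df]]]]|uj].
  rewrite -(jet_jacE k0 sj) (same_jetP Ax Bx jf).
  have Bfx : charts_at (matlas M') (f (jsource j)) psi by rewrite -jf.1.
  rewrite jet_jacE//; last exact: sn_loc.
  exact: diffeo_jac df Ux Ax Bfx.
have jT : nbhs (jsource j) setT by exact: filterT.
have [U [U' [Ux _ dU]]] := jac_local_diffeo Ax Bx (jreprP j).1 uj jT.
by exists (jrepr j), U, U'; split=> //; exact: jmaps_repr.
Qed.

Lemma sn_jet_jac (V : normedModType R) k (u : V -> 'M[R]_(#|{: multi_index m k}|, m)) x :
  smooth_near u x -> smooth_near (fun y => jet_jac (u y)) x.
Proof. by move=> su; apply: sn_mx => i l; apply: sn_entry; exact: sn_jrow. Qed.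

End LocalDiffeo.

(** * Parametrization of the solutions of a complete system *)

Section CutOff.
Context {R : realType}.

Definition bumpv m (e : R) (v : 'rV[R]_m) : R := \prod_i bumpf e (v 0 i).

Lemma bumpv0 m (e : R) : 0 < e -> bumpv e (0 : 'rV[R]_m) = 1.
Proof. by move=> e0; rewrite /bumpv big1// => i _; rewrite mxE bump0. Qed.

Lemma bumpv_support m (e : R) (v : 'rV[R]_m) : 0 < e -> bumpv e v != 0 -> `|v| < e.
Proof.
move=> e0 /prodf_neq0 h; rewrite /Num.norm /= mx_normrE; apply/bigmax_ltP; split=> //.
by move=> [i j] _ /=; rewrite ord1; apply: bump_support => //; exact: h.
Qed.

Lemma sn_bumpv (V : normedModType R) m (e : R) (a : V -> 'rV[R]_m) x :
  smooth_near a x -> smooth_near (fun y => bumpv e (a y)) x.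
Proof. by move=> sa; apply: sn_prod => i; apply: sn_bump; exact: sn_entry. Qed.

(** [C] is the preimage of a compact set of coordinates. It is closed in the
    whole space because that space is Hausdorff, so a point that leaves the
    chart also leaves [C], and does so in a neighborhood. *)
Lemma chart_shield (X : topologicalType) (V : normedModType R) {fV : findim V} (A : atlas X V)
    (sA : smooth_atlas A) x phi : hausdorff_space X -> charts_at A x phi ->
  exists e : R, exists C : set X, [/\ 0 < e, closed C, C `<=` cdom phi &
    forall y, cdom phi y -> `|cmap phi y - cmap phi x| < e -> C y].
Proof.
move=> hX Ax; have inj := sa_inj sA Ax.1.
have xT : nbhs x [set _ | True] by exact: filterT.
have [K [nK cK _ KI]] := convex_compact_nbhs (fV := fV) (chart_near sA Ax xT).
pose inv v := xget x [set y | cdom phi y /\ cmap phi y = v].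
have invE y : cdom phi y -> inv (cmap phi y) = y.
  move=> dy; have /(xgetPex x) [dz ez] : exists y', [set y' | cdom phi y' /\ cmap phi y' = cmap phi y] y'.
    by exists y.
  by apply: inj; rewrite ?inE.
have cinv v : K v -> {for v, continuous inv}.
  move=> /KI[y [dy <- _]] N; rewrite invE// => nN.
  have Ay : charts_at A y phi by split=> //; exact: Ax.1.
  by apply: filterS (chart_near sA Ay nN) => w [z [dz <- Nz]]; rewrite /= invE.
have /nbhs_ballP[e e0 he] := nK.
exists e, (inv @` K); split=> //.
- apply: compact_closed => //; apply: continuous_compact cK.
  by apply/continuous_in_subspaceT => v; rewrite inE; exact: cinv.
- by move=> _ [v /KI[y [dy <- _]] <-]; rewrite invE.
- move=> y dy ye; exists (cmap phi y); last exact: invE.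
  by apply: he; rewrite -ball_normE /= distrC.
Qed.

Lemma unit_segment_convex : segment_convex (`[0, 1]%classic : set R).
Proof.
move=> a b t; rewrite /= !in_itv /= => /andP[a0 a1] /andP[b0 b1] /andP[t0 t1].
by apply/andP; split; rewrite /GRing.scale /=; nra.
Qed.

Lemma unit_speed_euler i k : euler_iter (fun _ : R => (1 : R)) i k 0 = k%:R * dyadic i.
Proof.
elim: k => [|k IH]; first by rewrite mul0r.
by rewrite euler_iterS IH -natr1 mulrDl mul1r /GRing.scale /= mulr1.
Qed.

End CutOff.

Section CompleteSystem.
Context {R : realType} {m : nat} (M M' : manifold R m) (r : nat).
Hypothesis r_gt0 : (0 < r)%N.
Variable Phi : jet M M' r -> jet M M' r.+1.
Hypothesis Phi_smooth : smooth_on (jatlas M M' r) (jatlas M M' r.+1) (invertible_jet M M' r) Phi.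
Variables (p : M) (p' : M') (phi : chart M 'rV[R]_m) (psi : chart M' 'rV[R]_m).
Hypotheses (Ap : charts_at (matlas M) p phi) (Bp : charts_at (matlas M') p' psi).
Variables (e : R) (C : set M) (C' : set M').
Hypotheses (e_gt0 : 0 < e) (closedC : closed C) (closedC' : closed C').
Hypotheses (C_dom : C `<=` cdom phi) (C'_dom : C' `<=` cdom psi).
Hypothesis C_ball : forall y, cdom phi y -> `|cmap phi y - cmap phi p| < e + e -> C y.
Hypothesis C'_ball : forall y, cdom psi y -> `|cmap psi y - cmap psi p'| < e + e -> C' y.

Let sM : smooth_atlas (matlas M) := manifold_smooth_atlas M.
Let sM' : smooth_atlas (matlas M') := manifold_smooth_atlas M'.

Notation chi := (jet_chart r phi psi : chart (jet M M' r) _).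
Notation chi1 := (jet_chart r.+1 phi psi : chart (jet M M' r.+1) _).
Notation E := ('rV[R]_m * 'M[R]_(#|{: multi_index m r}|, m))%type.
Notation E1 := ('rV[R]_m * 'M[R]_(#|{: multi_index m r.+1}|, m))%type.

Let sJ : smooth_atlas (jatlas M M' r) := jatlas_smooth_atlas M M' r.
Let sJ1 : smooth_atlas (jatlas M M' r.+1) := jatlas_smooth_atlas M M' r.+1.

Lemma chi_atlas : jatlas M M' r chi.
Proof. by exists phi, psi; split; [exact: Ap.1|exact: Bp.1|]. Qed.

Lemma chi1_atlas : jatlas M M' r.+1 chi1.
Proof. by exists phi, psi; split; [exact: Ap.1|exact: Bp.1|]. Qed.

(** The jets close to the fiber over (p, p'). The radius is half of that of
    the balls in [C] and [C'], which leaves room for the displacement allowed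
    by [cut]. *)
Definition good (j : jet M M' r) : Prop :=
  [/\ cdom chi j, invertible_jet M M' r j,
      `|cmap phi (jsource j) - cmap phi p| < e & `|cmap psi (jtarget j) - cmap psi p'| < e].

Lemma good_near j : good j -> \forall v \near cmap chi j, forall i, cdom chi i -> cmap chi i = v -> good i.
Proof.
move=> [dj ij sj tj]; set v := cmap chi j.
have s1 : smooth_near (fst : E -> _) v by apply: sn_lin => // ?; exact: cvg_fst.
have s2 : smooth_near (snd : E -> _) v by apply: sn_lin => // ?; exact: cvg_snd.
have n1 : \forall w \near v, \det (jet_jac w.2) != 0.
  apply: (sn_neq0 (a := fun w : E => \det (jet_jac w.2))).
    apply: (sn_det (A := fun w : E => jet_jac w.2)); exact: sn_jet_jac.
  by have := (invertible_jetP r_gt0 Ap.1 Bp.1 dj).1 ij; rewrite unitmxE unitfE.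
have nb (x y : 'rV[R]_m) : `|y - x| < e -> nbhs y [set z | `|z - x| < e].
  move=> yx; apply/nbhs_ballP; exists (e - `|y - x|); first by rewrite /= subr_gt0.
  move=> z; rewrite -ball_normE /= distrC ltrBrDr => zy.
  by rewrite -(subrK y z) -addrA; exact: le_lt_trans (ler_normD _ _) zy.
have n2 := sn_preim s1 (nb _ _ sj).
have n3 := sn_preim (A := [set z | `|z - cmap psi p'| < e]) (sn_jrow [::] s2).
rewrite /v (jrow_cmap Ap.1 Bp.1 dj) in n3; have {}n3 := n3 (nb _ _ tj).
apply: filterS3 n1 n2 n3 => w h1 h2 h3 i di iw; split=> //.
- by apply/(invertible_jetP r_gt0 Ap.1 Bp.1 di); rewrite iw unitmxE unitfE.
- by move: h2; rewrite -iw.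
- by move: h3; rewrite -iw /= -(jrow_cmap Ap.1 Bp.1 di).
Qed.

(** Compares source and target of a jet with those of its image under [Phi];
    it equals one where they agree, as they do at jets of solutions. *)
Definition cut (j : jet M M' r) : R :=
  bumpv e (cmap phi (jsource (Phi j)) - cmap phi (jsource j)) *
  bumpv e (cmap psi (jtarget (Phi j)) - cmap psi (jtarget j)).

Definition next_jet (j : jet M M' r) : 'M[R]_(#|{: multi_index m r.+1}|, m) :=
  if `[< cdom chi1 (Phi j) >] then cut j *: (cmap chi1 (Phi j)).2 else 0.

Definition next_coord : E -> 'M[R]_(#|{: multi_index m r.+1}|, m) := inchart chi next_jet.

Lemma jet_near k (i : jet M M' k) (P : set M) (Q : set M') :
  nbhs (jsource i) P -> nbhs (jtarget i) Q -> \forall l \near i, P (jsource l) /\ Q (jtarget l).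
Proof.
move=> nP nQ.
have [f Af] := matlas_cover (jsource i); have [g Bg] := matlas_cover (jtarget i).
have Ai : charts_at (jatlas M M' k) i (jet_chart k f g).
  by split; [exists f, g; split; [exact: Af.1|exact: Bg.1|]|split; [exact: Af.2|exact: Bg.2]].
have sk := jatlas_smooth_atlas M M' k.
have n1 := near_chart sk Ai (jet_near_dom Af.1 Bg.1 Ai.2 nP nQ).
by apply: filterS2 n1 (near_cdom sk Ai) => l h dl; exact: h.
Qed.

Lemma next_coordE j : cdom chi j -> next_coord (cmap chi j) = next_jet j.
Proof. by move=> dj; rewrite /next_coord inchartE//; exact: (sa_inj sJ chi_atlas). Qed.

Lemma next_coord_smooth j : good j -> smooth_near next_coord (cmap chi j).
Proof.
move=> gj; have [dj ij sj tj] := gj.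
have Aj : charts_at (jatlas M M' r) j chi by split=> //; exact: chi_atlas.
have [cPhi sPhi] := Phi_smooth ij.
have nd := near_cdom sJ Aj.
(* Where [Phi j] stays in the chart the formula is smooth. Where it leaves the
   chart, [next_jet] vanishes near [j], because jets where it does not vanish
   are sent to points of [C] and [C']. *)
have [dP|ndP] := pselect (cdom chi1 (Phi j)).
- have APj : charts_at (jatlas M M' r.+1) (Phi j) chi1 by split=> //; exact: chi1_atlas.
  have sY := sPhi _ _ Aj APj; set Y0 := inchart chi _ in sY.
  set v := cmap chi j in sY *.
  have s1 : smooth_near (fst : E -> _) v by apply: sn_lin => // ?; exact: cvg_fst.
  have s2 : smooth_near (snd : E -> _) v by apply: sn_lin => // ?; exact: cvg_snd.
  have Y1 : smooth_near (fun w => (Y0 w).1) v.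
    by apply: (sn_comp (G := fst) sY); apply: sn_lin => // ?; exact: cvg_fst.
  have Y2 : smooth_near (fun w => (Y0 w).2) v.
    by apply: (sn_comp (G := snd) sY); apply: sn_lin => // ?; exact: cvg_snd.
  pose G w := (bumpv e ((Y0 w).1 - w.1) * bumpv e (jrow [::] (Y0 w).2 - jrow [::] w.2)) *: (Y0 w).2.
  have sG : smooth_near G v.
    apply: sn_scale => //; apply: snM; apply: sn_bumpv; apply: snB => //; exact: sn_jrow.
  apply: sn_congr sG; apply: (chart_near_eq sJ Aj).
  have n1 : \forall i \near j, cdom chi1 (Phi i) by exact: (cPhi _ (near_cdom sJ1 APj)).
  apply: filterS n1 => i dPi di; rewrite next_coordE// /next_jet; case: asboolP => // _.
  have Y0i : Y0 (cmap chi i) = cmap chi1 (Phi i).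
    by rewrite /Y0 inchartE//; exact: (sa_inj sJ chi_atlas).
  by rewrite /G Y0i (jrow_cmap Ap.1 Bp.1 dPi) (jrow_cmap Ap.1 Bp.1 di).
- suff n0 : \forall i \near j, next_jet i = 0.
    apply: (sn_congr _ (sn_cst (0 : 'M[R]_(#|{: multi_index m r.+1}|, m)) (cmap chi j))); apply: (chart_near_eq sJ Aj).
    by apply: filterS n0 => i i0 di; rewrite next_coordE.
  have [nC|nC] : ~ C (jsource (Phi j)) \/ ~ C' (jtarget (Phi j)).
    apply: contrapT => /not_orP[/contrapT h1 /contrapT h2]; apply: ndP.
    by split; [exact: C_dom|exact: C'_dom].
  + have n1 : nbhs (jsource (Phi j)) (~` C) by apply: open_nbhs_nbhs; split=> //; exact: closed_openC.
    have tT : nbhs (jtarget (Phi j)) [set: M'] by exact: filterT.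
    have n2 : \forall i \near j, (~` C) (jsource (Phi i)) /\ [set: M'] (jtarget (Phi i)).
      exact: (cPhi _ (jet_near n1 tT)).
    have n3 := near_chart sJ Aj (good_near gj).
    apply: filterS3 n2 n3 nd => i [Ci _] gi di.
    have [_ _ si _] := gi i di erefl.
    rewrite /next_jet; case: asboolP => // -[ds _].
    have [->|] := eqVneq (cut i) 0; first by rewrite scale0r.
    rewrite /cut mulf_eq0 negb_or => /andP[/(bumpv_support e_gt0) h _].
    exfalso; apply: Ci; apply: C_ball => //.
    rewrite -(subrK (cmap phi (jsource i)) (cmap phi (jsource (Phi i)))) -addrA.
    by apply: le_lt_trans (ler_normD _ _) _; exact: ltrD.
  + have n1 : nbhs (jtarget (Phi j)) (~` C') by apply: open_nbhs_nbhs; split=> //; exact: closed_openC.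
    have tT : nbhs (jsource (Phi j)) [set: M] by exact: filterT.
    have n2 : \forall i \near j, [set: M] (jsource (Phi i)) /\ (~` C') (jtarget (Phi i)).
      exact: (cPhi _ (jet_near tT n1)).
    have n3 := near_chart sJ Aj (good_near gj).
    apply: filterS3 n2 n3 nd => i [_ Ci] gi di.
    have [_ _ _ ti] := gi i di erefl.
    rewrite /next_jet; case: asboolP => // -[_ ds].
    have [->|] := eqVneq (cut i) 0; first by rewrite scale0r.
    rewrite /cut mulf_eq0 negb_or => /andP[_ /(bumpv_support e_gt0) h].
    exfalso; apply: Ci; apply: C'_ball => //.
    rewrite -(subrK (cmap psi (jtarget i)) (cmap psi (jtarget (Phi i)))) -addrA.
    by apply: le_lt_trans (ler_normD _ _) _; exact: ltrD.
Qed.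

(** At the jet of a solution the cut-off is one. *)
Lemma next_jet_complete f x (fx : smooth_at (matlas M) (matlas M') f x) :
  cdom phi x -> cdom psi (f x) -> jet_at r.+1 fx = Phi (jet_at r fx) ->
  next_jet (jet_at r fx) = jetc r.+1 (loc phi psi f) (cmap phi x).
Proof.
move=> dx dfx E1; rewrite /next_jet -E1.
have d1 : cdom chi1 (jet_at r.+1 fx) by apply: jet_at_dom.
case: asboolP => // _; rewrite (jet_at_cmap r.+1 fx (conj Ap.1 dx) (conj Bp.1 dfx)).
by rewrite /cut -E1 !jtarget_at /= !subrr !bumpv0// mulr1 scale1r.
Qed.

(** The complete system as an autonomous field on triples of a point, a jet,
    and the constant velocity of the point. Keeping the velocity as a
    component makes the field vanish where the velocity is zero. *)
Definition system_field (z : E * 'rV[R]_m) : E * 'rV[R]_m :=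
  ((z.2, \sum_j z.2 0 j *: jop r [:: j] (next_coord z.1)), 0).

Lemma system_field0 v : system_field (v, 0) = 0.
Proof.
rewrite /system_field /= big1// => j _.
by rewrite mxE scale0r.
Qed.

Lemma system_field_smooth v w : smooth_near next_coord v -> smooth_near system_field (v, w).
Proof.
move=> sY.
have s1 : smooth_near (fst : E * 'rV[R]_m -> E) (v, w) by apply: sn_lin => // ?; exact: cvg_fst.
have s2 : smooth_near (snd : E * 'rV[R]_m -> 'rV[R]_m) (v, w) by apply: sn_lin => // ?; exact: cvg_snd.
have s3 : smooth_near (fun z : E * 'rV[R]_m => next_coord z.1) (v, w).
  exact: (sn_comp (F := fst) (G := next_coord)).
apply: sn_pair; last exact: sn_cst.
apply: sn_pair => //; apply: sn_sum => j; apply: sn_scale; last exact: sn_jop.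
exact: sn_entry.
Qed.

Lemma good_tame j : good j -> tame system_field (cmap chi j, 0).
Proof.
move=> gj; apply: stationary_tame; last exact: system_field0.
by apply: system_field_smooth; exact: next_coord_smooth.
Qed.

(** Along a straight segment in the chart, the jet of a solution is an integral
    curve of the system field, so its end point is the time-one flow of the
    jet at the initial point. *)
Lemma complete_solution (f : M -> M') q (fq : smooth_at (matlas M) (matlas M') f q) (U : set M) :
  nbhs q U ->
  (forall x (fx : smooth_at (matlas M) (matlas M') f x), U x -> jet_at r.+1 fx = Phi (jet_at r fx)) ->
  good (jet_at r fq) ->
  \forall x \near q, cdom psi (f x) /\
    jrow [::] (flow1 system_field (cmap chi (jet_at r fq), cmap phi x - cmap phi q)).1.2 = cmap psi (f x).
Proof.
move=> nU fU gj; have [[dq dt] _ _ _] := gj.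
have Aq : charts_at (matlas M) q phi by split=> //; exact: Ap.1.
have Bq : charts_at (matlas M') (f q) psi by split; [exact: Bp.1|rewrite -(jtarget_at r fq)].
set x0 := cmap phi q; pose fh := loc phi psi f.
have sf : smooth_near fh x0 by exact: sn_loc.
have E0 : cmap chi (jet_at r fq) = (x0, jetc r fh x0) by exact: jet_at_cmap.
have sj := sn_jetc r sf.
have sg : smooth_near (fun a => (a, jetc r fh a)) x0 by apply: sn_pair => //; exact: sn_id.
have nf : \forall x \near q, cdom psi (f x) by apply: fq.1; exact: (near_cdom sM' Bq).
have nP : \forall x \near q, [/\ U x, cdom psi (f x) & smooth_at (matlas M) (matlas M') f x].
  apply: filterS3 nU nf _; last exact: (smooth_at_near (fV := findimM 1 m) (fW := findimM 1 m) sM sM' Aq Bq fq).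
  by move=> x.
(* Near [q] the second member of the system is the jet of [f] of the next
   order. *)
have hE : \forall a \near x0, [/\ smooth_near fh a, smooth_near next_coord (a, jetc r fh a) &
    next_coord (a, jetc r fh a) = jetc r.+1 fh a].
  have n1 := chart_near sM Aq nP.
  have n2 := good_near gj; rewrite E0 in n2; have {}n2 := sn_preim sg n2.
  apply: filterS3 n1 n2 (sn_near sf) => a [x [dx xa [Ux dfx sfx]]] ga sfa.
  have Ax : charts_at (matlas M) x phi by split=> //; exact: Ap.1.
  have Bx : charts_at (matlas M') (f x) psi by split=> //; exact: Bp.1.
  have Ex : cmap chi (jet_at r sfx) = (a, jetc r fh a) by rewrite jet_at_cmap// xa.
  have dchi : cdom chi (jet_at r sfx) by exact: jet_at_dom.
  split=> //; first by rewrite -Ex; apply: next_coord_smooth; exact: ga.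
  by rewrite -Ex next_coordE// (next_jet_complete dx dfx (fU x sfx Ux)) xa.
have sS : smooth_near system_field ((x0, jetc r fh x0), 0).
  by rewrite -E0; apply: system_field_smooth; exact: next_coord_smooth.
have [K [nK KS cK vK hK]] := stationary_confined sS (system_field0 _) (sn_near sS).
(* [K] is a convex compact set that confines the scheme; the curve itself has
   to stay in [K] as well, which [c] allows to check by continuity at (x0, 0). *)
pose c (z : 'rV[R]_m * 'rV[R]_m) : E * 'rV[R]_m := ((z.1, jetc r fh z.1), z.2).
have s1 : smooth_near (fst : 'rV[R]_m * 'rV[R]_m -> _) (x0, 0) by apply: sn_lin => // ?; exact: cvg_fst.
have s2 : smooth_near (snd : 'rV[R]_m * 'rV[R]_m -> _) (x0, 0) by apply: sn_lin => // ?; exact: cvg_snd.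
have sc : smooth_near c (x0, 0).
  apply: sn_pair => //; apply: sn_pair => //.
  exact: (sn_comp (F := fst) (G := jetc r fh)).
have nc : nbhs ((x0, 0) : 'rV[R]_m * 'rV[R]_m) [set z | K (c z) /\ [/\ smooth_near fh z.1, smooth_near next_coord (z.1, jetc r fh z.1) &
    next_coord (z.1, jetc r fh z.1) = jetc r.+1 fh z.1]].
  apply: filterI; first exact: (sn_preim sc nK).
  exact: (sn_preim s1 hE).
have /nbhs_ballP[d d0 hd] := nc.
have scw : smooth_near (fun w : 'rV[R]_m => ((x0, jetc r fh x0), w)) 0.
  by apply: sn_pair; [exact: sn_cst|exact: sn_id].
have nw := sn_preim (A := [set z | forall i k, (k <= 2 ^ i)%N -> K (euler_iter system_field i k z)]) scw hK.
have sb : smooth_near (fun a : 'rV[R]_m => a - x0) x0 by apply: snB; [exact: sn_id|exact: sn_cst].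
have nw' : \forall x \near q, [/\ cdom phi x, `|cmap phi x - x0| < d &
    forall i k, (k <= 2 ^ i)%N -> K (euler_iter system_field i k ((x0, jetc r fh x0), cmap phi x - x0))].
  have h0 : nbhs (0 : 'rV[R]_m) [set w : 'rV[R]_m | `|w| < d] by exact: (@near0_norm_lt R 'rV[R]_m d d0).
  have h1 : nbhs (x0 - x0) [set w : 'rV[R]_m | `|w| < d] by rewrite subrr.
  have h2 : nbhs (x0 - x0) [set w : 'rV[R]_m | forall i k, (k <= 2 ^ i)%N ->
      K (euler_iter system_field i k ((x0, jetc r fh x0), w))] by rewrite subrr.
  have n1 := near_chart sM Aq (sn_preim sb h1); have n2 := near_chart sM Aq (sn_preim sb h2).
  by apply: filterS3 n1 n2 (near_cdom sM Aq) => x.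
apply: filterS2 nf nw' => x dfx [dx xd hKx]; split=> //.
set w := cmap phi x - x0 in xd hKx *.
pose h (t : R) : E * 'rV[R]_m := c (x0 + t *: w, w).
have ht (t : R) : 0 <= t <= 1 -> K (h t) /\ [/\ smooth_near fh (x0 + t *: w),
    smooth_near next_coord (x0 + t *: w, jetc r fh (x0 + t *: w)) &
    next_coord (x0 + t *: w, jetc r fh (x0 + t *: w)) = jetc r.+1 fh (x0 + t *: w)].
  move=> /andP[t0 t1]; apply: (hd (x0 + t *: w, w)).
  have n1 : `|x0 - (x0 + t *: w)| < d.
    by rewrite opprD addrA subrr add0r normrN normrZ ger0_norm// (le_lt_trans _ xd)// ler_piMl.
  by split=> /=; rewrite -ball_normE /= ?sub0r ?normrN.
have sl (t : R) : smooth_near (fun s : R => x0 + s *: w) t.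
  apply: snD; first exact: sn_cst.
  by apply: (sn_scale (a := fun s : R => s)); [exact: sn_id|exact: sn_cst].
have sjl (t : R) : 0 <= t <= 1 -> smooth_near (fun s : R => jetc r fh (x0 + s *: w)) t.
  by move=> /ht[_ [sft _ _]]; apply: (sn_comp (G := jetc r fh) (sl t)); exact: sn_jetc.
have sh (t : R) : 0 <= t <= 1 -> smooth_near h t.
  by move=> t01; apply: sn_pair; [apply: sn_pair => //; exact: sjl|exact: sn_cst].
have seg (t : R) : `[0, 1]%classic t -> 0 <= t <= 1 by rewrite /= in_itv.
have h0 : h 0 = ((x0, jetc r fh x0), w) by rewrite /h /c /= scale0r addr0.
have cv : euler system_field ^~ (h 0) @ \oo --> h 1.
  (* [h] intertwines the constant field 1 on the segment [0, 1] with the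
     system field. *)
  apply: (@flow_natural R R (E * 'rV[R]_m)%type _ _ h (fun=> 1) system_field `[0, 1]%classic K 0 1) => //.
  - exact: segment_compact.
  - exact: unit_segment_convex.
  - by move=> t _; exact: cst_continuous.
  - by move=> t /seg /ht[].
  - move=> t /seg t01; have [_ [sft _ nx]] := ht t t01.
    rewrite (der_pair (f := fun s : R => (x0 + s *: w, jetc r fh (x0 + s *: w))) (g := fun=> w)); last 2 first.
    + by apply: sn_diff; apply: sn_pair => //; exact: sjl.
    + exact: differentiable_cst.
    rewrite (der_pair (f := fun s : R => x0 + s *: w)); [|exact: sn_diff|exact: sn_diff (sjl t t01)].
    rewrite derive_cst (der_comp (f := fun s : R => x0 + s *: w) (g := jetc r fh)); last 2 first.
    + exact: sn_diff.
    + by apply: sn_diff; exact: sn_jetc.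
    by rewrite line_der scale1r jetc_der// /system_field /= nx.
  - move=> i k ki; rewrite unit_speed_euler /= in_itv /=.
    by rewrite mulr_ge0 ?dyadic_ge0//= dyadic_mul_le.
  - by move=> i k ki; rewrite h0; exact: hKx.
  - have -> : (fun i => euler (fun _ : R => (1 : R)) i 0) = fun=> (1 : R).
      apply/funext => i; rewrite /euler unit_speed_euler /dyadic natrX.
      by rewrite divff ?expf_neq0.
    exact: cvg_cst.
have F1 : flow1 system_field (h 0) = h 1 by exact: (cvg_lim (@norm_hausdorff _ _) cv).
rewrite h0 in F1; rewrite E0 F1 /h /c /= scale1r.
have /ht[_ [sf1 _ _]] : 0 <= (1 : R) <= 1 by rewrite ler01 lexx.
rewrite scale1r in sf1; rewrite jrow_jetc//=.
have -> : x0 + w = cmap phi x by rewrite /w addrC subrK.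
by rewrite /fh locE//; split=> //; exact: Ap.1.
Qed.

(** The target coordinates at the end of the segment from the source of a jet
    to a given point. *)
Definition theta (z : 'rV[R]_m * E) : 'rV[R]_m :=
  jrow [::] (flow1 system_field (z.2, z.1 - z.2.1)).1.2.

(** The flow is defined and smooth near the tame points, and the last
    condition says that its target coordinates are those of a point of the
    chart. *)
Definition param_dom : set (M * jet M M' r) :=
  [set z | [/\ cdom phi z.1, good z.2,
     tame system_field (cmap chi z.2, cmap phi z.1 - cmap phi (jsource z.2)) &
     exists2 y, cdom psi y & cmap psi y = theta (cmap phi z.1, cmap chi z.2)]].

Definition param (z : M * jet M M' r) : M' :=
  xget p' [set y | cdom psi y /\ cmap psi y = theta (cmap phi z.1, cmap chi z.2)].

Lemma theta_smooth a v : tame system_field (v, a - v.1) -> smooth_near theta (a, v).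
Proof.
move=> tz.
have s1 : smooth_near (fst : 'rV[R]_m * E -> _) (a, v) by apply: sn_lin => // ?; exact: cvg_fst.
have s2 : smooth_near (snd : 'rV[R]_m * E -> _) (a, v) by apply: sn_lin => // ?; exact: cvg_snd.
have s3 : smooth_near (fun z : 'rV[R]_m * E => z.2.1) (a, v).
  by apply: (sn_comp (F := snd) (G := fst)) => //; apply: sn_lin => // ?; exact: cvg_fst.
have s4 : smooth_near (fun z : 'rV[R]_m * E => (z.2, z.1 - z.2.1)) (a, v).
  by apply: sn_pair => //; exact: snB.
have s5 : smooth_near (fun z => flow1 system_field (z.2, z.1 - z.2.1)) (a, v).
  by apply: (sn_comp (G := flow1 system_field) s4); exact: flow_smooth.
apply: sn_jrow.
have s6 : smooth_near (fun z => (flow1 system_field (z.2, z.1 - z.2.1)).1) (a, v).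
  by apply: (sn_comp (G := fst) s5); apply: sn_lin => // ?; exact: cvg_fst.
by apply: (sn_comp (G := snd) s6); apply: sn_lin => // ?; exact: cvg_snd.
Qed.

Let sP : smooth_atlas (prod_atlas (matlas M) (jatlas M M' r)) :=
  prod_smooth_atlas (fV := findimM 1 m) (fW := findimX (findimM 1 m) (findimM _ m)) sM sJ.

Lemma param_chart z : param_dom z ->
  charts_at (prod_atlas (matlas M) (jatlas M M' r)) z (prod_chart phi chi).
Proof.
move=> [dx [dj _ _ _] _ _]; split=> //.
by exists phi, chi; split=> //; [exact: Ap.1|exact: chi_atlas].
Qed.

Lemma param_near z : param_dom z -> \forall z' \near z, param_dom z'.
Proof.
case: z => x j zP; have Az := param_chart zP.
have [dx gj tz [y dy ey]] := zP; rewrite [fst _]/= in dx tz ey; rewrite [snd _]/= in gj tz ey.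
set v := (cmap phi x, cmap chi j).
have s1 : smooth_near (fst : 'rV[R]_m * E -> _) v by apply: sn_lin => // ?; exact: cvg_fst.
have s2 : smooth_near (snd : 'rV[R]_m * E -> _) v by apply: sn_lin => // ?; exact: cvg_snd.
have s3 : smooth_near (fun z : 'rV[R]_m * E => z.2.1) v.
  by apply: (sn_comp (F := snd) (G := fst)) => //; apply: sn_lin => // ?; exact: cvg_fst.
have s4 : smooth_near (fun z : 'rV[R]_m * E => (z.2, z.1 - z.2.1)) v.
  by apply: sn_pair => //; exact: snB.
have n1 := sn_preim s2 (good_near gj).
have n2 := sn_preim (A := tame system_field) s4 (tame_near tz).
have st : smooth_near theta v by exact: theta_smooth.
have yT : nbhs y [set _ | True] by exact: filterT.
have n3 := chart_near sM' (conj Bp.1 dy) yT; rewrite ey in n3.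
have {}n3 := sn_preim st n3.
have n4 : \forall w \near v, [/\ forall i, cdom chi i -> cmap chi i = w.2 -> good i,
    tame system_field (w.2, w.1 - w.2.1) & exists y, [/\ cdom psi y, cmap psi y = theta w & True]].
  by apply: filterS3 n1 n2 n3 => w.
have n5 := near_chart sP Az n4.
apply: filterS2 n5 (near_cdom sP Az) => -[x' j'] [/= g' t' [y' [dy' ey' _]]] [/= dx' dj'].
split=> //; first exact: g'.
by exists y'.
Qed.

Lemma param_eq z y : cdom psi y -> cmap psi y = theta (cmap phi z.1, cmap chi z.2) -> param z = y.
Proof.
move=> dy ey; rewrite /param.
have /(xgetPex p') [dz ez] : exists y', [set y' | cdom psi y' /\ cmap psi y' = theta (cmap phi z.1, cmap chi z.2)] y'.
  by exists y.
by apply: (sa_inj sM' Bp.1); rewrite ?inE// ez.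
Qed.

Lemma param_smooth : smooth_on (prod_atlas (matlas M) (jatlas M M' r)) (matlas M') param_dom param.
Proof.
move=> z zP; have Az := param_chart zP.
have st : smooth_near theta (cmap (prod_chart phi chi) z) by apply: theta_smooth; case: zP.
apply: (smooth_at_of_coord (fV := findimX (findimM 1 m) (findimX (findimM 1 m) (findimM _ m)))
  (fW := findimM 1 m) (psi := psi) sP sM' Az _ st); first exact: Bp.1.
apply: filterS (param_near zP) => z' [_ _ _ [y dy ey]].
by rewrite (param_eq dy ey).
Qed.

(** At the source of the jet itself the velocity is zero, the flow is
    stationary, and the target is that of the jet. *)
Lemma param_fiber : [set p] `*` invertible_jet_fiber p p' `<=` param_dom.
Proof.
move=> [x j] [/= -> [ij sj tj]].
have dj : cdom chi j by split; rewrite ?sj ?tj; [exact: Ap.2|exact: Bp.2].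
have gj : good j by split=> //; rewrite ?sj ?tj subrr normr0.
have E0 : cmap phi p - cmap phi (jsource j) = 0 by rewrite sj subrr.
split=> //=; first exact: Ap.2.
  by rewrite E0; exact: good_tame.
exists p'; first exact: Bp.2.
rewrite /theta /= E0 stationary_flow; last exact: system_field0.
by rewrite -[RHS]/(jrow [::] (cmap chi j).2) (jrow_cmap Ap.1 Bp.1 dj) tj.
Qed.

Lemma param_solution (f : M -> M') q (fq : smooth_at (matlas M) (matlas M') f q) (U : set M) :
  nbhs q U ->
  (forall x (fx : smooth_at (matlas M) (matlas M') f x), U x -> jet_at r.+1 fx = Phi (jet_at r fx)) ->
  param_dom (q, jet_at r fq) ->
  \forall x \near q, f x = param (x, jet_at r fq).
Proof.
move=> nU fU [_ gj _ _]; have := complete_solution nU fU gj.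
by apply: filterS => x [dfx ex]; rewrite (param_eq dfx)// /theta /= -ex.
Qed.

End CompleteSystem.

Section Parametrization.
Context {R : realType}.

(** The statement for solutions of a complete system in general; the CR
    structures enter only in showing that CR-maps with invertible jets are
    solutions. *)
Lemma complete_system_param m m' (e : m = m') (M : manifold R m) (M' : manifold R m')
    (r : nat) (r_gt0 : (0 < r)%N) (Phi : jet M M' r -> jet M M' r.+1)
    (Phi_smooth : smooth_on (jatlas M M' r) (jatlas M M' r.+1) (invertible_jet M M' r) Phi)
    (p : M) (p' : M') :
  exists (Omega : set (M * jet M M' r)) (Psi : M * jet M M' r -> M'),
    [/\ open Omega,
        Omega `<=` [set z | invertible_jet M M' r z.2],
        [set p] `*` invertible_jet_fiber p p' `<=` Omega,
        smooth_on (prod_atlas (matlas M) (jatlas M M' r)) (matlas M') Omega Psi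
      & forall (f : M -> M') q (fq : smooth_at (matlas M) (matlas M') f q) (U : set M),
          nbhs q U ->
          (forall x (fx : smooth_at (matlas M) (matlas M') f x), U x ->
             jet_at r.+1 fx = Phi (jet_at r fx)) ->
          Omega (q, jet_at r fq) ->
          \forall x \near q, f x = Psi (x, jet_at r fq)].
Proof.
subst m'.
have [phi Ap] := matlas_cover p; have [psi Bp] := matlas_cover p'.
have [e1 [C [e10 cC Cd CP]]] := chart_shield (manifold_smooth_atlas M) (@manifold_hausdorff _ _ M) Ap.
have [e2 [C' [e20 cC' Cd' CP']]] := chart_shield (manifold_smooth_atlas M') (@manifold_hausdorff _ _ M') Bp.
(* Twice this radius is available around both points. *)
pose e := Num.min e1 e2 / 2.
have e0 : 0 < e by rewrite divr_gt0// lt_min e10.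
have ee : e + e = Num.min e1 e2 by rewrite -splitr.
have C_ball y : cdom phi y -> `|cmap phi y - cmap phi p| < e + e -> C y.
  by move=> dy; rewrite ee lt_min => /andP[h _]; exact: CP.
have C'_ball y : cdom psi y -> `|cmap psi y - cmap psi p'| < e + e -> C' y.
  by move=> dy; rewrite ee lt_min => /andP[_ h]; exact: CP'.
exists (param_dom Phi p p' phi psi e), (param Phi p' phi psi e); split.
- rewrite openE => z zP.
  exact: (param_near r_gt0 Ap Bp zP).
- by move=> z [_ [_ iz _ _] _ _].
- exact: (param_fiber r_gt0 Phi_smooth Ap Bp e0 cC cC' Cd Cd' C_ball C'_ball).
- exact: (param_smooth r_gt0 Ap Bp).
- move=> f q fq U nU fU zP.
  exact: (param_solution r_gt0 Phi_smooth Ap Bp e0 cC cC' Cd Cd' C_ball C'_ball nU fU zP).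
Qed.

Lemma invertible_jet_diffeo m m' (e : m = m') (M : manifold R m) (M' : manifold R m')
    (r : nat) (r_gt0 : (0 < r)%N) (f : M -> M') q
    (fq : smooth_at (matlas M) (matlas M') f q) (V : set M) :
  nbhs q V -> invertible_jet M M' r (jet_at r fq) ->
  exists U U', [/\ U q, U `<=` V & diffeo U U' f].
Proof.
subst m' => nV ij.
have [phi Ap] := matlas_cover q; have [psi Bp] := matlas_cover (f q).
have dj : cdom (jet_chart r phi psi) (jet_at r fq) by apply: jet_at_dom; [exact: Ap.2|exact: Bp.2].
have := (invertible_jetP r_gt0 Ap.1 Bp.1 dj).1 ij.
rewrite jet_at_cmap//= jet_jacE//; last exact: sn_loc.
by move=> uf; exact: jac_local_diffeo Ap Bp fq uf nV.
Qed.

End Parametrization.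

(** * CR-maps with invertible jets *)

Section CRDiffeo.
Context {R : realType}.

Lemma chart_atP m (M : manifold R m) (x : M) : charts_at (matlas M) x (chart_at x).
Proof. exact: projT2 (cid _). Qed.

Lemma mdiff_cancel m m' (M : manifold R m) (M' : manifold R m') (U : set M) (f : M -> M')
    (g : M' -> M) x u :
  open U -> U x -> (forall y, U y -> g (f y) = y) ->
  smooth_at (matlas M) (matlas M') f x -> smooth_at (matlas M') (matlas M) g (f x) ->
  mdiff g (f x) (mdiff f x u) = u.
Proof.
move=> oU Ux gf sf sg; have Ax := chart_atP x; have Bx := chart_atP (f x).
have gfx := gf x Ux.
have Agx : charts_at (matlas M) (g (f x)) (chart_at x) by rewrite gfx.
have sl := sn_loc Ax Bx sf; have sl' := sn_loc Bx Agx sg.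
have E := loc_cancel oU Ux gf sf.1 Ax Bx.
rewrite /mdiff gfx -/(loc (chart_at x) (chart_at (f x)) f) -/(loc (chart_at (f x)) (chart_at x) g).
rewrite -[X in 'D_ _ _ X](locE (chart_at (f x)) f Ax).
rewrite -(der_comp (f := loc (chart_at x) (chart_at (f x)) f) (g := loc (chart_at (f x)) (chart_at x) g)).
- by rewrite (near_eq_derive (g := id) _ E) derive_id.
- exact: sn_diff.
- by rewrite (locE _ _ Ax); exact: sn_diff.
Qed.

Lemma mdiff_linear m m' (M : manifold R m) (M' : manifold R m') (f : M -> M') x :
  smooth_at (matlas M) (matlas M') f x -> linear (mdiff f x).
Proof.
move=> sf a u v; have sl := sn_loc (chart_atP x) (chart_atP (f x)) sf.
by rewrite /mdiff der_dirD ?der_dirZ//; exact: sn_diff.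
Qed.

Lemma crT_dim n d (M : CRmanifold R n d) (x : M) : \dim (crT x) = n.*2.
Proof.
have [U [X [[_ Ux] _ b]]] := crT_subbundle x.
exact: size_basis (b x Ux).
Qed.

(** The differential of [f] embeds each complex tangent space into one of at
    most the same dimension, hence onto it, so the inverse preserves the CR
    structure. *)
Lemma diffeo_cr n d n' d' (M : CRmanifold R n d) (M' : CRmanifold R n' d')
    (U V : set M) (U' : set M') (f : M -> M') :
  (n' <= n)%N -> U `<=` V -> cr_map V f -> diffeo U U' f -> cr_diffeo U U' f.
Proof.
move=> nn UV [fs fT fJ] [oU oU' sf [g [gf fg] sg]]; split=> //.
  by split=> // x u /UV; [exact: fT|exact: fJ].
exists g => //.
(* The image of [crT (g y)] is all of [crT y], by comparison of dimensions. *)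
have key y u' : U' y -> u' \in crT y ->
    exists u, [/\ u \in crT (g y), mdiff f (g y) u = u' & mdiff g y u' = u].
  move=> U'y; have [Ux fx] := fg y U'y; set x := g y in Ux fx *.
  have sfx := sf x Ux.
  have sgx : smooth_at (matlas M') (matlas M) g (f x) by rewrite fx; exact: sg.
  have C u := mdiff_cancel u oU Ux (fun z Uz => (gf z Uz).2) sfx sgx.
  have lf := mdiff_linear sfx.
  pose L : {linear 'rV[R]_(n.*2 + d) -> 'rV[R]_(n'.*2 + d')} :=
    HB.pack (mdiff f x) (GRing.isLinear.Build _ _ _ _ _ lf).
  have inj : lker (linfun L) = 0%VS.
    apply/eqP; rewrite -subv0; apply/subvP => u; rewrite memv_ker lfunE /= => /eqP Lu.
    rewrite memv0 -(C u) Lu; apply/eqP.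
    have lg := mdiff_linear sgx.
    pose L' : {linear 'rV[R]_(n'.*2 + d') -> 'rV[R]_(n.*2 + d)} :=
      HB.pack (mdiff g (f x)) (GRing.isLinear.Build _ _ _ _ _ lg).
    exact: (linear0 L').
  have sub : (linfun L @: crT x <= crT (f x))%VS.
    by apply/subvP => _ /memv_imgP[u uT ->]; rewrite lfunE /=; apply: fT => //; exact: UV.
  have : (linfun L @: crT x == crT (f x))%VS.
    rewrite eqEdim sub /= limg_dim_eq ?inj ?capv0//.
    by rewrite !crT_dim leq_double.
  rewrite fx => /eqP <- /memv_imgP[u uT ->]; exists u; rewrite lfunE /=; split=> //.
  by have := C u; rewrite fx.
split.
- exact: sg.
- by move=> y u' U'y /(key y u' U'y)[u [uT _ ->]].
- move=> y u' U'y u'T; have [u [uT fu gu]] := key y u' U'y u'T.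
  have [Ux fx] := fg y U'y.
  have JuT : crJ (g y) u \in crT (g y) by exact: crJ_stable.
  have := fJ (g y) u (UV _ Ux) uT; rewrite fu fx => <-.
  have sgx : smooth_at (matlas M') (matlas M) g (f (g y)) by rewrite fx; exact: sg.
  have := mdiff_cancel (crJ (g y) u) oU Ux (fun z Uz => (gf z Uz).2) (sf _ Ux) sgx.
  by rewrite fx gu.
Qed.

End CRDiffeo.

(** * CR-maps as functions of their jets *)

Theorem corollary1p5 (R : realType) (n d n' d' : nat)
    (M : CRmanifold R n d) (M' : CRmanifold R n' d')
    (dim_eq : (n.*2 + d = n'.*2 + d')%N)
    (crdim_le : (n' <= n)%N)
    (r : nat) (r_gt0 : (0 < r)%N)
    (Phi : jet M M' r -> jet M M' r.+1)
    (Phi_smooth : smooth_on (jatlas M M' r) (jatlas M M' r.+1)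
                    (invertible_jet M M' r) Phi)
    (Phi_complete : forall (U : set M) (U' : set M') (f : M -> M'),
       cr_diffeo U U' f ->
       forall (x : M) (fx : smooth_at (matlas M) (matlas M') f x),
         U x -> jet_at r.+1 fx = Phi (jet_at r fx))
    (p : M) (p' : M') :
  exists (Omega : set (M * jet M M' r)) (Psi : M * jet M M' r -> M'),
    [/\ open Omega,
        Omega `<=` [set z | invertible_jet M M' r z.2],
        [set p] `*` invertible_jet_fiber p p' `<=` Omega,
        smooth_on (prod_atlas (matlas M) (jatlas M M' r)) (matlas M') Omega Psi
      & forall (q : M) (V : set M) (f : M -> M')
          (fq : smooth_at (matlas M) (matlas M') f q),
          open_nbhs q V -> cr_map V f -> Omega (q, jet_at r fq) ->
          \forall x \near q, f x = Psi (x, jet_at r fq)].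
Proof.
have [W [Psi [oO iO fO sP solP]]] :=
  complete_system_param dim_eq r_gt0 Phi_smooth p p'.
exists W, Psi; split=> // q V f fq qV fcr Oq.
have [U [U' [Uq UV fd]]] :=
  invertible_jet_diffeo dim_eq r_gt0 (open_nbhs_nbhs qV) (iO _ Oq).
have fcd := diffeo_cr crdim_le UV fcr fd.
apply: (solP f q fq U) => // [|x fx Ux]; last exact: Phi_complete fcd x fx Ux.
by apply: open_nbhs_nbhs; split=> //; case: fd.
Qed.
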